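(* Let $\omega<0$ and let $\Phi\in H^2_{\rm NK}(\mathcal{T})$ be the real positive solution of the stationary NLS equation $-\Delta\Phi-3\Phi^5=\omega\Phi$ given by $\Phi=\left(\tfrac13\mathcal{B}(\omega)\right)^{1/4}\Psi$, where $\Psi$ is a global minimizer (chosen real and positive) of $$\mathcal{B}(\omega)=\inf_{U\in H^1_{\rm C}(\mathcal{T})}\left\{B_\omega(U):\ \|U\|_{L^6(\mathcal{T})}=1\right\}.$$ Let $\mathcal{L}:H^2_{\rm NK}(\mathcal{T})\subset L^2(\mathcal{T})\to L^2(\mathcal{T})$ be the self-adjoint operator $\mathcal{L}=-\Delta-\omega-15\Phi^4$. Then, for every $\omega<0$, $n(\mathcal{L})=1$ and $z(\mathcal{L})=0$.
   Context: The tadpole graph $\mathcal{T}$ consists of a circle, identified with $[-\pi,\pi]$ with both end points attached to a single vertex, and a half-line $[0,\infty)$ attached at $0$ to the same vertex. Functions on $\mathcal{T}$ are pairs $U=(u,v)$ with $u$ on $[-\pi,\pi]$ and $v$ on $[0,\infty)$; $\|U\|_{L^q(\mathcal{T})}^q=\|u\|_{L^q(-\pi,\pi)}^q+\|v\|_{L^q(0,\infty)}^q$, and $\nabla U=(u',v')$, $\Delta U=(u'',v'')$ componentwise. $H^1_{\rm C}(\mathcal{T})$ is the space of $(u,v)\in H^1(-\pi,\pi)\times H^1(0,\infty)$ with $u(\pi)=u(-\pi)=v(0)$. $H^2_{\rm NK}(\mathcal{T})$ is the space of $(u,v)\in H^2(-\pi,\pi)\times H^2(0,\infty)$ satisfying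 $u(\pi)=u(-\pi)=v(0)$ and $u'(\pi)-u'(-\pi)=v'(0)$. $B_\omega(U):=\|\nabla U\|_{L^2(\mathcal{T})}^2-\omega\|U\|_{L^2(\mathcal{T})}^2$. For every $\omega<0$ a global minimizer $\Psi$ exists; $\Phi=(u,v)$ is real up to phase rotation, positive up to sign, $u$ is even on $[-\pi,\pi]$, $u$ is monotonically decreasing on $[0,\pi]$ and $v$ on $[0,\infty)$. $n(\mathcal{L})$ is the Morse index (number of negative eigenvalues of $\mathcal{L}$ counted with multiplicity) and $z(\mathcal{L})$ is the multiplicity of the zero eigenvalue of $\mathcal{L}$ (equal to $0$ if $0$ is not an eigenvalue). *)

(* Defs.v *)
From HB Require Import structures.
From mathcomp Require Import all_boot all_order all_algebra.
From mathcomp Require Import all_classical all_reals all_analysis.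
From mathcomp Require Import complex.

Set Implicit Arguments.
Unset Strict Implicit.
Unset Printing Implicit Defensive.

Import Order.TTheory GRing.Theory Num.Theory.
Import numFieldNormedType.Exports.
Import Normc.

Local Open Scope classical_set_scope.
Local Open Scope ring_scope.
Local Open Scope complex_scope.

(** Functions are total functions [R -> R[i]]; only their values on an interval [I]
    matter, and notions for complex-valued functions are imposed on the real
    and the imaginary part. *)

Definition sqintegrable (R : realType) (I : set R) (f : R -> R[i]) : Prop :=
  [/\ measurable_fun I (fun x => complex.Re (f x)),
      measurable_fun I (fun x => complex.Im (f x)) &
      (\int[lebesgue_measure]_(x in I) (normc (f x) ^+ 2)%:E < +oo)%E].

(** C^1 and C^oo test functions define the same weak derivatives. *)
Definition test_fun (R : realType) (I : set R) (phi : R -> R) : Prop :=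
  [/\ forall x, derivable phi x 1,
      continuous (derive1 phi) &
      exists a b : R, `[a, b]%classic `<=` I° /\ forall x, x \notin `[a, b] -> phi x = 0].

(** [g] is a weak derivative of [f] on [I]; used for [f] and [g] in L^2(I),
    so that all the integrals converge. *)
Definition weak_derivative (R : realType) (I : set R) (f g : R -> R[i]) : Prop :=
  forall phi : R -> R, test_fun I phi ->
    (\int[lebesgue_measure]_(x in I) (complex.Re (f x) * derive1 phi x))
      = - (\int[lebesgue_measure]_(x in I) (complex.Re (g x) * phi x))
    /\
    (\int[lebesgue_measure]_(x in I) (complex.Im (f x) * derive1 phi x))
      = - (\int[lebesgue_measure]_(x in I) (complex.Im (g x) * phi x)).

(** [f] is the continuous representative (on [I], endpoints included) of an
    element of H^1(I); this gives a meaning to its values at the endpoints. *)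
Definition H1 (R : realType) (I : set R) (f : R -> R[i]) : Prop :=
  [/\ {within I, continuous (fun x => complex.Re (f x))},
      {within I, continuous (fun x => complex.Im (f x))},
      sqintegrable I f &
      exists g, sqintegrable I g /\ weak_derivative I f g].

(** A square-integrable weak derivative of [f]; it is unique almost everywhere
    on [I], and the value is irrelevant if there is none. *)
Definition wderiv (R : realType) (I : set R) (f : R -> R[i]) : R -> R[i] :=
  xget (fun=> 0) [set g | sqintegrable I g /\ weak_derivative I f g].

(** A pair (u, v) is a family [U] indexed by the two edges:
    u = [U Circle], v = [U Ray]. *)

Variant edge := Circle | Ray.

Definition dom (R : realType) (e : edge) : set R :=
  match e with Circle => `[- pi, pi]%classic | Ray => `[0, +oo[%classic end.

Definition tadfun (R : realType) := edge -> R -> R[i].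

Definition tad_ae_eq (R : realType) (U V : tadfun R) : Prop :=
  forall e, {ae lebesgue_measure, forall x, dom e x -> U e x = V e x}.

Definition Lnorm_tad (R : realType) (q : nat) (U : tadfun R) : \bar R :=
  ((\int[lebesgue_measure]_(x in dom Circle) (normc (U Circle x) ^+ q)%:E
    + \int[lebesgue_measure]_(x in dom Ray) (normc (U Ray x) ^+ q)%:E)
   `^ (q%:R^-1))%E.

Definition nabla (R : realType) (U : tadfun R) : tadfun R :=
  fun e => wderiv (dom e) (U e).

Definition laplacian (R : realType) (U : tadfun R) : tadfun R :=
  nabla (nabla U).

Definition continuous_at_vertex (R : realType) (U : tadfun R) : Prop :=
  U Circle pi = U Circle (- pi) /\ U Circle pi = U Ray 0.

Definition H1C (R : realType) (U : tadfun R) : Prop :=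
  (forall e, H1 (dom e) (U e)) /\ continuous_at_vertex U.

(** Here [dU] is the continuous representative of the gradient of [U]. *)
Definition H2NK (R : realType) (U : tadfun R) : Prop :=
  H1C U /\
  exists dU : tadfun R,
    [/\ forall e, weak_derivative (dom e) (U e) (dU e),
        forall e, H1 (dom e) (dU e) &
        dU Circle pi - dU Circle (- pi) = dU Ray 0].

(** The norms involved are finite for [U] in H^1(T). *)
Definition B_form (R : realType) (omega : R) (U : tadfun R) : R :=
  fine (Lnorm_tad 2 (nabla U)) ^+ 2 - omega * fine (Lnorm_tad 2 U) ^+ 2.

Definition admissible (R : realType) : set (tadfun R) :=
  [set U | H1C U /\ Lnorm_tad 6 U = 1%E].

(** For [omega < 0] the set is bounded below by 0. *)
Definition calB (R : realType) (omega : R) : R :=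
  inf [set B_form omega U | U in @admissible R].

Definition global_minimizer (R : realType) (omega : R) (Psi : tadfun R) : Prop :=
  @admissible R Psi /\ B_form omega Psi = calB omega.

(** In the order of [R[i]], [0 < z] means that [z] is real and positive. *)
Definition tad_positive (R : realType) (U : tadfun R) : Prop :=
  forall e x, dom e x -> 0 < U e x.

Definition stationary_NLS (R : realType) (omega : R) (Phi : tadfun R) : Prop :=
  tad_ae_eq (fun e x => - laplacian Phi e x - 3 * Phi e x ^+ 5)
            (fun e x => omega%:C * Phi e x).

(** The domain [H2NK] of the operator is imposed in [eigenspace]. *)
Definition Lop (R : realType) (omega : R) (Phi U : tadfun R) : tadfun R :=
  fun e x =>
    - laplacian U e x - omega%:C * U e x - 15 * Phi e x ^+ 4 * U e x.

Definition eigenspace (R : realType) (omega : R) (Phi : tadfun R) (lambda : R) :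
    set (tadfun R) :=
  [set U | H2NK U /\
           tad_ae_eq (Lop omega Phi U) (fun e x => lambda%:C * U e x)].

(** Independence is in L^2(T), hence modulo equality almost everywhere. *)
Definition tad_free (R : realType) (n : nat) (F : 'I_n -> tadfun R) : Prop :=
  forall c : 'I_n -> R[i],
    tad_ae_eq (fun e x => \sum_(i < n) c i * F i e x) (fun _ _ => 0) ->
    forall i, c i = 0.

(** The dimension (possibly infinite) of a linear subspace [E] of L^2(T). *)
Definition tad_dim (R : realType) (E : set (tadfun R)) : \bar R :=
  ereal_sup [set (n%:R)%:E | n in
    [set n : nat | exists F : 'I_n -> tadfun R,
       (forall i, E (F i)) /\ tad_free F]].

(** Equal to 0 if [lambda] is not an eigenvalue. *)
Definition multiplicity (R : realType) (omega : R) (Phi : tadfun R) (lambda : R) :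
    \bar R :=
  tad_dim (eigenspace omega Phi lambda).

Definition morse_index (R : realType) (omega : R) (Phi : tadfun R) : \bar R :=
  \esum_(lambda in [set l : R | l < 0]) multiplicity omega Phi lambda.

Definition nullity (R : realType) (omega : R) (Phi : tadfun R) : \bar R :=
  multiplicity omega Phi 0.

(* Main.v *)
Require Import Defs.
From HB Require Import structures.
From mathcomp Require Import all_boot all_order all_algebra.
From mathcomp Require Import all_classical all_reals all_analysis.
From mathcomp Require Import measurable_realfun.
From mathcomp Require Import complex ring lra.

(** Let m = - omega and Phi = (u, v). Three facts make the theorem true.

    The second variation. The homogeneous form B(U)^3 >= calB^3 N(U), where N is the integral of
    the sixth power, of the minimization problem is an equality at Phi. To second order, the
    quadratic form of L is therefore nonnegative on the functions orthogonal to Phi^5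
    ([second_variation]). So a combination of negative eigenfunctions which is orthogonal to
    Phi^5 is zero, and there is at most one negative eigenvalue, which is simple
    ([negative_mode], [negative_modes]).

    The explicit solutions of the linearized equation. On the circle these are u', which is odd,
    and an even one, s, the derivative of the even solutions with respect to their amplitude
    ([even_solution]); on the ray, v' is the one which decays. The Wronskians of an element of
    the kernel with the three turn the vertex conditions into a linear system for its value and
    slope at the vertex, of determinant D = s(pi) u''(pi) - 4 s'(pi) u'(pi); so the kernel is
    trivial if D is not zero ([kernel_trivial]). In fact D < 0, by the formula for s, provided that
    u' < 0 on (0, pi] and v' < 0 on the ray. This monotonicity is again due to the second
    variation: at a zero of u' or v' the function Phi' can be cut off to give
    competitors which would make the form negative ([no_critical], [cut_competitor], [v10_le0]).

    The existence of a negative eigenvalue, by shooting. For every level l, the equation is solved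
    with even data on the circle and continued along the ray by the vertex conditions. If l is very
    negative this solution grows to + oo. At l = 0 it grows to - oo, as follows from D < 0 by the
    Wronskian with v'. Both behaviours are stable under small changes of l, so between them
    there is a level where neither takes place, and there the solution is square integrable
    ([decaying_mode], [negative_exists]).

    All this is about classical solutions. The weak ones of the statement are classical, after
    extension of both edges to the whole line, by [weak_C2]; this rests on the fundamental
    lemma of the calculus of variations ([fundamental_lemma]). Existence and continuous dependence
    for linear equations are [lin_ode_exists] and [lin_ode_bound]. *)

Set Implicit Arguments.
Unset Strict Implicit.
Unset Printing Implicit Defensive.

Import Order.TTheory GRing.Theory Num.Theory.
Import numFieldNormedType.Exports.
Import Normc.

Local Open Scope classical_set_scope.
Local Open Scope ring_scope.
Local Open Scope complex_scope.

(** * Calculus on the line *)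

Section calculus.
Context {R : realType}.
Implicit Types (f g F H : R -> R) (a b c x y d e : R).

Notation dv f x d := (is_derive (x : R) (1 : R) (f : R -> R) (d : R)).

Lemma dv_eq f x d e : dv f x d -> d = e -> dv f x e.
Proof. by move=> ? <-. Qed.

Lemma dv_uniq f x d e : dv f x d -> dv f x e -> d = e.
Proof. by move=> [_ <-] [_ <-]. Qed.

Lemma dv_cst c x : dv (fun=> c) x 0.
Proof. exact: is_derive_cst. Qed.

Lemma dv_id x : dv (fun y => y) x 1.
Proof. exact: is_derive_id. Qed.

Lemma dvD f g x d e : dv f x d -> dv g x e -> dv (fun y => f y + g y) x (d + e).
Proof. by move=> ? ?; exact: is_deriveD. Qed.

Lemma dvN f x d : dv f x d -> dv (fun y => - f y) x (- d).
Proof. by move=> ?; exact: is_deriveN. Qed.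

Lemma dvB f g x d e : dv f x d -> dv g x e -> dv (fun y => f y - g y) x (d - e).
Proof. by move=> ? ?; exact: is_deriveB. Qed.

Lemma dvM f g x d e : dv f x d -> dv g x e ->
  dv (fun y => f y * g y) x (f x * e + g x * d).
Proof. by move=> ? ?; exact: is_deriveM. Qed.

Lemma dvX f n x d : dv f x d -> dv (fun y => f y ^+ n) x (n%:R * f x ^+ n.-1 * d).
Proof.
move=> df; have := @is_deriveX R R f n x 1 d df.
by rewrite (_ : f ^+ n = (fun y => f y ^+ n)) //; apply/funext => y; rewrite exprfctE.
Qed.

Lemma dvV f x d : f x != 0 -> dv f x d -> dv (fun y => (f y)^-1) x (- d / f x ^+ 2).
Proof.
move=> f0 df; apply: (dv_eq (is_deriveV f0 df)).
by rewrite /GRing.scale /= mulNr mulNr mulrC.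
Qed.

Lemma dv_comp f g x d e : dv f (g x) d -> dv g x e -> dv (fun y => f (g y)) x (d * e).
Proof. by move=> ? ?; exact: is_derive1_comp. Qed.

Lemma dv_neg f x d : dv f (- x) d -> dv (fun y => f (- y)) x (- d).
Proof.
move=> h; have := @dv_comp f (fun y => - y) x _ _ h (dvN (dv_id x)).
by rewrite mulrN mulr1.
Qed.

Lemma dv_cont {f x d} : dv f x d -> {for x, continuous f}.
Proof.
by move=> [df _]; apply: differentiable_continuous; apply/derivable1_diffP.
Qed.

Lemma dv_within f a b (df : R -> R) : (forall x, a <= x <= b -> dv f x (df x)) ->
  {within `[a, b], continuous f}.
Proof.
move=> h; apply/continuous_in_subspaceT => x.
by rewrite inE /= in_itv /= => /h /dv_cont.
Qed.

Lemma dv_near {f g x d} : {near x, f =1 g} -> dv f x d -> dv g x d.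
Proof. by move=> fg; apply: near_eq_is_derive => //; exact: oner_neq0. Qed.

Lemma mvt f (df : R -> R) a b : a < b -> (forall x, a <= x <= b -> dv f x (df x)) ->
  exists2 c, a < c < b & f b - f a = df c * (b - a).
Proof.
move=> ab h; have [c|//|] := @MVT R f df a b ab.
- by rewrite in_itv /= => /andP[/ltW ac /ltW cb]; apply: h; rewrite ac.
- exact: dv_within h.
- by move=> c; rewrite in_itv /= => cab e; exists c.
Qed.

Lemma dv_ge0_le f (df : R -> R) a b : a <= b ->
  (forall x, a <= x <= b -> dv f x (df x)) ->
  (forall x, a < x < b -> 0 <= df x) -> f a <= f b.
Proof.
rewrite le_eqVlt => /orP[/eqP-> //|ab] h h0.
have [c cab e] := mvt ab h.
by rewrite -subr_ge0 e mulr_ge0 ?h0 // subr_ge0 ltW.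
Qed.

Lemma dv_gt0_lt f (df : R -> R) a b : a < b ->
  (forall x, a <= x <= b -> dv f x (df x)) ->
  (forall x, a < x < b -> 0 < df x) -> f a < f b.
Proof.
move=> ab h h0; have [c cab e] := mvt ab h.
by rewrite -subr_gt0 e mulr_gt0 ?h0 // subr_gt0.
Qed.

Lemma dv_le0_ge f (df : R -> R) a b : a <= b ->
  (forall x, a <= x <= b -> dv f x (df x)) ->
  (forall x, a < x < b -> df x <= 0) -> f b <= f a.
Proof.
move=> ab h h0; rewrite -lerN2; apply: (@dv_ge0_le (fun x => - f x) (fun x => - df x) _ _ ab).
  by move=> x /h; exact: dvN.
by move=> x /h0; rewrite oppr_ge0.
Qed.

Lemma dv_lt0_gt f (df : R -> R) a b : a < b ->
  (forall x, a <= x <= b -> dv f x (df x)) ->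
  (forall x, a < x < b -> df x < 0) -> f b < f a.
Proof.
move=> ab h h0; rewrite -ltrN2; apply: (@dv_gt0_lt (fun x => - f x) (fun x => - df x) _ _ ab).
  by move=> x /h; exact: dvN.
by move=> x /h0; rewrite oppr_gt0.
Qed.

Lemma dv0_cst f a b : (forall x, a <= x <= b -> dv f x 0) ->
  forall x y, a <= x <= b -> a <= y <= b -> f x = f y.
Proof.
move=> h x y hx hy.
wlog xy : x y hx hy / x <= y.
  by move=> W; case: (leP x y) => [/W-> //|/ltW /W->].
move: hx hy => /andP[ax xb] /andP[ay yb].
have h' z : x <= z <= y -> dv f z 0.
  by move=> /andP[xz zy]; apply: h; rewrite (le_trans ax xz) (le_trans zy yb).
by apply/eqP; rewrite eq_le; apply/andP; split;
  [exact: (dv_ge0_le xy h')|exact: (dv_le0_ge xy h')].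
Qed.

Lemma ivt f a b v : a <= b -> (forall x, a <= x <= b -> {for x, continuous f}) ->
  f a <= v <= f b \/ f b <= v <= f a -> exists2 c, a <= c <= b & f c = v.
Proof.
move=> ab cf hv; have [||c] := @IVT R f a b v ab.
- by apply/continuous_in_subspaceT => x; rewrite inE /= in_itv /=; exact: cf.
- rewrite ge_min le_max; case: hv => /andP[h1 h2]; rewrite h1 h2 ?orbT //.
- by rewrite in_itv /= => hc e; exists c.
Qed.

(** A primitive on the whole line, glued from the integrals over [-N, x]: these
    differ by constants, so their increments from 0 do not depend on N. *)
Lemma primitive (h : R -> R) : continuous h ->
  exists2 H, H 0 = 0 & forall x, dv H x (h x).
Proof.
move=> ch.
pose A (N : R) x := \int[lebesgue_measure]_(t in `[- N, x]) h t.
have ih a b : lebesgue_measure.-integrable `[a, b] (EFin \o h).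
  apply: continuous_compact_integrable; first exact: segment_compact.
  exact: continuous_subspaceT.
have dA N x : - N < x -> dv (A N) x (h x).
  move=> Nx; have [] := @continuous_FTC1_closed R h (- N) x (x + 1) _ (ih _ _) Nx (ch x).
    by rewrite ltrDl.
  by move=> dA <-; rewrite derive1E; exact/derivableP.
pose H x := A (`|x| + 1) x - A (`|x| + 1) 0.
have HE N x : `|x| < N -> H x = A N x - A N 0.
  move=> xN.
  pose M := Num.min (`|x| + 1) N.
  have xM : `|x| < M by rewrite lt_min xN ltrDl ltr01.
  have [M1 M2] : M <= `|x| + 1 /\ M <= N by rewrite !ge_min !lexx orbT.
  pose D y := A (`|x| + 1) y - A N y.
  have dD y : - `|x| <= y <= `|x| -> dv D y 0.
    move=> /andP[y1 y2]; rewrite -(subrr (h y)).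
    by apply: dvB; apply: dA; move: xM xN M1 M2 y1 y2;
      move: (normr_ge0 x); generalize `|x|; move=> *; lra.
  have hx : - `|x| <= x <= `|x| by rewrite -ler_norml.
  have h0 : - `|x| <= 0 <= `|x| by rewrite oppr_le0 normr_ge0.
  have := dv0_cst dD hx h0.
  by rewrite /D /H; move: (A _ _) (A _ _) (A _ _) (A _ _) => *; lra.
exists H.
  by rewrite /H subrr.
move=> x.
pose N := `|x| + 2.
have dN : dv (fun y => A N y - A N 0) x (h x).
  rewrite -[h x]subr0; apply: dvB (dv_cst _ _); apply: dA.
  by rewrite /N; have := ler_norm (- x); rewrite normrN; move: `|x| => *; lra.
apply: dv_near dN; near=> y.
rewrite (HE N) // /N; near: y.
have xx : (fun y : R => y) @ x --> x by exact: cvg_id.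
by apply: (cvgr_norm_lt _ xx); rewrite ltrDl.
Unshelve. all: by end_near. Qed.

End calculus.
Notation dv f x d := (is_derive x 1 f d) (only parsing).

(** * Linear second order equations *)

Section ode.
Context {R : realType}.
Implicit Types (f g F H w : R -> R) (a b c x y d e : R).

Lemma dv_exp (k : R) x : dv (fun y => expR (k * y)) x (k * expR (k * x)).
Proof.
have h : dv (fun y : R => k * y) x k.
  by apply: dv_eq (dvM (dv_cst k x) (dv_id x)) _; rewrite mulr1 mulr0 addr0.
by apply: dv_eq (@dv_comp R expR (fun y => k * y) x _ _ (is_derive_expR _) h) _; rewrite mulrC.
Qed.

(** The function (f + c) exp(- k x) is nonincreasing. *)
Lemma gronwall f (df : R -> R) (k c a b : R) : a <= b ->
  (forall x, a <= x <= b -> dv f x (df x)) ->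
  (forall x, a < x < b -> df x <= k * f x + k * c) ->
  f b + c <= (f a + c) * expR (k * (b - a)).
Proof.
move=> ab h h1.
pose g x := (f x + c) * expR (- k * x).
have dg x : a <= x <= b ->
    dv g x (expR (- k * x) * (df x - k * f x - k * c)).
  move=> hx; apply: dv_eq.
    exact: dvM (dvD (h _ hx) (dv_cst c x)) (dv_exp (- k) x).
  rewrite addr0 /=; set E := expR _; by ring.
have : g b <= g a.
  apply: (dv_le0_ge ab dg) => x /h1 hx.
  by rewrite pmulr_rle0 ?expR_gt0 //; lra.
rewrite /g.
rewrite -(ler_pM2r (expR_gt0 (k * b))) -!mulrA -!expRD mulNr addNr expR0 mulr1.
by move/le_trans; apply; rewrite le_eqVlt; apply/orP; left; apply/eqP; congr (_ * expR _); ring.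
Qed.

(** Gronwall's inequality for w^2 + w'^2. It is used twice: for the difference of solutions of
    two equations, [r] being the effect of the change of potential, and with [e = 0], where
    it is uniqueness. *)
Lemma lin_ode_bound w w1 (q r : R -> R) (C e a b : R) : a <= b -> 0 <= C ->
  (forall x, a <= x <= b -> dv w x (w1 x)) ->
  (forall x, a <= x <= b -> dv w1 x (q x * w x + r x)) ->
  (forall x, a <= x <= b -> `|q x| <= C) ->
  (forall x, a <= x <= b -> `|r x| <= e) ->
  w b ^+ 2 + w1 b ^+ 2 <=
    (w a ^+ 2 + w1 a ^+ 2 + e ^+ 2) * expR ((C + 2) * (b - a)).
Proof.
move=> ab C0 dw dw1 hq hr.
pose f x := w x ^+ 2 + w1 x ^+ 2.
have df x : a <= x <= b ->
    dv f x (2 * w x * w1 x + 2 * w1 x * (q x * w x + r x)).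
  by move=> hx; apply: dv_eq (dvD (dvX 2 (dw _ hx)) (dvX 2 (dw1 _ hx))) _.
have : f b + e ^+ 2 <= (f a + e ^+ 2) * expR ((C + 2) * (b - a)).
  apply: (gronwall ab df).
  move=> x /andP[/ltW ax /ltW xb] /=; have hx : a <= x <= b by rewrite ax.
  move: (hq x hx) (hr x hx); rewrite !ler_norml => /andP[q1 q2] /andP[r1 r2].
  have h1 : 2 * w x * w1 x * (1 + q x) <= (1 + C) * (w x ^+ 2 + w1 x ^+ 2).
    have k1 : 0 <= (1 + q x + (1 + C)) * (w x - w1 x) ^+ 2 by rewrite mulr_ge0 ?sqr_ge0 //; lra.
    have k2 : 0 <= ((1 + C) - (1 + q x)) * (w x + w1 x) ^+ 2 by rewrite mulr_ge0 ?sqr_ge0 //; lra.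
    have k3 : 0 <= (1 + C + (1 + q x)) * (w x - w1 x) ^+ 2 by rewrite mulr_ge0 ?sqr_ge0 //; lra.
    nra.
  have h2 : 2 * w1 x * r x <= w1 x ^+ 2 + e ^+ 2.
    have k1 : r x ^+ 2 <= e ^+ 2 by rewrite !expr2; nra.
    have := sqr_ge0 (w1 x - r x); nra.
  have k4 := sqr_ge0 (w x); have k5 := sqr_ge0 e.
  have k6 : 0 <= C * e ^+ 2 by rewrite mulr_ge0.
  rewrite /f; lra.
by apply: le_trans; rewrite lerDl sqr_ge0.
Qed.

Lemma lin_ode_uniq w w1 (q : R -> R) (C a b c : R) : 0 <= C ->
  (forall x, a <= x <= b -> dv w x (w1 x)) ->
  (forall x, a <= x <= b -> dv w1 x (q x * w x)) ->
  (forall x, a <= x <= b -> `|q x| <= C) ->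
  a <= c <= b -> w c = 0 -> w1 c = 0 ->
  forall x, a <= x <= b -> w x = 0 /\ w1 x = 0.
Proof.
move=> C0 dw dw1 hq /andP[ac cb] wc w1c x /andP[ax xb].
suff : w x ^+ 2 + w1 x ^+ 2 <= 0.
  move=> h; have h1 := sqr_ge0 (w x); have h2 := sqr_ge0 (w1 x).
  by split; apply/eqP; rewrite -sqrf_eq0; apply/eqP; lra.
have [cx|/ltW xc] := leP c x.
  have hx y : c <= y <= x -> a <= y <= b by case/andP=> ? ?; apply/andP; split; lra.
  have := @lin_ode_bound w w1 q (fun=> 0) C 0 c x cx C0 _ _ _ _.
  rewrite wc w1c expr0n /= !addr0 mul0r; apply.
  - by move=> y /hx; exact: dw.
  - by move=> y /hx; rewrite addr0; exact: dw1.
  - by move=> y /hx; exact: hq.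
  - by move=> y _; rewrite normr0.
(* To the left of c, time is reversed. *)
have hx y : - c <= y <= - x -> a <= - y <= b by case/andP=> ? ?; apply/andP; split; lra.
have := @lin_ode_bound (fun y => w (- y)) (fun y => - w1 (- y)) (fun y => q (- y))
  (fun=> 0) C 0 (- c) (- x) _ C0 _ _ _ _.
rewrite !opprK wc w1c oppr0 expr0n /= !addr0 mul0r sqrrN; apply.
- by rewrite lerN2.
- by move=> y /hx; move=> /dw; exact: dv_neg.
- move=> y /hx /dw1 h; rewrite addr0; apply: dv_eq (dvN (dv_neg h)) _.
  by rewrite opprK.
- by move=> y /hx; exact: hq.
- by move=> y _; rewrite normr0.
Qed.

End ode.

(** ** Existence of solutions *)

Section initial_value_problem.
Context {R : realType}.
Implicit Types (f g h : R -> R) (a b c x y d e : R).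

Local Notation hn n := ((2^-1 : R) ^+ n).

Lemma hn_gt0 n : 0 < hn n. Proof. by rewrite exprn_gt0 // invr_gt0. Qed.

Lemma hn_small (C e : R) : 0 < e -> exists N, C * hn N < e.
Proof.
move=> e0; have h : `|(2^-1 : R)| < 1 by rewrite ger0_norm ?invr_ge0 // invf_lt1 // ltr1n.
have := cvg_geometric (`|C| + 1) h.
move=> /cvgr0_norm_lt /(_ _ e0) [N _ /(_ N (leqnn N))] /=.
rewrite normrM normrX (ger0_norm (_ : 0 <= 2^-1)) ?invr_ge0 // => hN.
exists N; apply: le_lt_trans hN; rewrite ler_wpM2r ?(ltW (hn_gt0 _)) //.
apply: le_trans (ler_norm C) _; apply: le_trans _ (ler_norm _).
by rewrite lerDl.
Qed.

Lemma hn_le0 (C t : R) : (forall n, t <= C * hn n) -> t <= 0.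
Proof.
move=> h; rewrite leNgt; apply/negP => t0.
by have [N] := hn_small C t0; rewrite ltNge h.
Qed.

Lemma hn_eq (C x y : R) : (forall n, `|x - y| <= C * hn n) -> x = y.
Proof. by move=> /hn_le0; rewrite normr_le0 subr_eq0 => /eqP. Qed.

(** The intervals of radius 2 B / 2^n around Y n are nested. *)
Lemma geo_lim (Y : nat -> R) (B : R) :
  (forall n, `|Y n.+1 - Y n| <= B * hn n) ->
  exists l, forall n, `|l - Y n| <= 2 * B * hn n.
Proof.
move=> h.
pose lo n := Y n - 2 * B * hn n; pose up n := Y n + 2 * B * hn n.
have B0 : 0 <= B by have := le_trans (normr_ge0 _) (h 0%N); rewrite expr0 mulr1.
have hs n : hn n.+1 = hn n / 2 by rewrite exprSr.
have lo_nd m n : (m <= n)%N -> lo m <= lo n.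
  elim: n => [|n IH]; first by rewrite leqn0 => /eqP->.
  rewrite leq_eqVlt => /orP[/eqP-> //|]; rewrite ltnS => /IH /le_trans; apply.
  by have := h n; rewrite /lo hs ler_norml => /andP[]; lra.
have up_ni m n : (m <= n)%N -> up n <= up m.
  elim: n => [|n IH]; first by rewrite leqn0 => /eqP->.
  rewrite leq_eqVlt => /orP[/eqP-> //|]; rewrite ltnS => /IH; apply: le_trans.
  by have := h n; rewrite /up hs ler_norml => /andP[]; lra.
have lu m n : lo m <= up n.
  apply: (@le_trans _ _ (lo (maxn m n))); first by apply: lo_nd; rewrite leq_maxl.
  apply: (@le_trans _ _ (up (maxn m n))); last by apply: up_ni; rewrite leq_maxr.
  rewrite /lo /up; have : 0 <= 2 * B * hn (maxn m n) by rewrite !mulr_ge0 // (ltW (hn_gt0 _)).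
  lra.
exists (sup (range lo)) => n.
have h1 : lo n <= sup (range lo).
  by apply: ub_le_sup; [exists (up 0%N) => _ [m _ <-]|exists n].
have h2 : sup (range lo) <= up n.
  by apply: ge_sup; [exists (lo 0%N); exists 0%N|move=> _ [m _ <-]].
by move: h1 h2; rewrite /lo /up ler_norml => ? ?; apply/andP; split; lra.
Qed.

Lemma unif_lim_continuous (F : nat -> R -> R) f :
  (forall n, continuous (F n)) ->
  (forall L : R, exists C : R, forall n x, `|x| <= L -> `|f x - F n x| <= C * hn n) ->
  continuous f.
Proof.
move=> cF hC x.
apply/cvgrPdist_lt => e e0.
have [C hC'] := hC (`|x| + 1).
have e3 : 0 < e / 3 by rewrite divr_gt0.
have [N hN] := hn_small C e3.
have := cF N x => /cvgrPdist_lt /(_ _ e3) h.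
near=> y.
have hy : `|F N x - F N y| < e / 3 by near: y.
have hxy : `|y| <= `|x| + 1.
  apply: ltW; near: y.
  have xx : (fun y : R => y) @ x --> x by exact: cvg_id.
  by apply: (cvgr_norm_lt _ xx); rewrite ltrDl.
have h1 : `|f x - F N x| <= C * hn N by apply: hC'; rewrite lerDl.
have h2 := hC' N y hxy.
have -> : f x - f y = (f x - F N x) + (F N x - F N y) - (f y - F N y) by ring.
apply: le_lt_trans (ler_normB _ _) _.
have := ler_normD (f x - F N x) (F N x - F N y).
lra.
Unshelve. all: by end_near. Qed.

(** Integrating from 0 against the weight exp(2 K |x|) gains the factor 1 / (2 K), which
    beats the Lipschitz constant K by a factor 2. *)
Lemma dv_exp_bound f (df : R -> R) (K c L : R) : 0 <= K -> f 0 = 0 ->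
  (forall x, dv f x (df x)) ->
  (forall x, `|x| <= L -> `|df x| <= K * (c * expR (2 * K * `|x|))) ->
  0 <= c ->
  forall x, `|x| <= L -> `|f x| <= c / 2 * expR (2 * K * `|x|).
Proof.
move=> K0 f0 hf hdf c0.
have pos f' df' x : f' 0 = 0 -> (forall x, dv f' x (df' x)) ->
    (forall x, `|x| <= L -> `|df' x| <= K * (c * expR (2 * K * `|x|))) ->
    0 <= x -> x <= L -> f' x <= c / 2 * expR (2 * K * x).
  move=> f0' hf' hdf' x0 xL.
  pose g x := c / 2 * expR (2 * K * x) - f' x.
  have dg y : dv g y (c * (K * expR (2 * K * y)) - df' y).
    apply: dv_eq (dvB (dvM (dv_cst (c / 2) y) (dv_exp (2 * K) y)) (hf' y)) _.
    by rewrite mulr0 addr0; congr (_ - _); field.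
  have : g 0 <= g x.
    apply: (dv_ge0_le x0 (fun y _ => dg y)) => y /andP[y0 yx].
    have := hdf' y; rewrite ger0_norm ?(ltW y0) // => /(_ (ltW (lt_le_trans yx xL))).
    rewrite ler_norml => /andP[_]; rewrite subr_ge0 => /le_trans; apply.
    by rewrite mulrCA.
  by rewrite /g f0' mulr0 expR0; lra.
move=> x xL; rewrite ler_norml; have [x0|/ltW x0] := leP 0 x.
  move: xL; rewrite ger0_norm // => xL.
  rewrite (pos f df) // andbT lerNl.
  apply: (pos (fun y => - f y) (fun y => - df y)) => //; first by rewrite f0 oppr0.
  by move=> y /hdf; rewrite normrN.
move: xL; rewrite ler0_norm // => xL; have nx0 : 0 <= - x by rewrite oppr_ge0.
apply/andP; split.
  rewrite lerNl; have := @pos (fun y => - f (- y)) (fun y => df (- y)) (- x).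
  rewrite opprK; apply => //.
  - by rewrite oppr0 f0 oppr0.
  - by move=> y; apply: dv_eq (dvN (dv_neg (hf (- y)))) _; rewrite opprK.
  - by move=> y yL; have := hdf (- y); rewrite normrN; exact.
have := @pos (fun y => f (- y)) (fun y => - df (- y)) (- x).
rewrite opprK; apply => //.
- by rewrite oppr0 f0.
- by move=> y; exact: dv_neg (hf (- y)).
- by move=> y yL; have := hdf (- y); rewrite !normrN; exact.
Qed.

(** Picard iteration for the first order system (y, y')' = (y', q y); weighting by
    exp(2 K |x|) makes every step a contraction by the factor 1/2. *)
Theorem lin_ode_exists (q : R -> R) (a b : R) : continuous q ->
  exists y y1 : R -> R, [/\ y 0 = a, y1 0 = b,
    forall x, dv y x (y1 x) & forall x, dv y1 x (q x * y x)].
Proof.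
move=> cq.
pose prim h : R -> R := xget (fun=> 0) [set H | H 0 = 0 /\ forall x, dv H x (h x)].
have primP h : continuous h -> prim h 0 = 0 /\ forall x, dv (prim h) x (h x).
  move=> /primitive[H H0 dH].
  by apply: (@xgetPex _ (fun=> 0) [set H | H 0 = 0 /\ forall x, dv H x (h x)]); exists H.
pose step (p : (R -> R) * (R -> R)) :=
  (fun x => a + prim p.2 x, fun x => b + prim (fun x => q x * p.1 x) x).
pose p n := iter n step (fun=> a, fun=> b).
pose Y n := (p n).1; pose W n := (p n).2.
have YS n x : Y n.+1 x = a + prim (W n) x by [].
have WS n x : W n.+1 x = b + prim (fun x => q x * Y n x) x by [].
have cont n : continuous (Y n) /\ continuous (W n).
  elim: n => [|n [IY IW]]; first by split=> x; exact: cst_continuous.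
  have [_ dY] := primP _ IW.
  have [_ dW] := primP (fun x => q x * Y n x) (fun x => continuousM (cq x) (IY x)).
  split=> x.
    exact: dv_cont (dvD (dv_cst a x) (dY x)).
  exact: dv_cont (dvD (dv_cst b x) (dW x)).
have cqY n : continuous (fun x => q x * Y n x).
  by move=> x; have [IY _] := cont n; exact: continuousM (cq x) (IY x).
have cW n : continuous (W n) by case: (cont n).
have cY n : continuous (Y n) by case: (cont n).
have dY n x : dv (Y n.+1) x (W n x).
  have [_ d] := primP _ (cW n); apply: dv_eq (dvD (dv_cst a x) (d x)) _.
  by rewrite add0r.
have dW n x : dv (W n.+1) x (q x * Y n x).
  have [_ d] := primP _ (cqY n); apply: dv_eq (dvD (dv_cst b x) (d x)) _.
  by rewrite add0r.
have Y0 n : Y n 0 = a.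
  by case: n => // n; rewrite YS (primP _ (cW n)).1 addr0.
have W0 n : W n 0 = b.
  by case: n => // n; rewrite WS (primP _ (cqY n)).1 addr0.
have [K hK] : exists K : R -> R, forall L : R, 1 <= K L /\ forall x, `|x| <= L -> `|q x| <= K L.
  suff h : forall L : R, exists K : R, 1 <= K /\ forall x, `|x| <= L -> `|q x| <= K.
    by have [K hK] := choice h; exists K.
  move=> L; have [L0|L0] := ltP L 0.
    by exists 1; split=> // x xL; have := normr_ge0 x; lra.
  have LL : - L <= L by lra.
  have cN : {within `[- L, L], continuous (fun x => `|q x|)}.
    apply: continuous_subspaceT => x; apply: continuous_comp (cq x) _.
    exact: norm_continuous.
  have [c _ hc] := EVT_max LL cN.
  exists (`|q c| + 1); split; first by rewrite lerDr.
  move=> x xL; apply: le_trans (hc x _) _; last by rewrite lerDl.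
  by rewrite in_itv /= -ler_norml.
have geo (L : R) : exists B, forall n x, `|x| <= L ->
    `|Y n.+1 x - Y n x| <= B * hn n /\ `|W n.+1 x - W n x| <= B * hn n.
  have [K1 hq] := hK L; set k := K L in K1 hq.
  have k0 : 0 <= k by lra.
  pose M := (`|a| + `|b|) * 2.
  have M0 : 0 <= M by rewrite mulr_ge0 // addr_ge0.
  exists (M * expR (2 * k * L)) => n x xL.
  suff : `|Y n.+1 x - Y n x| <= M * hn n * expR (2 * k * `|x|) /\
         `|W n.+1 x - W n x| <= M * hn n * expR (2 * k * `|x|).
    have h : M * hn n * expR (2 * k * `|x|) <= M * expR (2 * k * L) * hn n.
      rewrite mulrAC ler_wpM2r ?(ltW (hn_gt0 _)) // ler_wpM2l // ler_expR.
      by rewrite ler_wpM2l // mulr_ge0.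
    by move=> [h1 h2]; split; [exact: le_trans h1 h|exact: le_trans h2 h].
  have e1 (z : R) : 1 <= expR (2 * k * `|z|).
    by rewrite -expR0 ler_expR !mulr_ge0.
  have S0 n' (z : R) : `|z| <= L -> 0 <= M * hn n' * expR (2 * k * `|z|).
    by move=> _; rewrite !mulr_ge0 ?expR_ge0 // (ltW (hn_gt0 _)).
  elim: n x xL => [|n IH] x xL.
    have half : M * hn 0 = (2 * M) / 2 by rewrite expr0 mulr1; field.
    rewrite half; split.
      apply: (@dv_exp_bound (fun z => Y 1%N z - Y 0%N z) (fun z => b) k _ L) => //.
      - by rewrite !Y0 subrr.
      - by move=> z; apply: dv_eq (dvB (dY 0%N z) (dv_cst a z)) _; rewrite subr0.
      - move=> z _; have := e1 z; move: (normr_ge0 a) (normr_ge0 b); rewrite /M.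
        move: (expR _) => E ha hb hE.
        have : `|b| <= 2 * ((`|a| + `|b|) * 2) * E by nra.
        move=> h; apply: le_trans h _; rewrite ler_peMl //.
        by rewrite !mulr_ge0 ?addr_ge0 //; lra.
      - by rewrite mulr_ge0.
    apply: (@dv_exp_bound (fun z => W 1%N z - W 0%N z) (fun z => q z * a) k _ L) => //.
    - by rewrite !W0 subrr.
    - by move=> z; apply: dv_eq (dvB (dW 0%N z) (dv_cst b z)) _; rewrite subr0.
    - move=> z zL; have := e1 z; move: (normr_ge0 a) (normr_ge0 b); rewrite /M.
      move: (expR _) => E ha hb hE; rewrite normrM.
      apply: (@le_trans _ _ (k * `|a|)); first by rewrite ler_wpM2r // hq.
      rewrite ler_wpM2l //; nra.
    - by rewrite mulr_ge0.
  have half : M * hn n.+1 = (M * hn n) / 2 by rewrite exprSr mulrA.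
  have Mn0 : 0 <= M * hn n by rewrite mulr_ge0 // (ltW (hn_gt0 _)).
  rewrite half; split.
    apply: (@dv_exp_bound (fun z => Y n.+2 z - Y n.+1 z) (fun z => W n.+1 z - W n z) k _ L) => //.
    - by rewrite !Y0 subrr.
    - move=> z zL; apply: le_trans (IH _ zL).2 _.
      by rewrite ler_peMl // S0.
  apply: (@dv_exp_bound (fun z => W n.+2 z - W n.+1 z)
    (fun z => q z * Y n.+1 z - q z * Y n z) k _ L) => //.
  - by rewrite !W0 subrr.
  - move=> z zL; rewrite -mulrBr normrM.
    by apply: ler_pM => //; [exact: hq|exact: (IH _ zL).1].
have lims x : exists yw : R * R, exists C, forall n,
    `|yw.1 - Y n x| <= C * hn n /\ `|yw.2 - W n x| <= C * hn n.
  have [B hB] := geo `|x|.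
  have [y hy] := geo_lim (fun n => (hB n x (lexx _)).1).
  have [w hw] := geo_lim (fun n => (hB n x (lexx _)).2).
  by exists (y, w); exists (2 * B).
have [yw hyw] := choice lims.
pose y x := (yw x).1; pose w x := (yw x).2.
have unif (L : R) : exists C, forall n x, `|x| <= L ->
    `|y x - Y n x| <= C * hn n /\ `|w x - W n x| <= C * hn n.
  have [B hB] := geo L; exists (2 * B) => n x xL.
  have [C hC] := hyw x.
  have [y' hy] := geo_lim (fun n => (hB n x xL).1).
  have [w' hw] := geo_lim (fun n => (hB n x xL).2).
  have -> : y x = y'.
    apply: (@hn_eq (C + 2 * B)) => m; rewrite mulrDl.
    rewrite (_ : y x - y' = (y x - Y m x) - (y' - Y m x)); last by ring.
    by apply: le_trans (ler_normB _ _) _; apply: lerD => //; exact: (hC m).1.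
  have -> : w x = w'.
    apply: (@hn_eq (C + 2 * B)) => m; rewrite mulrDl.
    rewrite (_ : w x - w' = (w x - W m x) - (w' - W m x)); last by ring.
    by apply: le_trans (ler_normB _ _) _; apply: lerD => //; exact: (hC m).2.
  by split.
have cy : continuous y.
  apply: (unif_lim_continuous cY) => L; have [C hC] := unif L; exists C => n x xL.
  exact: (hC n x xL).1.
have cw : continuous w.
  apply: (unif_lim_continuous cW) => L; have [C hC] := unif L; exists C => n x xL.
  exact: (hC n x xL).2.
(* The equations are passed to the limit in integrated form, by the mean value theorem. *)
have pass (F f : nat -> R -> R) (f0 g : R -> R) (c : R) : continuous g ->
    (forall n x, dv (F n.+1) x (f n x)) -> (forall n, F n 0 = c) ->
    (forall L : R, exists C : R, forall n x, `|x| <= L ->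
       `|f0 x - F n x| <= C * hn n /\ `|g x - f n x| <= C * hn n) ->
    f0 0 = c /\ forall x, dv f0 x (g x).
  move=> cg dF F0 hC; have [G G0 dG] := primitive cg.
  suff E x : f0 x = c + G x.
    have -> : f0 = (fun x => c + G x) by apply/funext.
    by split=> [|x]; [rewrite G0 addr0|apply: dv_eq (dvD (dv_cst c x) (dG x)) _; rewrite add0r].
  have [C hC'] := hC `|x|.
  have C0 : 0 <= C.
    by have := le_trans (normr_ge0 _) (hC' 0%N x (lexx _)).1; rewrite expr0 mulr1.
  apply: (@hn_eq (C * (1 + `|x|))) => n.
  have D0 : G 0 - F n.+1 0 = - c by rewrite G0 F0 sub0r.
  have key : `|c + G x - F n.+1 x| <= C * hn n * `|x|.
    pose D z := G z - F n.+1 z.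
    have dD (z : R) : dv D z (g z - f n z) by exact: dvB (dG z) (dF n z).
    have bD (z : R) : `|z| <= `|x| -> `|g z - f n z| <= C * hn n by move=> /(hC' n)[].
    have -> : c + G x - F n.+1 x = D x - D 0 by rewrite /D D0; ring.
    have [x0|x0|x0] := ltgtP x 0.
    - have [z /andP[xz z0] e] := mvt x0 (fun z _ => dD z).
      rewrite -normrN opprB e sub0r normrM normrN ler_wpM2r // bD //.
      by rewrite !ler0_norm ?(ltW xz) //; lra.
    - have [z /andP[xz z0] e] := mvt x0 (fun z _ => dD z).
      rewrite e subr0 normrM ler_wpM2r // bD //.
      by rewrite !ger0_norm ?(ltW z0) //; lra.
    - by rewrite x0 subrr normr0 mulr0.
  have h1 := (hC' n.+1 x (lexx _)).1.
  rewrite (_ : f0 x - (c + G x) = (f0 x - F n.+1 x) - (c + G x - F n.+1 x)); last by ring.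
  apply: le_trans (ler_normB _ _) _.
  have h2 : C * hn n.+1 <= C * hn n.
    by rewrite ler_wpM2l // exprSr ler_piMr ?(ltW (hn_gt0 _)) // invf_le1 // ler1n.
  move: h1 key h2; nra.
have [y0 dy] : y 0 = a /\ forall x, dv y x (w x).
  exact: (pass Y W y w a cw dY Y0 unif).
have [w0 dw] : w 0 = b /\ forall x, dv w x (q x * y x).
  apply: (pass W (fun n x => q x * Y n x) w (fun x => q x * y x) b) => //.
    by move=> x; exact: continuousM (cq x) (cy x).
  move=> L; have [C hC] := unif L; have [K1 hq] := hK L.
  exists (C * K L) => n x xL; have [h1 h2] := hC n x xL.
  have Ch0 := le_trans (normr_ge0 _) h1.
  split.
    apply: le_trans h2 _; rewrite mulrAC -[X in X <= _]mulr1.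
    by apply: ler_pM => //; rewrite ?ler01.
  rewrite -mulrBr normrM mulrAC [_ * K L]mulrC.
  by apply: ler_pM => //; exact: hq.
by exists y, w; split.
Qed.

End initial_value_problem.

(** * Integrals *)

Section integrals.
Context {R : realType}.
Implicit Types (A B : set R) (f g h k F H : R -> R) (a b c x y d e v : R).
Local Notation mu := (@lebesgue_measure R).

Definition integ A f := mu.-integrable A (EFin \o f).

(** Integrals are handled as a relation, so that integrability and values are proved
    together. *)
Definition hasint A f v := integ A f /\ \int[mu]_(x in A) f x = v.

Lemma integ_measurable A f : integ A f -> measurable_fun A f.
Proof. by move=> /(measurable_int mu)/measurable_EFinP. Qed.

Lemma integ_ext A f g : measurable A -> (forall x, A x -> f x = g x) ->
  integ A f -> integ A g.
Proof.
by move=> mA fg; apply: eq_integrable => // x; rewrite inE /= => Ax; rewrite fg.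
Qed.

Lemma hasint_ext A f g v : measurable A -> (forall x, A x -> f x = g x) ->
  hasint A f v -> hasint A g v.
Proof.
move=> mA fg [fi fv]; split; first exact: integ_ext fi.
by rewrite -fv; apply: eq_Rintegral => x; rewrite inE => /fg.
Qed.

Lemma hasint_eqv A f v w : hasint A f v -> v = w -> hasint A f w.
Proof. by move=> ? <-. Qed.

Lemma integ_hasint A f : integ A f -> hasint A f (\int[mu]_(x in A) f x).
Proof. by []. Qed.

Lemma integD A f g : measurable A -> integ A f -> integ A g ->
  integ A (fun x => f x + g x).
Proof. by move=> mA; exact: integrableD. Qed.

Lemma integZ A f c : measurable A -> integ A f -> integ A (fun x => c * f x).
Proof. by move=> mA; exact: integrableZl. Qed.

Lemma hasintD A f g v w : measurable A -> hasint A f v -> hasint A g w ->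
  hasint A (fun x => f x + g x) (v + w).
Proof.
move=> mA [fi <-] [gi <-]; split; first exact: integD.
exact: RintegralD.
Qed.

Lemma hasintZ A f c v : measurable A -> hasint A f v ->
  hasint A (fun x => c * f x) (c * v).
Proof. by move=> mA [fi <-]; split; [exact: integZ|exact: RintegralZl]. Qed.

Lemma hasintN A f v : measurable A -> hasint A f v -> hasint A (fun x => - f x) (- v).
Proof.
move=> mA /(hasintZ (-1) mA) h; apply: hasint_eqv (mulN1r v).
by apply: hasint_ext h => // x _; rewrite mulN1r.
Qed.

Lemma hasintB A f g v w : measurable A -> hasint A f v -> hasint A g w ->
  hasint A (fun x => f x - g x) (v - w).
Proof. by move=> mA hf /(hasintN mA); exact: hasintD. Qed.

Lemma hasint0 A f : measurable A -> (forall x, A x -> f x = 0) -> hasint A f 0.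
Proof.
move=> mA f0; have h0 : hasint A (fun=> 0) 0.
  split; first exact: integrable0.
  by rewrite Rintegral_cst // mul0r.
by apply: hasint_ext h0 => // x /f0.
Qed.

Lemma hasint_uniq A f v w : hasint A f v -> hasint A f w -> v = w.
Proof. by move=> [_ <-] [_ <-]. Qed.

Lemma hasint_ge0 A f v : hasint A f v -> (forall x, A x -> 0 <= f x) -> 0 <= v.
Proof. by move=> [_ <-] h; apply: Rintegral_ge0 => x; exact: h. Qed.

Lemma hasint_le A f g v w : measurable A -> hasint A f v -> hasint A g w ->
  (forall x, A x -> f x <= g x) -> v <= w.
Proof. by move=> mA [fi <-] [gi <-] h; apply: le_Rintegral => // x; exact: h. Qed.

Lemma integ_dom A f g : measurable A -> measurable_fun A f ->
  (forall x, A x -> `|f x| <= g x) -> integ A g -> integ A f.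
Proof.
move=> mA mf fg; apply: le_integrable => //; first exact/measurable_EFinP.
by move=> x Ax /=; rewrite lee_fin (le_trans (fg x Ax)) // ler_norm.
Qed.

Lemma integS A B f : measurable A -> measurable B -> A `<=` B -> integ B f -> integ A f.
Proof. by move=> mA mB AB; exact: integrableS. Qed.

Lemma integU A B f : measurable A -> measurable B -> [disjoint A & B] ->
  integ A f -> integ B f -> integ (A `|` B) f.
Proof.
move=> mA mB AB /integrableP[mf fi] /integrableP[mg gi].
have mU : measurable_fun (A `|` B) (EFin \o f) by apply/measurable_funU.
apply/integrableP; split=> //.
have mn : measurable_fun (A `|` B) (fun x => `|(EFin \o f) x|)%E by exact: measurableT_comp.
rewrite ge0_integral_setU //.
by rewrite lte_add_pinfty.
Qed.

Lemma hasintU A B f v w : measurable A -> measurable B -> [disjoint A & B] ->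
  hasint A f v -> hasint B f w -> hasint (A `|` B) f (v + w).
Proof.
move=> mA mB AB [fi <-] [gi <-].
have i := integU mA mB AB fi gi.
by split=> //; exact: Rintegral_setU.
Qed.

Lemma hasint_support A B f v : measurable A -> measurable B -> A `<=` B ->
  (forall x, B x -> ~ A x -> f x = 0) -> hasint A f v -> hasint B f v.
Proof.
move=> mA mB AB f0 hA.
have mD : measurable (B `\` A) by exact: measurableD.
have h0 : hasint (B `\` A) f 0 by apply: hasint0 => // x [Bx Ax]; exact: f0.
have dAB : [disjoint A & (B `\` A)] by rewrite disj_set2E setDE setIA setIAC setICr set0I.
by have := hasintU mA mD dAB hA h0; rewrite addr0 setDUK.
Qed.

Lemma cc_continuous_measurable f a b : (forall x, a <= x <= b -> {for x, continuous f}) ->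
  measurable_fun `[a, b] f.
Proof.
move=> cf; apply: subspace_continuous_measurable_fun => //.
by apply/continuous_in_subspaceT => x; rewrite inE /= in_itv /=; exact: cf.
Qed.

(** The integrand [k] is arbitrary at the end points: a piecewise defined function takes
    there the value of a neighbouring piece. *)
Lemma hasint_ftc (h k : R -> R) H a b : a <= b ->
  (forall x, a <= x <= b -> dv H x (h x)) ->
  (forall x, a <= x <= b -> {for x, continuous h}) ->
  (forall x, a < x < b -> k x = h x) ->
  hasint `[a, b] k (H b - H a).
Proof.
rewrite le_eqVlt => /orP[/eqP-> _ _ _|ab dH ch kh].
  rewrite subrr set_itv1; split; last by rewrite Rintegral_set1.
  apply/integrableP; split; first exact: measurable_fun_set1.
  by rewrite integral_set1.
have wh : {within `[a, b], continuous h}.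
  by apply/continuous_in_subspaceT => x; rewrite inE /= in_itv /=; exact: ch.
have ih : integ `[a, b] h by apply: continuous_compact_integrable => //; exact: segment_compact.
have Iab x : x \in `]a, b[ -> a <= x <= b.
  by rewrite in_itv /= => /andP[/ltW -> /ltW ->].
have eh : (\int[mu]_(x in `[a, b]) (h x)%:E = (H b)%:E - (H a)%:E)%E.
  apply: continuous_FTC2 => //.
    split.
    - by move=> x /Iab /dH [].
    - by apply: cvg_at_right_filter; apply: dv_cont (dH a _); rewrite lexx ltW.
    - by apply: cvg_at_left_filter; apply: dv_cont (dH b _); rewrite lexx ltW.
  by move=> x /Iab /dH [_ <-]; rewrite derive1E.
have moh : measurable_fun `]a, b[ h.
  by apply: measurable_funS (integ_measurable ih) => //; exact: subset_itv_oo_cc.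
have kho : {in `]a, b[, h =1 k} by move=> x; rewrite in_itv /= => /kh.
have mok : measurable_fun `]a, b[ k.
  by apply: eq_measurable_fun moh => x; rewrite inE; exact: kho.
have mk : measurable_fun `[a, b] k by exact: (@measurable_fun_itv_cc _ _ _ false true).
split.
  apply/integrableP; split; first exact/measurable_EFinP.
  move/integrableP : ih => [_]; apply: le_lt_trans.
  have := @eq_integral_itv_bounded R a b (fun x => `|h x|) (fun x => `|k x|) true false.
  move=> /= -> //; first by apply: measurableT_comp.
    by apply: measurableT_comp.
  by move=> x xab; rewrite kho.
rewrite /Rintegral (@eq_integral_itv_bounded R a b h k true false) //; last by rewrite eh.
Qed.

Lemma integ_cc f a b : (forall x, a <= x <= b -> {for x, continuous f}) -> integ `[a, b] f.
Proof.
move=> cf; apply: continuous_compact_integrable; first exact: segment_compact.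
by apply/continuous_in_subspaceT => x; rewrite inE /= in_itv /=; exact: cf.
Qed.

Lemma hasint_cat f a b (c : itv_bound R) v w : a <= b -> (BLeft b <= c)%O ->
  hasint `[a, b] f v -> hasint [set` Interval (BLeft b) c] f w ->
  hasint [set` Interval (BLeft a) c] f (v + w).
Proof.
move=> ab bc hv hw.
have -> : [set` Interval (BLeft a) c] = `[a, b[ `|` [set` Interval (BLeft b) c].
  by rewrite -itv_bndbnd_setU // bnd_simp.
apply: hasintU => //.
  by apply/disj_setPS => x /= []; rewrite !in_itv /= => /andP[_ xb] /andP[bx _]; lra.
case: hv => hi <-; have hi' : integ `[a, b[ f.
  by apply: integS hi => //; apply: subset_itvl; rewrite bnd_simp.
by split=> //; exact: Rintegral_itv_bndo_bndc.
Qed.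

Lemma hasint_cat_cc f a b c v w : a <= b <= c ->
  hasint `[a, b] f v -> hasint `[b, c] f w -> hasint `[a, c] f (v + w).
Proof. by move=> /andP[ab bc]; apply: hasint_cat; rewrite ?bnd_simp. Qed.

Lemma hasint_cat_cy f a b v w : a <= b ->
  hasint `[a, b] f v -> hasint `[b, +oo[ f w -> hasint `[a, +oo[ f (v + w).
Proof. by move=> ab; exact: hasint_cat. Qed.

Lemma hasint_ray (k : R -> R) (H : R -> R) a l : integ `[a, +oo[ k ->
  (forall b, a <= b -> hasint `[a, b] k (H b - H a)) ->
  H x @[x --> +oo] --> l -> hasint `[a, +oo[ k (l - H a).
Proof.
move=> ik hk Hl; split=> //.
pose f_ n := ((EFin \o k) \_ `[a, a + n%:R]).
have mk : measurable_fun `[a, +oo[ k by exact: integ_measurable.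
have mT : measurable (`[a, +oo[ : set R) by exact: measurable_itv.
have dc : (\int[mu]_(x in `[a, +oo[) f_ n x)%E @[n --> \oo] -->
    (\int[mu]_(x in `[a, +oo[) (EFin \o k) x)%E.
  have [] // := @dominated_convergence _ _ _ mu `[a, +oo[ mT f_ (EFin \o k)
    (EFin \o (fun x => `|k x|)).
  - move=> n; apply/measurable_restrict => //.
    apply/measurable_EFinP; by apply: measurable_funS mk => // x [].
  - exact/measurable_EFinP.
  - apply: aeW => x /=; rewrite in_itv /= andbT => ax.
    apply: cvg_near_cst; near=> n.
    rewrite /f_ /= patchE mem_set //= in_itv /= ax /=.
    rewrite -lerBlDl; near: n; exact: nbhs_infty_ger.
  - exact: integrable_norm.
  - apply: aeW => x n /= _; rewrite /f_ patchE; case: ifPn => //= _.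
    by rewrite normr0 lee_fin.
have e n : (\int[mu]_(x in `[a, +oo[) f_ n x)%E = (H (a + n%:R) - H a)%:E.
  have an : a <= a + n%:R by rewrite lerDl ler0n.
  have [ii <-] := hk _ an.
  rewrite /f_ -integral_mkcondr /Rintegral fineK; last exact: integrable_fin_num.
  by congr (integral _ _ _); rewrite setIC; apply/setIidl; exact: subset_itvl.
rewrite /Rintegral.
suff -> : (\int[mu]_(x in `[a, +oo[) (k x)%:E = (l - H a)%:E)%E by [].
apply: cvg_unique dc _ => //.
rewrite (_ : (fun n => _) = (fun n => (H (a + n%:R) - H a)%:E)); last by apply/funext.
apply: cvg_EFin; first exact: nearW.
rewrite /comp /=; apply: cvgB; last exact: cvg_cst.
apply: (@cvg_comp _ _ _ (fun n : nat => a + n%:R) H) Hl.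
apply/cvgryPge => M; near=> n; rewrite -lerBlDl; near: n; exact: nbhs_infty_ger.
Unshelve. all: by end_near. Qed.

Lemma bounded_ndecr_cvg H a M : (forall x y, a <= x -> x <= y -> H x <= H y) ->
  (forall x, a <= x -> H x <= M) -> exists l : R, H x @[x --> +oo] --> l.
Proof.
move=> nd hM; pose H' x := H (Num.max a x).
have : H' x @[x --> +oo] --> sup (range H').
  apply: nondecreasing_cvgr.
    move=> x y xy; apply: nd; first by rewrite le_max lexx.
    by rewrite ge_max !le_max lexx xy orbT.
  by exists M => _ [x _ <-]; apply: hM; rewrite le_max lexx.
move=> h; exists (sup (range H')); apply: cvg_trans h; apply: near_eq_cvg.
near=> x; rewrite /H' max_r //; near: x; exact: nbhs_pinfty_ge.
Unshelve. all: by end_near. Qed.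

(** A monotone primitive which is bounded converges at infinity. *)
Lemma ge0_integ_ray (h : R -> R) H a M : (forall x, a <= x -> dv H x (h x)) ->
  (forall x, a <= x -> {for x, continuous h}) -> (forall x, a <= x -> 0 <= h x) ->
  (forall x, a <= x -> H x <= M) -> integ `[a, +oo[ h.
Proof.
move=> dH ch h0 hM.
have [l Hl] : exists l : R, H x @[x --> +oo] --> l.
  apply: (bounded_ndecr_cvg (M := M)) hM => x y ax xy.
  apply: (dv_ge0_le xy) => z /andP[xz _].
    by apply: dH; exact: le_trans ax xz.
  by apply: h0; apply: le_trans ax (ltW xz).
have wh : {within `[a, +oo[, continuous h}.
  by apply/continuous_in_subspaceT => x; rewrite inE /= in_itv /= andbT; exact: ch.
apply/integrableP; split.
  by apply/measurable_EFinP; apply: subspace_continuous_measurable_fun.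
rewrite (_ : (\int[mu]_(x in `[a, +oo[) `|(EFin \o h) x|)%E = (l%:E - (H a)%:E)%E).
  by rewrite -EFinB ltry.
rewrite -(@ge0_continuous_FTC2y R h H a l) //.
- by apply: eq_integral => x; rewrite inE /= in_itv /= andbT => ax; rewrite ger0_norm // h0.
- by move=> x ax; case: (dH x (ltW ax)).
- by apply: cvg_at_right_filter; apply: dv_cont (dH a (lexx _)).
- by move=> x; rewrite in_itv /= andbT => ax; case: (dH x (ltW ax)) => _ <-; rewrite derive1E.
Qed.

(** ** Square integrable functions *)

Definition L2 A f := measurable_fun A f /\ integ A (fun x => f x ^+ 2).

Lemma L2_mul A f g : measurable A -> L2 A f -> L2 A g -> integ A (fun x => f x * g x).
Proof.
move=> mA [mf fi] [mg gi].
apply: (integ_dom (g := fun x => f x ^+ 2 + g x ^+ 2)) => //.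
- exact: measurable_funM.
- move=> x _; rewrite ler_norml.
  have := sqr_ge0 (f x); have := sqr_ge0 (g x).
  have := sqr_ge0 (f x + g x); have := sqr_ge0 (f x - g x).
  by move=> *; apply/andP; split; nra.
- exact: integD.
Qed.

Lemma L2D A f g : measurable A -> L2 A f -> L2 A g -> L2 A (fun x => f x + g x).
Proof.
move=> mA hf hg; have fg := L2_mul mA hf hg; case: hf hg => [mf fi] [mg gi].
split; first exact: measurable_funD.
have h := integD mA (integD mA fi gi) (integZ 2 mA fg).
by apply: integ_ext h => // x _; ring.
Qed.

Lemma L2Z A f c : measurable A -> L2 A f -> L2 A (fun x => c * f x).
Proof.
move=> mA [mf fi]; split; first exact: measurable_funM.
by apply: integ_ext (integZ (c ^+ 2) mA fi) => // x _; rewrite exprMn.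
Qed.

Lemma L2B A f g : measurable A -> L2 A f -> L2 A g -> L2 A (fun x => f x - g x).
Proof.
move=> mA hf /(L2Z (-1) mA) hg; have [m i] := L2D mA hf hg; split.
  by apply: eq_measurable_fun m => x _; rewrite mulN1r.
by apply: integ_ext i => // x _; rewrite mulN1r.
Qed.

Lemma L2_ext A f g : measurable A -> (forall x, A x -> f x = g x) -> L2 A f -> L2 A g.
Proof.
move=> mA fg [m i]; split.
  by apply: eq_measurable_fun m => x; rewrite inE; exact: fg.
by apply: integ_ext i => // x Ax; rewrite fg.
Qed.

Lemma L2S A B f : measurable A -> measurable B -> A `<=` B -> L2 B f -> L2 A f.
Proof.
move=> mA mB AB [m i]; split; first exact: measurable_funS m.
exact: integS i.
Qed.

Lemma L2_bounded_mul A f h (M : R) : measurable A -> measurable_fun A h ->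
  (forall x, A x -> `|h x| <= M) -> L2 A f -> L2 A (fun x => h x * f x).
Proof.
move=> mA mh hM [mf fi]; split; first exact: measurable_funM.
apply: (integ_dom (g := fun x => M ^+ 2 * f x ^+ 2)) => //.
- by apply: measurable_funX; exact: measurable_funM.
- move=> x Ax; rewrite exprMn ger0_norm ?(mulr_ge0 (sqr_ge0 _) (sqr_ge0 _)) //.
  rewrite ler_wpM2r ?sqr_ge0 // -[h x ^+ 2]real_normK ?num_real //.
  have hx := hM x Ax; have M0 := le_trans (normr_ge0 _) hx.
  by rewrite lerXn2r ?nnegrE.
- exact: (integZ (M ^+ 2) mA fi).
Qed.

Lemma L2_cc f a b : (forall x, a <= x <= b -> {for x, continuous f}) -> L2 `[a, b] f.
Proof.
move=> cf; split; first exact: cc_continuous_measurable.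
by apply: integ_cc => x /cf c; apply: continuousM.
Qed.

Lemma L2_integ_cc f a b : L2 `[a, b] f -> integ `[a, b] f.
Proof.
move=> hf; have h1 : L2 `[a, b] (fun=> 1) by apply: L2_cc => x _; exact: cst_continuous.
by apply: integ_ext (L2_mul _ hf h1) => // x _; rewrite mulr1.
Qed.

End integrals.

(** * Weak derivatives of real functions on an edge *)

Section edges.
Context {R : realType}.
Implicit Types (e : edge) (f g h k w F : R -> R) (a b c x y d : R).
Local Notation dom := (@dom R).
Local Notation mu := (@lebesgue_measure R).

Lemma ae_imp (P Q : R -> Prop) : {ae mu, forall x, P x} -> (forall x, P x -> Q x) ->
  {ae mu, forall x, Q x}.
Proof. by move=> h PQ; apply: filterS h; [exact: (ae_filter_ringOfSetsType mu)|]. Qed.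

Lemma ae_imp2 (P P' Q : R -> Prop) : {ae mu, forall x, P x} -> {ae mu, forall x, P' x} ->
  (forall x, P x -> P' x -> Q x) -> {ae mu, forall x, Q x}.
Proof. by move=> h h' PQ; apply: filterS2 h h'; [exact: (ae_filter_ringOfSetsType mu)|]. Qed.

Definition elo e : R := match e with Circle => - pi | Ray => 0 end.

Definition inner e x := match e with Circle => - pi < x < pi | Ray => 0 < x end.

(** The retraction of the line onto an edge; it extends continuous functions on the edge,
    and derivatives are then two-sided everywhere. *)
Definition clamp e x : R :=
  match e with Circle => Num.max (- pi) (Num.min pi x) | Ray => Num.max 0 x end.

Lemma pi2 : - pi < pi :> R. Proof. by rewrite gtrN // pi_gt0. Qed.

Lemma domE e x : dom e x <-> (match e with Circle => - pi <= x <= pi | Ray => 0 <= x end).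
Proof. by case: e; rewrite /= in_itv /= ?andbT. Qed.

Lemma measurable_dom e : measurable (dom e).
Proof. by case: e; exact: measurable_itv. Qed.

Lemma innerE e : (dom e)° = inner e.
Proof.
by case: e; rewrite /= interior_itv; apply/funext => x /=; apply/propext;
  rewrite in_itv /= ?andbT.
Qed.

Lemma inner_dom e x : inner e x -> dom e x.
Proof. by rewrite domE; case: e => /= => [/andP[/ltW-> /ltW->]|/ltW]. Qed.

Lemma elo_dom e : dom e (elo e).
Proof. by rewrite domE; case: e => /=; rewrite ?lexx //= ltW // pi2. Qed.

Lemma elo_le e x : dom e x -> elo e <= x.
Proof. by rewrite domE; case: e => //= /andP[]. Qed.

Lemma dom_convex e a b x : dom e a -> dom e b -> a <= x <= b -> dom e x.
Proof.
rewrite !domE; case: e => /= [/andP[a1 _] /andP[_ b1]|a1 _] /andP[ax xb].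
  by apply/andP; split; lra.
by lra.
Qed.

Lemma dom_inner e a b x : dom e a -> dom e b -> a < x < b -> inner e x.
Proof.
rewrite !domE; case: e => /= [/andP[a1 _] /andP[_ b1]|a1 _] /andP[ax xb].
  by apply/andP; split; lra.
by lra.
Qed.

Lemma inner_between e x : inner e x -> exists a b, [/\ inner e a, inner e b & a < x < b].
Proof.
case: e => /= [/andP[h1 h2]|h].
  by exists ((- pi + x) / 2), ((x + pi) / 2); split; apply/andP; split; lra.
by exists (x / 2), (x + 1); split; rewrite ?h; try (apply/andP; split); lra.
Qed.

Lemma clamp_dom e x : dom e (clamp e x).
Proof.
rewrite domE; case: e => /=; last by rewrite le_max lexx.
by rewrite le_max lexx /= ge_max ge_min lexx /= ltW // pi2.
Qed.

Lemma clamp_id e x : dom e x -> clamp e x = x.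
Proof.
by rewrite domE; case: e => /= [/andP[h1 h2]|h]; rewrite ?(min_r h2) max_r.
Qed.

Lemma clamp_lip e x y : `|clamp e x - clamp e y| <= `|x - y|.
Proof.
have mx c s t : `|Num.max c s - Num.max c t| <= `|s - t|.
  have := ler_norm (s - t); have := ler_norm (- (s - t)).
  rewrite normrN ler_norml; move: `|s - t| => N.
  by case: (leP c s) => ?; case: (leP c t) => ? ? ?; apply/andP; split; lra.
have mn c s t : `|Num.min c s - Num.min c t| <= `|s - t|.
  have := ler_norm (s - t); have := ler_norm (- (s - t)).
  rewrite normrN ler_norml; move: `|s - t| => N.
  by case: (leP c s) => ?; case: (leP c t) => ? ? ?; apply/andP; split; lra.
by case: e => /=; [exact: le_trans (mx _ _ _) (mn _ _ _)|exact: mx].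
Qed.

Lemma within_eps e k x : {within dom e, continuous k} -> dom e x ->
  forall E : R, 0 < E -> exists2 D : R, 0 < D &
    forall y, dom e y -> `|x - y| < D -> `|k x - k y| < E.
Proof.
move=> /subspace_continuousP /(_ x) h /h /cvgrPdist_lt {}h E /h.
rewrite near_withinE => -[D /= D0 hD]; exists D => // y ey xy.
exact: hD.
Qed.

Lemma clamp_continuous e k : {within dom e, continuous k} ->
  continuous (fun x => k (clamp e x)).
Proof.
move=> ck x; apply/cvgrPdist_lt => E E0.
have [D D0 hD] := within_eps ck (clamp_dom e x) E0.
near=> y; apply: hD; first exact: clamp_dom.
by apply: le_lt_trans (clamp_lip _ _ _) _; near: y; exact: cvgr_dist_lt.
Unshelve. all: by end_near. Qed.

Lemma within_measurable e f : {within dom e, continuous f} -> measurable_fun (dom e) f.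
Proof. exact: (subspace_continuous_measurable_fun (measurable_dom e)). Qed.

(** ** Test functions *)

(** A test function lives on a compact interval [elo e, d]; on the circle [d] is pi, on the
    ray some point beyond the support. Both edges can then be treated at once. *)
Lemma test_support e phi : test_fun (dom e) phi -> exists d,
  [/\ elo e < d, dom e d, phi (elo e) = 0, phi d = 0 &
      forall x, dom e x -> d < x -> phi x = 0 /\ derive1 phi x = 0].
Proof.
move=> [dphi _ [a [b [ab phi0]]]]; rewrite innerE in ab.
have out x : ~ inner e x -> phi x = 0.
  by move=> nx; apply: phi0; apply/negP => xab; apply: nx; exact: ab.
case: e ab out => /= ab out.
  exists pi; split; rewrite ?pi2 //.
  - by rewrite in_itv /= lexx ltW // pi2.
  - by apply: out; rewrite ltxx.
  - by apply: out; rewrite ltxx andbF.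
  - by move=> x; rewrite in_itv /= => /andP[_ xp] px; lra.
have bb x : Num.max b 1 < x -> phi x = 0.
  move=> bx; apply: phi0; rewrite in_itv /= negb_and -!ltNge.
  by rewrite (le_lt_trans _ bx) ?orbT // le_max lexx.
have m1 : 1 <= Num.max b 1 by rewrite le_max lexx orbT.
exists (Num.max b 1 + 1); split.
- lra.
- by rewrite in_itv /= andbT; lra.
- by apply: out; rewrite ltxx.
- by apply: bb; rewrite ltrDl.
move=> x _ dx; split; first by apply: bb; lra.
have xb : Num.max b 1 < x by lra.
suff [_ <-] : dv phi x 0 by rewrite derive1E.
apply: dv_near (dv_cst 0 x); near=> y; rewrite bb //; near: y.
have xx : (fun y : R => y) @ x --> x by exact: cvg_id.
exact: (cvgr_gt _ xx).
Unshelve. all: by end_near. Qed.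

Lemma test_dv e phi x : test_fun (dom e) phi -> dv phi x (derive1 phi x).
Proof. by move=> [d _ _]; rewrite derive1E; exact/derivableP. Qed.

Lemma test_hasint e phi d k v : test_fun (dom e) phi -> elo e < d -> dom e d ->
  (forall x, dom e x -> d < x -> k x = 0) ->
  hasint `[elo e, d] k v -> hasint (dom e) k v.
Proof.
move=> hphi ld ed k0; apply: hasint_support => //; first exact: measurable_dom.
  by move=> x /=; rewrite in_itv /= => /(dom_convex (elo_dom e) ed).
move=> x ex nx; apply: k0 => //; rewrite ltNge; apply/negP => xd; apply: nx.
by rewrite /= in_itv /= xd elo_le.
Qed.

Lemma test_L2 e phi : test_fun (dom e) phi -> L2 (dom e) phi /\ L2 (dom e) (derive1 phi).
Proof.
move=> hphi; have [d [ld ed _ _ hd]] := test_support hphi.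
have c1 : continuous phi by move=> x; exact: dv_cont (test_dv x hphi).
have c2 : continuous (derive1 phi) by case: hphi.
suff L k : continuous k -> (forall x, dom e x -> d < x -> k x = 0) -> L2 (dom e) k.
  by split; apply: L => // x ex /(hd x ex)[].
move=> ck k0; split.
  by apply: within_measurable; exact: continuous_subspaceT.
have hk : hasint `[elo e, d] (fun x => k x ^+ 2) (\int[mu]_(x in `[elo e, d]) (k x ^+ 2)).
  by split=> //; apply: integ_cc => x _; apply: continuousM; exact: ck.
have k0' x : dom e x -> d < x -> k x ^+ 2 = 0 by move=> ex dx; rewrite k0 // expr0n.
exact: (test_hasint hphi ld ed k0' hk).1.
Qed.

Definition rweak (I : set R) f g := forall phi, test_fun I phi ->
  \int[mu]_(x in I) (f x * derive1 phi x) = - \int[mu]_(x in I) (g x * phi x).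

(** ** Classical derivatives are weak derivatives *)

(** Integration by parts against every C^1 function; contrary to [rweak] this makes
    sense on a compact interval up to its end points, and is local and additive. *)
Definition ibp a b f g := forall phi, (forall x, derivable phi x 1) ->
  continuous (derive1 phi) -> exists v,
    hasint `[a, b] (fun x => f x * derive1 phi x) (f b * phi b - f a * phi a - v) /\
    hasint `[a, b] (fun x => g x * phi x) v.

Lemma ibp_C1 a b f g F (F1 : R -> R) : a <= b ->
  (forall x, dv F x (F1 x)) -> continuous F1 ->
  (forall x, a <= x <= b -> f x = F x) ->
  (forall x, a < x < b -> g x = F1 x) ->
  ibp a b f g.
Proof.
move=> ab dF cF1 fF gF1 phi dphi cphi.
have dp x : dv phi x (derive1 phi x) by rewrite derive1E; exact/derivableP.
have cp : continuous phi by move=> x; exact: dv_cont (dp x).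
have cF : continuous F by move=> x; exact: dv_cont (dF x).
have mab : measurable (`[a, b] : set R) by exact: measurable_itv.
have cFp : continuous (fun x => F1 x * phi x).
  by move=> x; exact: continuousM (cF1 x) (cp x).
have [H _ dH] := primitive cFp.
exists (H b - H a); split; last first.
  apply: (@hasint_ftc _ (fun x => F1 x * phi x)) => //; first by move=> x _; exact: cFp.
  by move=> x hx; rewrite gF1.
have h1 : hasint `[a, b] (fun x => F1 x * phi x) (H b - H a).
  by apply: (@hasint_ftc _ (fun x => F1 x * phi x)) => // x _; exact: cFp.
have h2 : hasint `[a, b] (fun x => F x * derive1 phi x + phi x * F1 x)
    (F b * phi b - F a * phi a).
  apply: (@hasint_ftc _ (fun x => F x * derive1 phi x + phi x * F1 x)
    _ (fun x => F x * phi x)) => //.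
  move=> x hx; apply: continuousD; first exact: continuousM (cF x) (cphi x).
  exact: continuousM (cp x) (cF1 x).
rewrite !fF ?lexx ?ab //; apply: hasint_ext (hasintB mab h2 h1) => // x.
by rewrite /= in_itv /= => /fF ->; ring.
Qed.

Lemma ibp_cat a b c f g : a <= b <= c -> ibp a b f g -> ibp b c f g -> ibp a c f g.
Proof.
move=> abc h1 h2 phi dp cp.
have [v1 [i1 j1]] := h1 phi dp cp; have [v2 [i2 j2]] := h2 phi dp cp.
exists (v1 + v2); split; last exact: hasint_cat_cc j1 j2.
by apply: hasint_eqv (hasint_cat_cc abc i1 i2) _; ring.
Qed.

Lemma rweak_ibp e f g : (forall d, dom e d -> ibp (elo e) d f g) ->
  rweak (dom e) f g.
Proof.
move=> h phi hphi; have [d [ld ed p0 pd hd]] := test_support hphi.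
case: (hphi) => dp cp _; have [v [hi hj]] := h d ed phi dp cp.
have e1 : forall x, dom e x -> d < x -> f x * derive1 phi x = 0.
  by move=> x ex dx; rewrite (hd x ex dx).2 mulr0.
have e2 : forall x, dom e x -> d < x -> g x * phi x = 0.
  by move=> x ex dx; rewrite (hd x ex dx).1 mulr0.
have [_ ->] := test_hasint hphi ld ed e1 hi.
have [_ ->] := test_hasint hphi ld ed e2 hj.
by rewrite p0 pd !mulr0 subrr sub0r.
Qed.

Lemma rweak_C1 e F (F1 : R -> R) : (forall x, dv F x (F1 x)) -> continuous F1 ->
  rweak (dom e) F F1.
Proof.
move=> dF cF; apply: rweak_ibp => d ed; apply: (ibp_C1 (F := F)) => //.
exact: elo_le.
Qed.

Lemma rweak_ext e f g f' g' : (forall x, dom e x -> f x = f' x) ->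
  (forall x, dom e x -> g x = g' x) -> rweak (dom e) f g -> rweak (dom e) f' g'.
Proof.
move=> ff gg h phi hphi.
have -> : \int[mu]_(x in dom e) (f' x * derive1 phi x) = \int[mu]_(x in dom e) (f x * derive1 phi x).
  by apply: eq_Rintegral => x; rewrite inE => /ff ->.
rewrite h //; congr (- _); apply: eq_Rintegral => x.
by rewrite inE => /gg ->.
Qed.

Lemma rweak_ae e f g g' : measurable_fun (dom e) g -> measurable_fun (dom e) g' ->
  {ae mu, forall x, dom e x -> g x = g' x} -> rweak (dom e) f g -> rweak (dom e) f g'.
Proof.
move=> mg mg' gg h phi hphi; rewrite h //; congr (- _).
have [[mp _] _] := test_L2 hphi; have mD := measurable_dom e.
congr fine; apply: ae_eq_integral => //.
- by apply/measurable_EFinP; exact: measurable_funM.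
- by apply/measurable_EFinP; exact: measurable_funM.
have gp : {ae mu, forall x, dom e x -> (g x * phi x)%:E = (g' x * phi x)%:E}.
  by apply: (ae_imp gg) => x /= h' /h' ->.
exact: gp.
Qed.

Lemma rweakZ e f g c : L2 (dom e) f -> L2 (dom e) g -> rweak (dom e) f g ->
  rweak (dom e) (fun x => c * f x) (fun x => c * g x).
Proof.
move=> lf lg h phi hphi; have [l1 l2] := test_L2 hphi; have mD := measurable_dom e.
under eq_Rintegral do rewrite -mulrA.
under [in RHS]eq_Rintegral do rewrite -mulrA.
by rewrite !RintegralZl ?h ?mulrN //; exact: L2_mul.
Qed.

Lemma rweakD e f g f' g' : L2 (dom e) f -> L2 (dom e) g -> L2 (dom e) f' ->
  L2 (dom e) g' -> rweak (dom e) f g -> rweak (dom e) f' g' ->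
  rweak (dom e) (fun x => f x + f' x) (fun x => g x + g' x).
Proof.
move=> lf lg lf' lg' h h' phi hphi.
have [l1 l2] := test_L2 hphi; have mD := measurable_dom e.
under eq_Rintegral do rewrite mulrDl.
under [in RHS]eq_Rintegral do rewrite mulrDl.
rewrite !RintegralD ?h ?h' ?opprD //; exact: L2_mul.
Qed.

End edges.

(** ** The fundamental lemma *)

Section fundamental_lemma.
Context {R : realType}.
Implicit Types (e : edge) (f g h k w F : R -> R) (a b c x y d t eps : R).
Local Notation mu := (@lebesgue_measure R).
Local Notation dom := (@dom R).

Definition hat (t : R) : R := Num.max 0 (t * (1 - t)).

Lemma hat_cont : continuous hat.
Proof.
move=> x; apply: (@continuous_max R R (fun=> 0) (fun t => t * (1 - t)) x).
  exact: cst_continuous.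
apply: continuousM; first exact: cvg_id.
by apply: continuousB; [exact: cst_continuous|exact: cvg_id].
Qed.

Lemma hat_ge0 t : 0 <= hat t. Proof. by rewrite le_max lexx. Qed.

Lemma hat_out t : t <= 0 \/ 1 <= t -> hat t = 0.
Proof. by move=> h; apply: max_l; case: h => h; nra. Qed.

Lemma hat_in t : 0 < t < 1 -> 0 < hat t.
Proof.
move=> /andP[t0 t1]; rewrite lt_max mulr_gt0 ?orbT // subr_gt0 //.
Qed.

(** A primitive of the hat function is constant on both sides of [0, 1]. *)
Lemma smooth_step : exists (S : R -> R) c, [/\ 0 < c,
  forall t, dv S t (hat t), forall t, t <= 0 -> S t = 0,
  forall t, 1 <= t -> S t = c & forall t, 0 <= S t <= c].
Proof.
have [S S0 dS] := primitive hat_cont.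
have lo t : t <= 0 -> S t = 0.
  move=> t0; rewrite -S0; apply: (dv0_cst (a := t) (b := 0)); rewrite ?lexx ?t0 //.
  by move=> x /andP[_ x0]; apply: dv_eq (dS x) _; apply: hat_out; left.
have hi t : 1 <= t -> S t = S 1.
  move=> t1; apply: (dv0_cst (a := 1) (b := t)); rewrite ?lexx ?t1 //.
  by move=> x /andP[x1 _]; apply: dv_eq (dS x) _; apply: hat_out; right.
have nd x y : x <= y -> S x <= S y.
  by move=> xy; apply: (dv_ge0_le xy (fun z _ => dS z)) => z _; exact: hat_ge0.
exists S, (S 1); split=> //.
  rewrite -S0; apply: (dv_gt0_lt ltr01 (fun z _ => dS z)) => z; exact: hat_in.
move=> t; apply/andP; split.
  by have [t0|/ltW t0] := leP t 0; [rewrite lo|rewrite -S0; exact: nd].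
by have [t0|/ltW t0] := leP 1 t; [rewrite hi|exact: nd].
Qed.

Definition bump (S : R -> R) a b eps x : R := S ((x - a) / eps) - S ((x - b) / eps).

Lemma dv_affine a eps x : dv (fun y => (y - a) / eps) x (eps^-1).
Proof.
apply: dv_eq (dvM (dvB (dv_id x) (dv_cst a x)) (dv_cst eps^-1 x)) _.
by rewrite mulr0 add0r subr0 mulr1.
Qed.

Section bump_facts.
Context (S : R -> R) (c : R).

Context (dS : forall t, dv S t (hat t)).
Context (Slo : forall t, t <= 0 -> S t = 0).
Context (Shi : forall t, 1 <= t -> S t = c).

Lemma dv_bump a b eps x : dv (bump S a b eps) x
  (hat ((x - a) / eps) / eps - hat ((x - b) / eps) / eps).
Proof.
apply: dvB; first exact: (@dv_comp R S (fun y => (y - a) / eps) x _ _ (dS _) (dv_affine _ _ _)).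
exact: (@dv_comp R S (fun y => (y - b) / eps) x _ _ (dS _) (dv_affine _ _ _)).
Qed.

Lemma bump_out a b eps x : 0 < eps -> a <= b -> x <= a \/ b + eps <= x ->
  bump S a b eps x = 0.
Proof.
move=> e0 ab [xa|xb]; rewrite /bump.
  by rewrite !Slo ?subr0 // mulr_le0_ge0 ?invr_ge0 ?(ltW e0) //; lra.
by rewrite !Shi ?subrr // ler_pdivlMr // mul1r; lra.
Qed.

Lemma bump_test e a0 a b b0 eps : dom e a0 -> dom e b0 -> a0 < a -> a <= b ->
  0 < eps -> b + eps < b0 -> test_fun (dom e) (bump S a b eps).
Proof.
move=> ea0 eb0 aa ab e0 bb; split.
- by move=> x; case: (dv_bump a b eps x).
- have -> : derive1 (bump S a b eps) =
      (fun x => hat ((x - a) / eps) / eps - hat ((x - b) / eps) / eps).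
    by apply/funext => x; rewrite derive1E; case: (dv_bump a b eps x).
  have ch d x : {for x, continuous (fun x => hat ((x - d) / eps) / eps)}.
    apply: (@continuousM _ _ (fun x => hat ((x - d) / eps)) (fun=> eps^-1)).
      exact: (continuous_comp (dv_cont (dv_affine d eps x)) (@hat_cont _)).
    exact: cst_continuous.
  by move=> x; exact: (continuousB (ch a x) (ch b x)).
exists a, (b + eps); split.
  move=> x /=; rewrite in_itv /= innerE => /andP[ax xb].
  by apply: (dom_inner ea0 eb0); apply/andP; split; lra.
move=> x; rewrite in_itv /= negb_and -!ltNge => /orP[h|h]; apply: bump_out => //.
  by left; exact: ltW.
by right; exact: ltW.
Qed.
End bump_facts.

(** Testing against smoothed indicators of ]a, b] makes all integrals of [h] over
    intervals vanish; then so does [h] at its Lebesgue points. *)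
Lemma fundamental_lemma e h : L2 (dom e) h ->
  (forall phi, test_fun (dom e) phi -> \int[mu]_(x in dom e) (h x * phi x) = 0) ->
  {ae mu, forall x, dom e x -> h x = 0}.
Proof.
move=> lh h0; have [S [c [c0 dS Slo Shi Sb]]] := smooth_step.
have mD := measurable_dom (R := R) e.
have sub a0 b0 : dom e a0 -> dom e b0 -> `[a0, b0]%classic `<=` dom e.
  by move=> ea eb x /=; rewrite in_itv /=; exact: dom_convex.
have ih a0 b0 : dom e a0 -> dom e b0 -> integ `[a0, b0] h.
  by move=> ea eb; apply: L2_integ_cc; apply: (L2S _ _ (sub _ _ ea eb)).
have int0 a0 a b b0 : dom e a0 -> dom e b0 -> a0 < a -> a <= b -> b < b0 ->
    \int[mu]_(x in `]a, b]) h x = 0.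
  move=> ea eb aa ab bb.
  pose eps n : R := (b0 - b) / 2 / n.+1%:R.
  have eps0 n : 0 < eps n by rewrite !divr_gt0 ?subr_gt0.
  have epsd n : eps n <= (b0 - b) / 2.
    by rewrite /eps ler_pdivrMr // ler_peMr ?ler1n //; lra.
  have beps n : b + eps n < b0 by have := epsd n; lra.
  pose ph n := bump S a b (eps n).
  have tp n : test_fun (dom e) (ph n) by exact: (bump_test dS Slo Shi ea eb aa ab (eps0 n) (beps n)).
  have mI : measurable (`[a0, b0] : set R) by exact: measurable_itv.
  have z n : (\int[mu]_(x in `[a0, b0]) (h x * ph n x)%:E)%E = 0%:E.
    have i1 : integ `[a0, b0] (fun x => h x * ph n x).
      have [l1 _] := test_L2 (tp n).
      by apply: (integS mI mD (sub _ _ ea eb)); exact: L2_mul.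
    have hi : hasint `[a0, b0] (fun x => h x * ph n x)
      (\int[mu]_(x in `[a0, b0]) (h x * ph n x)) by [].
    have ss : forall x, dom e x -> ~ `[a0, b0]%classic x -> h x * ph n x = 0.
      move=> x ex /=; rewrite in_itv /= => /negP; rewrite negb_and -!ltNge => nx.
      rewrite /ph (bump_out Slo Shi) ?mulr0 //.
      by case/orP: nx => nx; [left|right; apply: ltW; apply: lt_trans (beps n) _]; lra.
    have [_] := hasint_support mI mD (sub _ _ ea eb) ss hi.
    rewrite (h0 _ (tp n)) => /esym E.
    have fin : (\int[mu]_(x in `[a0, b0]) (h x * ph n x)%:E)%E \is a fin_num by exact: integrable_fin_num.
    by rewrite -[LHS](fineK fin); congr (_%:E).
  have mh : measurable_fun `[a0, b0] h by exact: integ_measurable (ih _ _ ea eb).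
  have mhE : measurable_fun `[a0, b0] (EFin \o h) by exact/measurable_EFinP.
  pose lim0 := ((EFin \o (fun x => c * h x)) \_ `]a, b]).
  have mch : measurable_fun `[a0, b0] (EFin \o (fun x => c * h x)).
    by apply/measurable_EFinP; exact: measurable_funM.
  have [|||||i0 _ dc] := @dominated_convergence _ _ _ mu `[a0, b0] mI
    (fun n x => (h x * ph n x)%:E) lim0 (EFin \o (fun x => `|c * h x|)).
  - move=> n; apply/measurable_EFinP; apply: measurable_funM => //.
    apply: cc_continuous_measurable => x _.
    exact: dv_cont (dv_bump dS a b (eps n) x).
  - apply/measurable_restrict => //.
    by apply: measurable_funS mch => // x [].
  - apply: aeW => x /= _; rewrite /lim0 patchE.
    have small y : 0 < y -> \forall n \near \oo, eps n <= y.
      move=> y0; near=> n; rewrite /eps ler_pdivrMr // -ler_pdivrMl //.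
      apply: (@le_trans _ _ n%:R); last by rewrite ler_nat.
      by near: n; exact: nbhs_infty_ger.
    apply: cvg_near_cst; case: ifPn => [|].
      rewrite inE /= in_itv /= => /andP[ax xb].
      near=> n; rewrite /ph /bump (Shi ((x - a) / eps n)); last first.
        rewrite ler_pdivlMr // mul1r; near: n; apply: small; lra.
      rewrite (Slo ((x - b) / eps n)) ?subr0; first by rewrite mulrC.
      by apply: mulr_le0_ge0; [lra|rewrite invr_ge0 ltW].
    rewrite notin_setE /= in_itv /= => /negP; rewrite negb_and -leNgt -ltNge.
    move=> /orP[xa|bx].
      by near=> n; rewrite /ph (bump_out Slo Shi) ?mulr0 //; left.
    near=> n; rewrite /ph (bump_out Slo Shi) ?mulr0 //; right.
    by rewrite -lerBrDl; near: n; apply: small; lra.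
  - have hch : integ `[a0, b0] (fun x => c * h x) by exact: (integZ c mI (ih _ _ ea eb)).
    exact: integrable_norm hch.
  - apply: aeW => x n /= _; rewrite lee_fin !normrM mulrC ler_wpM2r //.
    rewrite /ph /bump (gtr0_norm c0).
    have /andP[s1 s2] := Sb ((x - a) / eps n); have /andP[s3 s4] := Sb ((x - b) / eps n).
    by rewrite ler_norml; apply/andP; split; lra.
  move: dc; rewrite (_ : (fun n => _) = (fun=> 0%:E)); last by apply/funext => n; exact: z.
  move=> dc.
  have e0 : (\int[mu]_(x in `[a0, b0]) lim0 x)%E = 0%:E.
    by apply: cvg_unique dc _ => //; exact: cvg_cst.
  move: e0; rewrite /lim0 -integral_mkcondr (_ : _ `&` _ = `]a, b]%classic); last first.
    rewrite setIC; apply/setIidl => x /=; rewrite !in_itv /= => /andP[ax xb].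
    by apply/andP; split; lra.
  move=> e0.
  have ib : integ `]a, b] h.
    apply: (integS _ _ _ (ih _ _ ea eb)) => // x /=; rewrite !in_itv /= => /andP[ax xb].
    by apply/andP; split; lra.
  have : c * \int[mu]_(x in `]a, b]) h x = 0.
    by rewrite -RintegralZl // /Rintegral e0.
  by move/eqP; rewrite mulf_eq0 gt_eqF //= => /eqP.
have ld : locally_integrable setT (h \_ (dom e)).
  split.
  - by apply/(measurable_restrictT _ mD); case: lh.
  - exact: openT.
  - move=> K _ cK.
    have mK : measurable K by exact: compact_measurable.
    have lr : integ K (fun x => (h \_ (dom e)) x ^+ 2).
      have : integ setT (fun x => (h \_ (dom e)) x ^+ 2).
        have h2 : integ (dom e) (fun x => (h \_ (dom e)) x ^+ 2).
          by apply: integ_ext lh.2 => // x ex; rewrite patchE mem_set.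
        have z x : setT x -> ~ dom e x -> (h \_ (dom e)) x ^+ 2 = 0.
          by move=> _ nx; rewrite patchE memNset // expr0n.
        by case: (hasint_support mD measurableT (@subsetT _ _) z (integ_hasint h2)).
      exact: integS.
    have i1 : integ K (fun=> 1).
      by apply: continuous_compact_integrable => //; apply: continuous_subspaceT; exact: cst_continuous.
    have : integ K (fun x => 1 + (h \_ (dom e)) x ^+ 2) by exact: integD.
    move=> i2.
    have mhK : measurable_fun K (h \_ (dom e)).
      by apply: (measurable_funS (E := setT)) => //; apply/(measurable_restrictT _ mD); case: lh.
    have /integrableP[_] : integ K (h \_ (dom e)).
      apply: integ_dom i2 => // x _; rewrite ler_norml.
      by apply/andP; split; nra.
    by [].
have := lebesgue_differentiation ld.
have endp : {ae mu, forall x, dom e x -> inner e x}.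
  have n1 (t : R) : mu.-negligible [set t].
    by apply/negligibleP => //; exact: lebesgue_measure_set1.
  apply: (negligibleS _ (negligibleU (negligibleU (n1 (- pi)) (n1 pi)) (n1 0))).
  move=> x /= /not_implyP []; rewrite domE => ex nx.
  case: e ex nx {lh h0 mD sub ih int0 ld} => /= [/andP[x1 x2]|x1] nx.
    have [x3|x3] := leP pi x; first by left; right; lra.
    left; left; have [x4|x4] := leP x (- pi); first by lra.
    by case: nx; rewrite x3 x4.
  by right; have [x2|x2] := leP x 0; [lra|].
move=> lp; apply: (ae_imp2 lp endp) => x /= lx hx ex.
have [a0 [b0 [ia ib /andP[ax xb]]]] := inner_between (hx ex).
have ea := inner_dom ia; have eb := inner_dom ib.
pose a1 := (a0 + x) / 2; pose u := (x + b0) / 2.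
have [a01 a1x xu ub] : [/\ a0 < a1, a1 < x, x < u & u < b0].
  by rewrite /a1 /u; split; lra.
have hd y : a0 <= y <= b0 -> (h \_ (dom e)) y = h y.
  by move=> hy; rewrite patchE mem_set //; apply: dom_convex hy.
have iu : integ `]a1, u] (h \_ (dom e)).
  apply: (@integ_ext _ _ h) => //.
    by move=> y /=; rewrite in_itv /= => /andP[? ?]; rewrite hd //; apply/andP; split; lra.
  apply: (integS _ _ _ (ih _ _ ea eb)) => // y /=; rewrite !in_itv /= => /andP[? ?].
  by apply/andP; split; lra.
have hb : (BRight a1 < BRight x)%O by rewrite bnd_simp.
have [dF F'] := FTC1_lebesgue_pt xu iu hb lx.
rewrite -(hd x) -?F'; last by apply/andP; split; lra.
rewrite derive1E.
suff [_ ->] : dv (fun y : R => \int[mu]_(t in `]a1, y]) (h \_ (dom e)) t) x 0 by [].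
apply: dv_near (dv_cst 0 x); near=> y.
have y1 : a1 < y.
  near: y; have xx : (fun y : R => y) @ x --> x by exact: cvg_id.
  exact: (cvgr_gt _ xx).
have y2 : y < u.
  near: y; have xx : (fun y : R => y) @ x --> x by exact: cvg_id.
  exact: (cvgr_lt _ xx).
rewrite -(int0 a0 a1 y b0) ?(ltW y1) //; last by lra.
apply: eq_Rintegral => t; rewrite inE /= in_itv /= => /andP[? ?].
by rewrite hd //; apply/andP; split; lra.
Unshelve. all: by end_near. Qed.

End fundamental_lemma.

(** ** Regularity *)

Section regularity.
Context {R : realType}.
Implicit Types (e : edge) (f g h k w F : R -> R) (a b c x y d t eps : R).
Local Notation dom := (@dom R).

Lemma within_opp e k : {within dom e, continuous k} ->
  {within dom e, continuous (fun x => - k x)}.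
Proof.
move=> /subspace_continuousP ck; apply/subspace_continuousP => x ex.
exact: cvgN (ck x ex).
Qed.

(** The derivative of a smooth step between [a] and [b] is a difference of two hats,
    which would see a difference between the values of [k] at [a] and [b]. *)
Lemma weak_const_lt e k a0 a b b0 : {within dom e, continuous k} ->
  (forall phi, test_fun (dom e) phi -> hasint (dom e) (fun x => k x * derive1 phi x) 0) ->
  dom e a0 -> dom e b0 -> a0 < a -> a < b -> b < b0 -> k b <= k a.
Proof.
move=> ck h0 ea eb aa ab bb; rewrite leNgt; apply/negP => kab.
have [S [c [c0 dS Slo Shi Sb]]] := @smooth_step R.
have eda : dom e a by apply: (dom_convex ea eb); apply/andP; split; lra.
have edb : dom e b by apply: (dom_convex ea eb); apply/andP; split; lra.
have k3 : 0 < (k b - k a) / 3 by rewrite divr_gt0 // subr_gt0.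
have [D1 D10 hD1] := within_eps ck eda k3.
have [D2 D20 hD2] := within_eps ck edb k3.
pose eps := Num.min (Num.min D1 D2) (b0 - b) / 2.
have mpos : 0 < Num.min (Num.min D1 D2) (b0 - b) by rewrite !lt_min D10 D20 subr_gt0.
have [e0 e1 e2 e3] : [/\ 0 < eps, eps < D1, eps < D2 & b + eps < b0].
  have m1 : Num.min (Num.min D1 D2) (b0 - b) <= D1 by rewrite !ge_min lexx.
  have m2 : Num.min (Num.min D1 D2) (b0 - b) <= D2 by rewrite !ge_min lexx orbT.
  have m3 : Num.min (Num.min D1 D2) (b0 - b) <= b0 - b by rewrite ge_min lexx orbT.
  by rewrite /eps; split; lra.
pose ph := bump S a b eps.
have tp : test_fun (dom e) ph by exact: (bump_test dS Slo Shi ea eb aa (ltW ab) e0 e3).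
pose ha x := hat ((x - a) / eps) / eps; pose hb x := hat ((x - b) / eps) / eps.
have dph x : derive1 ph x = ha x - hb x.
  by rewrite derive1E; case: (dv_bump dS a b eps x).
have ch d x : {for x, continuous (fun x => hat ((x - d) / eps) / eps)}.
  apply: (@continuousM _ _ (fun x => hat ((x - d) / eps)) (fun=> eps^-1)).
    exact: (continuous_comp (dv_cont (dv_affine d eps x)) (@hat_cont _ _)).
  exact: cst_continuous.
have hz d x : x <= d \/ d + eps <= x -> hat ((x - d) / eps) / eps = 0.
  move=> hx; rewrite hat_out ?mul0r //; case: hx => hx.
    by left; apply: mulr_le0_ge0; [lra|rewrite invr_ge0 ltW].
  by right; rewrite ler_pdivlMr //; lra.
have h00 d x : 0 <= hat ((x - d) / eps) / eps.
  by rewrite divr_ge0 ?hat_ge0 // ltW.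
pose I := `[a0, b0]%classic : set R.
have mI : measurable I by exact: measurable_itv.
have hint d : a0 <= d -> d + eps <= b0 -> hasint I (fun x => hat ((x - d) / eps) / eps) c.
  move=> d1 d2.
  have a0b0 : a0 <= b0 by lra.
  have dSd x : dv (fun y => S ((y - d) / eps)) x (hat ((x - d) / eps) / eps).
    exact: (@dv_comp R S (fun y => (y - d) / eps) x _ _ (dS _) (dv_affine _ _ _)).
  have := @hasint_ftc R (fun x => hat ((x - d) / eps) / eps)
    (fun x => hat ((x - d) / eps) / eps) (fun x => S ((x - d) / eps)) a0 b0 a0b0
    (fun x _ => dSd x) (fun x _ => ch d x) (fun x _ => erefl _).
  rewrite Shi; last by rewrite ler_pdivlMr //; lra.
  rewrite Slo ?subr0 //.
  by apply: mulr_le0_ge0; [lra|rewrite invr_ge0 ltW].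
have sub : I `<=` dom e by move=> x; rewrite /I /= in_itv /=; exact: dom_convex.
pose A := k a + (k b - k a) / 3; pose B := k b - (k b - k a) / 3.
have hU : hasint I (fun x => A * ha x - B * hb x) (A * c - B * c).
  by apply: hasintB => //; apply: hasintZ => //; apply: hint; lra.
have kph x : dom e x -> k x * derive1 ph x <= A * ha x - B * hb x.
  move=> ex; rewrite dph mulrBr; apply: lerB.
    have [hx|hx] := ltP a x; last by rewrite /ha hz ?mulr0 //; left.
    have [hx'|hx'] := ltP x (a + eps); last by rewrite /ha hz ?mulr0 //; right.
    rewrite ler_wpM2r ?h00 //.
    have : `|a - x| < D1 by rewrite ler0_norm; lra.
    by move=> /(hD1 x ex); rewrite ltr_norml /A => /andP[]; lra.
  have [hx|hx] := ltP b x; last by rewrite /hb hz ?mulr0 //; left.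
  have [hx'|hx'] := ltP x (b + eps); last by rewrite /hb hz ?mulr0 //; right.
  rewrite ler_wpM2r ?h00 //.
  have : `|b - x| < D2 by rewrite ler0_norm; lra.
  by move=> /(hD2 x ex); rewrite ltr_norml /B => /andP[]; lra.
have cc : A * c - B * c < 0.
  by rewrite -mulrBl pmulr_llt0 // /A /B; lra.
have ik : integ I (fun x => k x * derive1 ph x).
  exact: (integS mI (measurable_dom e) sub (h0 _ tp).1).
have hki : hasint I (fun x => k x * derive1 ph x) 0.
  have ss : forall x, dom e x -> ~ I x -> k x * derive1 ph x = 0.
    move=> x ex; rewrite /I /= in_itv /= => /negP; rewrite negb_and -!ltNge => nx.
    by rewrite dph /ha /hb !hz ?subrr ?mulr0 //; case/orP: nx => nx;
      [left|right|left|right]; lra.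
  have := hasint_support mI (measurable_dom e) sub ss (integ_hasint ik).
  by move=> [_]; rewrite (h0 _ tp).2 => ->.
have : 0 <= A * c - B * c.
  by apply: (hasint_le mI hki hU) => x /sub; exact: kph.
by rewrite leNgt cc.
Qed.

(** The previous lemma, for [k] and for [- k], in the interior, and continuity at the end
    points. *)
Lemma weak_const e k : {within dom e, continuous k} ->
  (forall phi, test_fun (dom e) phi -> hasint (dom e) (fun x => k x * derive1 phi x) 0) ->
  forall x y, dom e x -> dom e y -> k x = k y.
Proof.
move=> ck h0.
have ck' := within_opp ck.
have h0' phi : test_fun (dom e) phi ->
    hasint (dom e) (fun x => - k x * derive1 phi x) 0.
  move=> /h0 /(hasintN (measurable_dom e)); rewrite oppr0.
  by apply: hasint_ext => [|x _]; [exact: measurable_dom|rewrite mulNr].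
have inn x y : inner e x -> inner e y -> x < y -> k x = k y.
  move=> ix iy xy.
  have [a0 [_ [ia _ /andP[ax _]]]] := inner_between ix.
  have [_ [b0 [_ ib /andP[_ yb]]]] := inner_between iy.
  have ea := inner_dom ia; have eb := inner_dom ib.
  apply/eqP; rewrite eq_le (weak_const_lt ck h0 ea eb ax xy yb) andbT.
  by rewrite -lerN2 (weak_const_lt ck' h0' ea eb ax xy yb).
have inn' x y : inner e x -> inner e y -> k x = k y.
  move=> ix iy; have [xy|xy|-> //] := ltgtP x y; first exact: inn.
  by rewrite (inn y x).
have [z iz] : exists z : R, inner e z.
  case: (e) => /=; last by exists 1; exact: ltr01.
  by exists 0; rewrite oppr_lt0 pi_gt0.
suff H x : dom e x -> k x = k z by move=> x y /H-> /H->.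
move=> ex; apply/eqP; rewrite -subr_eq0 -normr_le0 leNgt; apply/negP => E0.
have [D D0 hD] := within_eps ck ex E0.
have [y iy xy] : exists2 y : R, inner e y & `|x - y| < D.
  have p := pi_gt0 R.
  move: ex; rewrite domE; case: (e) => /= [/andP[x1 x2]|x1].
    pose r := Num.min (D / 2) (pi / 2).
    have [r0 r1 r2] : [/\ 0 < r, r < D & r < pi].
      have : r <= D / 2 by rewrite ge_min lexx.
      have : r <= pi / 2 by rewrite ge_min lexx orbT.
      by split; rewrite ?lt_min; lra.
    have [xp|xp] := leP x 0.
      by exists (x + r); [apply/andP; split; lra|rewrite ler0_norm; lra].
    by exists (x - r); [apply/andP; split; lra|rewrite ger0_norm; lra].
  by exists (x + D / 2); [lra|rewrite ler0_norm; lra].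
by have := hD y (inner_dom iy) xy; rewrite (inn' y z) // ltxx.
Qed.
End regularity.

Section regularity2.
Context {R : realType}.
Implicit Types (e : edge) (f g h k w F : R -> R) (a b c x y d t eps : R).
Local Notation mu := (@lebesgue_measure R).
Local Notation dom := (@dom R).

(** The difference of [g] and a primitive of [W] has weak derivative 0. *)
Lemma weak_primitive e g (W : R -> R) : {within dom e, continuous g} ->
  {within dom e, continuous W} -> L2 (dom e) g -> rweak (dom e) g W ->
  exists2 G, forall x, dv G x (W (clamp e x)) & forall x, dom e x -> g x = G x.
Proof.
move=> cg cW lg gW; have mD := measurable_dom (R := R) e.
have cC := clamp_continuous cW.
have [H _ dH] := primitive cC.
have cH : continuous H by move=> x; exact: dv_cont (dH x).
have ck : {within dom e, continuous (fun x => g x - H x)}.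
  move/subspace_continuousP : cg => cg; apply/subspace_continuousP => x ex.
  by apply: cvgB; [exact: cg|apply: cvg_within_filter; exact: cH].
have h0 phi : test_fun (dom e) phi ->
    hasint (dom e) (fun x => (g x - H x) * derive1 phi x) 0.
  move=> tp; have [l1 l2] := test_L2 tp.
  have [d [ld ed p0 pd hd]] := test_support tp.
  have ib : ibp (elo e) d H (fun x => W (clamp e x)).
    by apply: (ibp_C1 (F := H)) => //; exact: ltW.
  case: (tp) => dp cp _; have [v [i1 i2]] := ib phi dp cp.
  have e1 x : dom e x -> d < x -> H x * derive1 phi x = 0.
    by move=> ex dx; rewrite (hd x ex dx).2 mulr0.
  have e2 x : dom e x -> d < x -> W (clamp e x) * phi x = 0.
    by move=> ex dx; rewrite (hd x ex dx).1 mulr0.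
  have := test_hasint tp ld ed e1 i1; rewrite p0 pd !mulr0 subrr sub0r => j1.
  have [_ j2] := test_hasint tp ld ed e2 i2.
  have ig : hasint (dom e) (fun x => g x * derive1 phi x) (- v).
    split; first exact: L2_mul.
    rewrite gW // -j2; congr (- _); apply: eq_Rintegral => x.
    by rewrite inE => ex; rewrite clamp_id.
  have := hasintB mD ig j1; rewrite subrr; apply: hasint_ext => // x _.
  by rewrite mulrBl.
have cst := weak_const ck h0.
exists (fun x => H x + (g (elo e) - H (elo e))).
  by move=> x; apply: dv_eq (dvD (dH x) (dv_cst _ x)) _; rewrite addr0.
move=> x ex; rewrite -(cst x _ ex (elo_dom e)); ring.
Qed.

(** A function with a continuous second weak derivative is of class C^2, and, after a
    C^2 extension, so on the whole line: no one-sided derivatives are needed later. *)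
Lemma weak_C2 e f g w (W : R -> R) : {within dom e, continuous f} ->
  {within dom e, continuous g} -> {within dom e, continuous W} ->
  L2 (dom e) f -> L2 (dom e) g -> measurable_fun (dom e) w ->
  rweak (dom e) f g -> rweak (dom e) g w ->
  {ae mu, forall x, dom e x -> w x = W x} ->
  exists F F1 : R -> R, [/\ forall x, dv F x (F1 x),
    forall x, dv F1 x (W (clamp e x)),
    forall x, dom e x -> f x = F x & forall x, dom e x -> g x = F1 x].
Proof.
move=> cf cg cW lf lg mw fg gw wW.
have gW : rweak (dom e) g W by apply: rweak_ae wW gw => //; exact: within_measurable.
have [F1 dF1 gF1] := weak_primitive cg cW lg gW.
have cF1 : continuous F1 by move=> x; exact: dv_cont (dF1 x).
have fF1 : rweak (dom e) f F1 by exact: rweak_ext fg.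
have [F0 dF0 fF0] := weak_primitive cf (continuous_subspaceT cF1) lf fF1.
have [F _ dF] := primitive cF1.
exists (fun x => F x + (F0 (elo e) - F (elo e))), F1; split=> //.
  by move=> x; apply: dv_eq (dvD (dF x) (dv_cst _ x)) _; rewrite addr0.
move=> x ex; rewrite fF0 //.
have xl := elo_le ex.
have d0 y : elo e <= y <= x -> dv (fun y => F0 y - F y) y 0.
  move=> hy; apply: dv_eq (dvB (dF0 y) (dF y)) _.
  by rewrite clamp_id ?subrr //; exact: dom_convex (elo_dom e) ex hy.
have := @dv0_cst R (fun y => F0 y - F y) (elo e) x d0 x (elo e).
by rewrite xl !lexx => /(_ isT isT) <-; ring.
Qed.

(** ** Complex valued functions *)

Lemma normc2 (z : R[i]) : normc z ^+ 2 = complex.Re z ^+ 2 + complex.Im z ^+ 2.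
Proof. by case: z => a b /=; rewrite sqr_sqrtr // addr_ge0 // sqr_ge0. Qed.

Lemma normc_real x : normc x%:C = `|x|.
Proof. by rewrite /normc /= expr0n /= addr0 sqrtr_sqr. Qed.

Lemma sqint_L2 (A : set R) (f : R -> R[i]) : measurable A -> sqintegrable A f <->
  L2 A (fun x => complex.Re (f x)) /\ L2 A (fun x => complex.Im (f x)).
Proof.
move=> mA; split.
  move=> [m1 m2 fin].
  have mn : measurable_fun A (fun x => normc (f x) ^+ 2).
    apply: (@eq_measurable_fun _ _ _ _ _ (fun x => complex.Re (f x) ^+ 2 + complex.Im (f x) ^+ 2)).
      by move=> x _; rewrite normc2.
    by apply: measurable_funD; exact: measurable_funX.
  have i : integ A (fun x => normc (f x) ^+ 2).
    apply/integrableP; split; first exact/measurable_EFinP.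
    move: fin; congr (_ < _)%E; apply: eq_integral => x _ /=.
    by rewrite ger0_norm // sqr_ge0.
  split; (split; first by []); apply: integ_dom i => //; try exact: measurable_funX.
    by move=> x _; rewrite normc2 ger0_norm ?sqr_ge0 // lerDl sqr_ge0.
  by move=> x _; rewrite normc2 ger0_norm ?sqr_ge0 // lerDr sqr_ge0.
move=> [[m1 i1] [m2 i2]]; split=> //.
have := integD mA i1 i2; move/integrableP => [_]; congr (_ < _)%E.
apply: eq_integral => x _ /=; rewrite normc2 ger0_norm //.
by rewrite addr_ge0 // sqr_ge0.
Qed.

Lemma weak_rweak (A : set R) (f g : R -> R[i]) : weak_derivative A f g <->
  rweak A (fun x => complex.Re (f x)) (fun x => complex.Re (g x)) /\
  rweak A (fun x => complex.Im (f x)) (fun x => complex.Im (g x)).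
Proof.
split; first by move=> h; split=> phi /h[].
by move=> [h1 h2] phi tp; split; [exact: h1|exact: h2].
Qed.

Lemma rweak_uniq e f g h : L2 (dom e) g -> L2 (dom e) h ->
  rweak (dom e) f g -> rweak (dom e) f h ->
  {ae mu, forall x, dom e x -> g x = h x}.
Proof.
move=> lg lh fg fh; have mD := measurable_dom (R := R) e.
have := @fundamental_lemma R e (fun x => g x - h x) (L2B mD lg lh).
have h0 phi : test_fun (dom e) phi -> \int[mu]_(x in dom e) ((g x - h x) * phi x) = 0.
  move=> tp; have [l1 l2] := test_L2 tp.
  have E : \int[mu]_(x in dom e) ((g x - h x) * phi x) =
           \int[mu]_(x in dom e) (g x * phi x - h x * phi x).
    by apply: eq_Rintegral => x _; rewrite mulrBl.
  rewrite E RintegralB //; try exact: L2_mul.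
  by rewrite -[X in X - _]opprK -fg // fh // opprK subrr.
move=> /(_ h0) hh; apply: (ae_imp hh) => x /= hx ex.
by apply/eqP; rewrite -subr_eq0 hx.
Qed.

Lemma complex_eq (z w : R[i]) : complex.Re z = complex.Re w ->
  complex.Im z = complex.Im w -> z = w.
Proof. by case: z => a b; case: w => c d /= -> ->. Qed.

(** Uniqueness almost everywhere makes the choice in [wderiv] harmless. *)
Lemma wderivP e (f g : R -> R[i]) : sqintegrable (dom e) g ->
  weak_derivative (dom e) f g ->
  [/\ sqintegrable (dom e) (wderiv (dom e) f),
      weak_derivative (dom e) f (wderiv (dom e) f) &
      {ae mu, forall x, dom e x -> wderiv (dom e) f x = g x}].
Proof.
move=> sg fg; have mD := measurable_dom (R := R) e.
have [s1 f1] : sqintegrable (dom e) (wderiv (dom e) f) /\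
    weak_derivative (dom e) f (wderiv (dom e) f).
  by apply: (@xgetPex _ _ [set g | sqintegrable (dom e) g /\ weak_derivative (dom e) f g]); exists g.
split=> //.
have [a1 a2] := (sqint_L2 _ mD).1 s1; have [b1 b2] := (sqint_L2 _ mD).1 sg.
have [c1 c2] := (weak_rweak _ _ _).1 f1; have [d1 d2] := (weak_rweak _ _ _).1 fg.
apply: (ae_imp2 (rweak_uniq a1 b1 c1 d1) (rweak_uniq a2 b2 c2 d2)) => x /= h1 h2 ex.
by apply: complex_eq; [exact: h1|exact: h2].
Qed.

End regularity2.

(** * Second variation at the minimizer *)

Section tadpole_integrals.
Context {R : realType}.
Implicit Types (e : edge) (f g h k w : edge -> R -> R) (a b c x y t v : R).
Local Notation mu := (@lebesgue_measure R).
Local Notation dom := (@dom R).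

(** The integral over the graph, as a relation. *)
Definition ht k v := exists v1 v2,
  [/\ hasint (dom Circle) (k Circle) v1, hasint (dom Ray) (k Ray) v2 & v = v1 + v2].

Lemma htD k k' v v' : ht k v -> ht k' v' -> ht (fun e x => k e x + k' e x) (v + v').
Proof.
move=> [v1 [v2 [h1 h2 ->]]] [v1' [v2' [h1' h2' ->]]].
exists (v1 + v1'), (v2 + v2'); split; last by rewrite addrACA.
  exact: hasintD (measurable_dom _) h1 h1'.
exact: hasintD (measurable_dom _) h2 h2'.
Qed.

Lemma htZ k c v : ht k v -> ht (fun e x => c * k e x) (c * v).
Proof.
move=> [v1 [v2 [h1 h2 ->]]]; exists (c * v1), (c * v2); split; last by rewrite mulrDr.
  exact: hasintZ (measurable_dom _) h1.
exact: hasintZ (measurable_dom _) h2.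
Qed.

Lemma ht_ext k k' v : (forall e x, dom e x -> k e x = k' e x) -> ht k v -> ht k' v.
Proof.
move=> kk [v1 [v2 [h1 h2 ->]]]; exists v1, v2; split=> //.
  by apply: (hasint_ext _ _ h1); [exact: measurable_dom|exact: kk].
by apply: (hasint_ext _ _ h2); [exact: measurable_dom|exact: kk].
Qed.

Lemma ht_eqv k v v' : ht k v -> v = v' -> ht k v'.
Proof. by move=> ? <-. Qed.

Lemma ht_uniq k v v' : ht k v -> ht k v' -> v = v'.
Proof.
move=> [v1 [v2 [h1 h2 ->]]] [v1' [v2' [h1' h2' ->]]].
by rewrite (hasint_uniq h1 h1') (hasint_uniq h2 h2').
Qed.

Lemma ht_ge0 k v : ht k v -> (forall e x, dom e x -> 0 <= k e x) -> 0 <= v.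
Proof.
move=> [v1 [v2 [h1 h2 ->]]] k0; apply: addr_ge0.
  exact: hasint_ge0 h1 (k0 Circle).
exact: hasint_ge0 h2 (k0 Ray).
Qed.

Lemma ht_integ k : (forall e, integ (dom e) (k e)) -> exists v, ht k v.
Proof.
move=> h; exists (\int[mu]_(x in dom Circle) k Circle x + \int[mu]_(x in dom Ray) k Ray x).
by exists (\int[mu]_(x in dom Circle) k Circle x), (\int[mu]_(x in dom Ray) k Ray x).
Qed.

(** Bounded square integrable functions form an algebra. *)
Definition BL2 (A : set R) (f : R -> R) :=
  L2 A f /\ exists M, forall x, A x -> `|f x| <= M.

Lemma BL2_mul (A : set R) (f g : R -> R) : measurable A -> BL2 A f -> BL2 A g ->
  BL2 A (fun x => f x * g x).
Proof.
move=> mA [lf [M hM]] [lg [M' hM']]; split.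
  by apply: (L2_bounded_mul mA _ hM lg); case: lf.
by exists (M * M') => x Ax; rewrite normrM ler_pM ?hM ?hM'.
Qed.

Lemma BL2_exp (A : set R) (f : R -> R) n : measurable A -> BL2 A f ->
  BL2 A (fun x => f x ^+ n.+1).
Proof.
move=> mA bf; elim: n => [|n IH].
  by have := bf; congr (BL2 A _); apply/funext => x; rewrite expr1.
by have := BL2_mul mA bf IH; congr (BL2 A _); apply/funext => x; rewrite -exprS.
Qed.

Lemma BL2D (A : set R) (f g : R -> R) : measurable A -> BL2 A f -> BL2 A g ->
  BL2 A (fun x => f x + g x).
Proof.
move=> mA [lf [M hM]] [lg [M' hM']]; split; first exact: L2D.
exists (M + M') => x Ax; apply: le_trans (ler_normD _ _) _.
by rewrite lerD ?hM ?hM'.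
Qed.

Lemma BL2Z (A : set R) (f : R -> R) c : measurable A -> BL2 A f ->
  BL2 A (fun x => c * f x).
Proof.
move=> mA [lf [M hM]]; split; first exact: L2Z.
by exists (`|c| * M) => x Ax; rewrite normrM ler_wpM2l ?hM.
Qed.

(** The real part of the energy space H^1. Boundedness, which is automatic there, is
    included because all the expansions below need products of such functions. *)
Definition energy f g :=
  [/\ forall e, {within dom e, continuous (f e)}, forall e, BL2 (dom e) (f e),
      forall e, L2 (dom e) (g e), forall e, rweak (dom e) (f e) (g e) &
      f Circle pi = f Circle (- pi) /\ f Circle pi = f Ray 0].

Lemma energyZ f g c : energy f g ->
  energy (fun e x => c * f e x) (fun e x => c * g e x).
Proof.
move=> [h1 h2 h3 h4 [h5 h6]]; have mD e := measurable_dom (R := R) e.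
split; last by rewrite -h6 h5.
- move=> e; have /subspace_continuousP := h1 e => ck.
  by apply/subspace_continuousP => x ex; apply: cvgM; [exact: cvg_cst|exact: ck].
- by move=> e; exact: BL2Z.
- by move=> e; exact: L2Z.
- by move=> e; apply: rweakZ => //; case: (h2 e).
Qed.

Lemma energyD f g f' g' : energy f g -> energy f' g' ->
  energy (fun e x => f e x + f' e x) (fun e x => g e x + g' e x).
Proof.
move=> [h1 h2 h3 h4 [h5 h6]] [k1 k2 k3 k4 [k5 k6]].
have mD e := measurable_dom (R := R) e.
split; last by rewrite h5 k5 -h6 -k6 h5 k5.
- move=> e; have /subspace_continuousP := h1 e => ck.
  have /subspace_continuousP := k1 e => ck'.
  by apply/subspace_continuousP => x ex; apply: cvgD; [exact: ck|exact: ck'].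
- by move=> e; exact: BL2D.
- by move=> e; exact: L2D.
- by move=> e; apply: rweakD => //; [case: (h2 e)|case: (k2 e)].
Qed.

Definition cplx f : tadfun R := fun e x => (f e x)%:C.

Lemma hasint_ae (A : set R) (k k' : R -> R) v : measurable A -> measurable_fun A k' ->
  {ae mu, forall x, A x -> k x = k' x} -> hasint A k v -> hasint A k' v.
Proof.
move=> mA mk' kk [ik <-]; have mk := integ_measurable ik.
have ae1 : {ae mu, forall x, A x -> (k' x)%:E = (k x)%:E}.
  by apply: (ae_imp kk) => x /= h Ax; rewrite h.
have ae2 : {ae mu, forall x, A x -> `|(k' x)%:E|%E = `|(k x)%:E|%E}.
  by apply: (ae_imp kk) => x /= h Ax; rewrite h.
split.
  apply/integrableP; split; first exact/measurable_EFinP.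
  move/integrableP : ik => [_]; congr (_ < _)%E; symmetry.
  apply: ae_eq_integral ae2 => //; apply: measurableT_comp => //; exact/measurable_EFinP.
by congr fine; apply: ae_eq_integral ae1 => //; exact/measurable_EFinP.
Qed.

Lemma energy_H1C f g : energy f g -> [/\ H1C (cplx f),
  forall e, sqintegrable (dom e) (nabla (cplx f) e) &
  forall e, {ae mu, forall x, dom e x -> nabla (cplx f) e x = (g e x)%:C}].
Proof.
move=> [h1 h2 h3 h4 [h5 h6]]; have mD e := measurable_dom (R := R) e.
have l0 e : L2 (dom e) (fun=> 0 : R).
  have := L2Z 0 (mD e) (h3 e); apply: L2_ext => // x _; exact: mul0r.
have w0 e : rweak (dom e) (fun=> 0 : R) (fun=> 0 : R).
  by apply: (@rweak_C1 R e (fun=> 0) (fun=> 0)) => x; exact: cst_continuous.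
have sf e : sqintegrable (dom e) (cplx f e).
  by apply/(sqint_L2 _ (mD e)); split; [case: (h2 e)|exact: l0].
have sg e : sqintegrable (dom e) (fun x => (g e x)%:C).
  by apply/(sqint_L2 _ (mD e)); split; [exact: h3|exact: l0].
have wg e : weak_derivative (dom e) (cplx f e) (fun x => (g e x)%:C).
  by apply/weak_rweak; split; [exact: h4|exact: w0].
split; last 2 first.
- by move=> e; have [] := wderivP (sg e) (wg e).
- by move=> e; have [] := wderivP (sg e) (wg e).
split; last by rewrite /continuous_at_vertex /cplx h5 -h6 h5.
move=> e; split.
- exact: (h1 e).
- by apply: continuous_subspaceT => x; exact: cst_continuous.
- exact: sf.
- by exists (fun x => (g e x)%:C).
Qed.

Lemma Lnorm_tad_ht q (U : tadfun R) v : ht (fun e x => normc (U e x) ^+ q) v ->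
  Lnorm_tad q U = (v `^ (q%:R^-1))%:E.
Proof.
move=> [v1 [v2 [[i1 <-] [i2 <-] ->]]]; rewrite /Lnorm_tad.
have fin A (k : R -> R) : integ A k -> measurable A ->
    (\int[mu]_(x in A) (k x)%:E)%E = (\int[mu]_(x in A) k x)%:E.
  by move=> ik mA; rewrite /Rintegral fineK //; exact: integrable_fin_num.
by rewrite !fin // ?poweR_EFin //; exact: measurable_dom.
Qed.

Lemma fine_Lnorm2 (U : tadfun R) v : ht (fun e x => normc (U e x) ^+ 2) v ->
  fine (Lnorm_tad 2 U) ^+ 2 = v.
Proof.
move=> hv; rewrite (Lnorm_tad_ht hv) /=.
have v0 : 0 <= v by apply: ht_ge0 hv _ => e x _; exact: sqr_ge0.
by rewrite powR12_sqrt // sqr_sqrtr.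
Qed.

Lemma B_form_energy omega f g v v' : energy f g ->
  ht (fun e x => g e x ^+ 2) v -> ht (fun e x => f e x ^+ 2) v' ->
  B_form omega (cplx f) = v - omega * v'.
Proof.
move=> ef hv hv'; have [_ sn dn] := energy_H1C ef; have mD e := measurable_dom (R := R) e.
rewrite /B_form (@fine_Lnorm2 _ v) ?(@fine_Lnorm2 _ v') //.
  apply: ht_ext hv' => e x _; rewrite /cplx normc_real real_normK //; exact: num_real.
have h e z : hasint (dom e) (fun x => g e x ^+ 2) z ->
    hasint (dom e) (fun x => normc (nabla (cplx f) e x) ^+ 2) z.
  apply: hasint_ae => //.
    have [[m1 _] [m2 _]] := (sqint_L2 _ (mD e)).1 (sn e).
    apply: (@eq_measurable_fun _ _ _ _ _ (fun x => complex.Re (nabla (cplx f) e x) ^+ 2 +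
        complex.Im (nabla (cplx f) e x) ^+ 2)).
      by move=> x _; rewrite normc2.
    by apply: measurable_funD; exact: measurable_funX.
  apply: (ae_imp (dn e)) => x /= hx ex.
  by rewrite hx // normc_real real_normK //; exact: num_real.
by case: hv => [v1 [v2 [h1 h2 ->]]]; exists v1, v2; split=> //; exact: h.
Qed.

Lemma energy_exp f g n : energy f g -> exists v, ht (fun e x => f e x ^+ n.+2) v.
Proof.
move=> [_ h2 _ _ _]; apply: ht_integ => e; have mD := measurable_dom (R := R) e.
have [l1 _] := BL2_exp n mD (h2 e).
by apply: integ_ext (L2_mul mD l1 (h2 e).1) => // x _; rewrite -exprSr.
Qed.

Lemma energy_grad2 f g : energy f g -> exists v, ht (fun e x => g e x ^+ 2) v.
Proof. by move=> [_ _ h3 _ _]; apply: ht_integ => e; case: (h3 e). Qed.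

(** Scaling turns the constrained minimum into a homogeneous inequality; its cube is
    polynomial in the function. *)
Lemma calB_le omega f g n v v' : omega < 0 -> energy f g ->
  ht (fun e x => f e x ^+ 6) n -> 0 < n ->
  ht (fun e x => g e x ^+ 2) v -> ht (fun e x => f e x ^+ 2) v' ->
  calB omega ^+ 3 * n <= (v - omega * v') ^+ 3.
Proof.
move=> w0 ef hn n0 hv hv'.
pose c := n `^ (- (6%:R)^-1).
have c0 : 0 < c by rewrite powR_gt0.
have c6 : c ^+ 6 * n = 1.
  rewrite -powR_mulrn ?ltW // -powRrM mulNr mulVf // powRN powRr1 ?ltW //.
  by rewrite mulVf ?gt_eqF.
have ec := energyZ c ef; have [hc _ _] := energy_H1C ec.
have e1 : ht (fun e x => (c * g e x) ^+ 2) (c ^+ 2 * v).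
  by apply: ht_ext (htZ (c ^+ 2) hv) => e x _; rewrite exprMn.
have e2 : ht (fun e x => (c * f e x) ^+ 2) (c ^+ 2 * v').
  by apply: ht_ext (htZ (c ^+ 2) hv') => e x _; rewrite exprMn.
have e6 : ht (fun e x => normc (cplx (fun e x => c * f e x) e x) ^+ 6) 1.
  rewrite -c6; apply: ht_ext (htZ (c ^+ 6) hn) => e x _.
  rewrite /cplx normc_real -exprMn -[6%N]/(2 * 3)%N exprM [in RHS]exprM.
  by rewrite real_normK // num_real.
have adm : @admissible R (cplx (fun e x => c * f e x)).
  by split=> //; rewrite (Lnorm_tad_ht e6) powR1.
have := B_form_energy omega ec e1 e2.
have -> : c ^+ 2 * v - omega * (c ^+ 2 * v') = c ^+ 2 * (v - omega * v') by ring.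
move=> Bc.
have B0 (U : tadfun R) : 0 <= B_form omega U.
  rewrite /B_form addr_ge0 ?sqr_ge0 // oppr_ge0 mulr_le0_ge0 ?sqr_ge0 ?ltW //.
have le1 : calB omega <= c ^+ 2 * (v - omega * v').
  rewrite -Bc; apply: ge_inf; last by exists (cplx (fun e x => c * f e x)).
  by exists 0 => _ [U _ <-]; exact: B0.
have b0 : 0 <= calB omega.
  by apply: lb_le_inf; [exists (B_form omega (cplx (fun e x => c * f e x)));
    exists (cplx (fun e x => c * f e x))|move=> _ [U _ <-]; exact: B0].
have le3 : calB omega ^+ 3 <= (c ^+ 2 * (v - omega * v')) ^+ 3.
  by rewrite lerXn2r // nnegrE (le_trans b0 le1).
rewrite -[X in _ <= X]mulr1 -c6 mulrA.
rewrite ler_pM2r //; apply: le_trans le3 _.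
by rewrite exprMn -exprM mulrC.
Qed.

Lemma small_le0 (x C : R) : (forall t, 0 < t -> t <= 1 -> x <= C * t) -> x <= 0.
Proof.
move=> h; rewrite leNgt; apply/negP => x0.
have C1 : 0 < `|C| + 1 by rewrite ltr_wpDl.
pose t := Num.min 1 (x / (2 * (`|C| + 1))).
have t0 : 0 < t by rewrite lt_min ltr01 divr_gt0 // mulr_gt0.
have t1 : t <= 1 by rewrite ge_min lexx.
have t2 : t * (2 * (`|C| + 1)) <= x.
  by rewrite -ler_pdivlMr ?mulr_gt0 // ge_min lexx orbT.
have := h t t0 t1; have := ler_norm C; nra.
Qed.

(** Necessary conditions for a minimum at 0, by comparing the orders in t. *)
Lemma cubic_min (p1 p2 r0 r1 r2 r3 : R) :
  (forall t, `|t| <= 1 ->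
    0 <= p1 * t + p2 * t ^+ 2 + t ^+ 3 * (r0 + r1 * t + r2 * t ^+ 2 + r3 * t ^+ 3)) ->
  p1 = 0 /\ 0 <= p2.
Proof.
move=> h; pose K := `|r0| + `|r1| + `|r2| + `|r3|.
have K0 : 0 <= K by rewrite !addr_ge0.
have hr t : `|t| <= 1 -> `|r0 + r1 * t + r2 * t ^+ 2 + r3 * t ^+ 3| <= K.
  move=> t1; have hn (r : R) n : `|r * t ^+ n| <= `|r|.
    by rewrite normrM normrX ler_piMr // exprn_ile1.
  apply: le_trans (ler_normD _ _) _; rewrite lerD ?hn //.
  apply: le_trans (ler_normD _ _) _; rewrite lerD ?hn //.
  apply: le_trans (ler_normD _ _) _; rewrite lerD //.
  by have := hn r1 1%N; rewrite expr1.
have h' t : `|t| <= 1 -> 0 <= p1 * t + p2 * t ^+ 2 + K * `|t| ^+ 3.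
  move=> t1; apply: le_trans (h t t1) _; rewrite lerD2l.
  apply: le_trans (ler_norm _) _; rewrite normrM normrX mulrC.
  by rewrite ler_wpM2r ?exprn_ge0 // hr.
have p10 : p1 = 0.
  apply/eqP; rewrite eq_le; apply/andP; split.
    apply: (@small_le0 _ (`|p2| + K)) => t t0 t1.
    have tt : `|- t| <= 1 by rewrite normrN gtr0_norm.
    have := h' _ tt; rewrite normrN gtr0_norm // sqrrN.
    have t3 : t ^+ 3 <= t ^+ 2 by rewrite exprSr ler_piMr // sqr_ge0.
    have := ler_norm p2; have := sqr_ge0 t => a1 a2 a3.
    have : p1 * t <= (`|p2| + K) * t * t by rewrite -mulrA -expr2; nra.
    by rewrite ler_pM2r.
  rewrite -oppr_le0; apply: (@small_le0 _ (`|p2| + K)) => t t0 t1.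
  have tt : `|t| <= 1 by rewrite gtr0_norm.
  have := h' _ tt; rewrite gtr0_norm //.
  have t3 : t ^+ 3 <= t ^+ 2 by rewrite exprSr ler_piMr // sqr_ge0.
  have := ler_norm p2; have := sqr_ge0 t => a1 a2 a3.
  have : - p1 * t <= (`|p2| + K) * t * t by rewrite -mulrA -expr2; nra.
  by rewrite ler_pM2r.
split=> //; rewrite -oppr_le0; apply: (@small_le0 _ K) => t t0 t1.
have tt : `|t| <= 1 by rewrite gtr0_norm.
have := h' _ tt; rewrite gtr0_norm // p10 mul0r add0r exprSr => a1.
have t2 : 0 < t ^+ 2 by rewrite exprn_gt0.
have : - p2 * t ^+ 2 <= K * t * t ^+ 2 by nra.
by rewrite ler_pM2r.
Qed.

(** The polynomial B(phi + t w)^3 - 27 N(phi)^2 N(phi + t w), where N is the integral of the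
    sixth power, is nonnegative and vanishes at t = 0. Its coefficient of order t vanishes,
    whence that of order t^2 is 27 N(phi)^2 times the second variation. *)
Lemma second_variation omega phi dphi w dw n v v' q :
  omega < 0 -> energy phi dphi -> energy w dw ->
  ht (fun e x => phi e x ^+ 6) n -> 0 < n ->
  ht (fun e x => dphi e x ^+ 2) v -> ht (fun e x => phi e x ^+ 2) v' ->
  v - omega * v' = 3 * n ->
  calB omega ^+ 3 = 27 * n ^+ 2 ->
  ht (fun e x => phi e x ^+ 5 * w e x) 0 ->
  ht (fun e x => dw e x ^+ 2 + (- omega - 15 * phi e x ^+ 4) * w e x ^+ 2) q ->
  0 <= q.
Proof.
move=> w0 ep ew hn n0 hv hv' Bn cB h5 hq.
have mD e := measurable_dom (R := R) e.
case: (ep) => _ bp lp _ _; case: (ew) => _ bw lw _ _.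
have bpw i j e : BL2 (dom e) (fun x => phi e x ^+ i.+1 * w e x ^+ j.+1).
  by apply: BL2_mul => //; exact: BL2_exp.
have ipw i j : exists a, ht (fun e x => phi e x ^+ i.+1 * w e x ^+ j.+1) a.
  apply: ht_integ => e; case: (BL2_exp i (mD e) (bp e)) => l1 _.
  by apply: L2_mul => //; case: (BL2_exp j (mD e) (bw e)).
have [a2 h2] := ipw 3%N 1%N; have [a3 h3] := ipw 2%N 2%N; have [a4 h4] := ipw 1%N 3%N.
have [a5 h5'] := ipw 0%N 4%N; have [a6 h6] := energy_exp 4 ew.
have [b1 hb1] : exists b, ht (fun e x => dphi e x * dw e x) b.
  by apply: ht_integ => e; exact: L2_mul.
have [b2 hb2] := ipw 0%N 0%N.
have [d1 hd1] := energy_grad2 ew; have [d2 hd2] := energy_exp 0 ew.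
pose m := - omega.
have qE : q = d1 + m * d2 - 15 * a2.
  apply: (ht_uniq hq); have H := htD (htD hd1 (htZ m hd2)) (htZ (-15) h2).
  apply: ht_eqv (_ : d1 + m * d2 + -15 * a2 = _); last by rewrite mulNr.
  by apply: ht_ext H => e x _; rewrite /m; ring.
have key t : `|t| <= 1 ->
    27 * n ^+ 2 * (n + 15 * t ^+ 2 * a2 + 20 * t ^+ 3 * a3 + 15 * t ^+ 4 * a4 +
      6 * t ^+ 5 * a5 + t ^+ 6 * a6) <=
    (3 * n + 2 * t * (b1 + m * b2) + t ^+ 2 * (d1 + m * d2)) ^+ 3.
  move=> _.
  have et := energyD ep (energyZ t ew).
  set S := n + _ + _ + _ + _ + _.
  have hS : ht (fun e x => (phi e x + t * w e x) ^+ 6) S.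
    have := htD (htD (htD (htD (htD (htD hn (htZ (6 * t) h5)) (htZ (15 * t ^+ 2) h2))
      (htZ (20 * t ^+ 3) h3)) (htZ (15 * t ^+ 4) h4)) (htZ (6 * t ^+ 5) h5')) (htZ (t ^+ 6) h6).
    rewrite mulr0 addr0 => /(ht_ext _); apply => e x _ /=; ring.
  have hG : ht (fun e x => (dphi e x + t * dw e x) ^+ 2) (v + 2 * t * b1 + t ^+ 2 * d1).
    have := htD (htD hv (htZ (2 * t) hb1)) (htZ (t ^+ 2) hd1).
    by apply: ht_ext => e x _ /=; ring.
  have hF : ht (fun e x => (phi e x + t * w e x) ^+ 2) (v' + 2 * t * b2 + t ^+ 2 * d2).
    have := htD (htD hv' (htZ (2 * t) hb2)) (htZ (t ^+ 2) hd2).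
    by apply: ht_ext => e x _ /=; ring.
  have S0 : 0 <= S.
    by apply: ht_ge0 hS _ => e x _; rewrite -[6%N]/(2 * 3)%N exprM exprn_ge0 ?sqr_ge0.
  have eB : v + 2 * t * b1 + t ^+ 2 * d1 - omega * (v' + 2 * t * b2 + t ^+ 2 * d2) =
    3 * n + 2 * t * (b1 + m * b2) + t ^+ 2 * (d1 + m * d2) by rewrite -Bn /m; ring.
  move: S0; rewrite le_eqVlt => /orP[/eqP <-|S0].
    rewrite mulr0 -eB exprn_ge0 // addr_ge0 //.
      by apply: ht_ge0 hG _ => e x _; exact: sqr_ge0.
    rewrite oppr_ge0 mulr_le0_ge0 ?(ltW w0) //.
    by apply: ht_ge0 hF _ => e x _; exact: sqr_ge0.
  by rewrite -cB -eB; exact: calB_le hS S0 hG hF.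
set B1 := b1 + m * b2 in key; set B2 := d1 + m * d2 in key.
have [t ht1|p1 p2] := @cubic_min (54 * n ^+ 2 * B1)
  (27 * n ^+ 2 * B2 + 36 * n * B1 ^+ 2 - 405 * n ^+ 2 * a2)
  (36 * n * B1 * B2 + 8 * B1 ^+ 3 - 540 * n ^+ 2 * a3)
  (9 * n * B2 ^+ 2 + 12 * B1 ^+ 2 * B2 - 405 * n ^+ 2 * a4)
  (6 * B1 * B2 ^+ 2 - 162 * n ^+ 2 * a5) (B2 ^+ 3 - 27 * n ^+ 2 * a6).
  by have := key t ht1; rewrite -subr_ge0; congr (_ <= _); ring.
have n2 : 0 < n ^+ 2 by rewrite exprn_gt0.
have B10 : B1 = 0.
  have n54 : 54 * n ^+ 2 != 0 by rewrite gt_eqF // mulr_gt0.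
  by apply: (mulfI n54); rewrite mulr0.
move: p2; rewrite B10 expr0n mulr0 addr0 qE -/B2.
have -> : 27 * n ^+ 2 * B2 - 405 * n ^+ 2 * a2 = 27 * n ^+ 2 * (B2 - 15 * a2) by ring.
by rewrite pmulr_rge0 // mulr_gt0.
Qed.

End tadpole_integrals.

(** * Piecewise smooth functions, and functions on the half-line *)

Section tools.
Context {R : realType}.
Implicit Types (f g h k w F : R -> R) (a b c x y d t : R).
Local Notation mu := (@lebesgue_measure R).

Lemma ctD f g x : {for x, continuous f} -> {for x, continuous g} ->
  {for x, continuous (fun y => f y + g y)}.
Proof. exact: continuousD. Qed.

Lemma ctM f g x : {for x, continuous f} -> {for x, continuous g} ->
  {for x, continuous (fun y => f y * g y)}.
Proof. exact: continuousM. Qed.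

Lemma ctN f x : {for x, continuous f} -> {for x, continuous (fun y => - f y)}.
Proof. exact: continuousN. Qed.

Lemma ctB f g x : {for x, continuous f} -> {for x, continuous g} ->
  {for x, continuous (fun y => f y - g y)}.
Proof. exact: continuousB. Qed.

Lemma ctC c x : {for x, continuous (fun=> c)}.
Proof. exact: cst_continuous. Qed.

Lemma ctX f n x : {for x, continuous f} -> {for x, continuous (fun y => f y ^+ n)}.
Proof.
move=> cf; elim: n => [|n IH].
  by rewrite (_ : (fun y => _) = (fun=> 1)); [exact: ctC|apply/funext => y].
rewrite (_ : (fun y => _) = (fun y => f y * f y ^+ n)); first exact: ctM.
by apply/funext => y; rewrite exprS.
Qed.

Lemma cc_bounded f a b : a <= b -> {within `[a, b], continuous f} ->
  exists2 C : R, 0 <= C & forall x, a <= x <= b -> `|f x| <= C.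
Proof.
move=> ab cf.
have cN : {within `[a, b], continuous (fun x => `|f x|)}.
  move/subspace_continuousP : cf => cf; apply/subspace_continuousP => x Ix.
  exact: cvg_norm (cf x Ix).
have [z _ hz] := EVT_max ab cN; exists `|f z| => // x hx; exact: hz.
Qed.

Lemma interior_min f (f1 : R -> R) a b y : (forall x, a <= x <= b -> dv f x (f1 x)) ->
  a <= y <= b -> f y < f a -> f y < f b ->
  exists c, [/\ a < c < b, f1 c = 0 & f c <= f y].
Proof.
move=> df /andP[ay yb] fa fb.
have ab : a <= b by lra.
have [c] := EVT_min ab (dv_within df); rewrite in_itv /= => /andP[ac cb] hc.
have cy : f c <= f y by apply: hc; rewrite in_itv /= ay.
have ca : a < c.
  by rewrite lt_neqAle ac andbT; apply/eqP => e; move: cy; rewrite -e leNgt fa.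
have cb' : c < b.
  by rewrite lt_neqAle cb andbT; apply/eqP => e; move: cy; rewrite e leNgt fb.
exists c; split=> //; first by rewrite ca.
have dc : dv f c (f1 c) by apply: df; rewrite ac.
apply: (dv_uniq dc); apply: (@derive1_at_min R f a b c ab).
- by move=> t; rewrite in_itv /= => /andP[/ltW a1 /ltW b1]; case: (df t); rewrite ?a1.
- by rewrite in_itv /= ca.
- by move=> t; rewrite in_itv /= => /andP[/ltW a1 /ltW b1]; apply: hc; rewrite in_itv /= a1.
Qed.

Lemma pos_left f a b : a < b -> {for b, continuous f} -> 0 < f b ->
  exists2 y, a < y < b & forall x, y <= x <= b -> 0 < f x.
Proof.
move=> ab cf fb.
have /cvgrPdist_lt /(_ _ fb) [D /= D0 hD] := cf.
pose y := Num.max ((a + b) / 2) (b - D / 2).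
have y1 : (a + b) / 2 <= y by rewrite le_max lexx.
have y2 : b - D / 2 <= y by rewrite le_max lexx orbT.
have y3 : y < b by rewrite gt_max; apply/andP; split; lra.
exists y; first by apply/andP; split; lra.
move=> x /andP[yx xb].
have : `|b - x| < D by rewrite ger0_norm; lra.
by move=> /hD; rewrite ltr_norml => /andP[_]; lra.
Qed.

Lemma lower_left f (f1 : R -> R) a b : a < b -> (forall x, a <= x <= b -> dv f x (f1 x)) ->
  {for b, continuous f1} -> 0 < f1 b -> exists2 y, a < y < b & f y < f b.
Proof.
move=> ab df cf fb; have [y /andP[ay yb] hy] := pos_left ab cf fb.
exists y; first by rewrite ay.
apply: (dv_gt0_lt (df := f1) yb).
  by move=> x /andP[yx xb]; apply: df; rewrite xb (le_trans (ltW ay)).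
by move=> x /andP[/ltW yx /ltW xb]; apply: hy; rewrite yx.
Qed.

Lemma lower_left2 f (f1 f2 : R -> R) a b : a < b ->
  (forall x, a <= x <= b -> dv f x (f1 x)) ->
  (forall x, a <= x <= b -> dv f1 x (f2 x)) ->
  {for b, continuous f2} -> f1 b = 0 -> f2 b < 0 -> exists2 y, a < y < b & f y < f b.
Proof.
move=> ab df df1 cf f10 fb.
have cf' : {for b, continuous (fun x => - f2 x)} by exact: continuousN.
have [|y /andP[ay yb] hy] := pos_left ab cf'; first by rewrite oppr_gt0.
exists y; first by rewrite ay.
have hab x : y <= x <= b -> a <= x <= b.
  by move=> /andP[yx xb]; rewrite xb (le_trans (ltW ay)).
apply: (dv_gt0_lt (df := f1) yb).
  by move=> x /hab; exact: df.
move=> x /andP[yx xb]; rewrite -f10.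
apply: (dv_lt0_gt (df := f2) xb).
  by move=> z /andP[xz zb]; apply: df1; apply: hab; rewrite zb (le_trans (ltW yx)).
move=> z /andP[/ltW xz /ltW zb]; rewrite -oppr_gt0; apply: hy.
by rewrite zb (le_trans (ltW yx)).
Qed.

(** ** Decay *)

Definition vanish f := forall E : R, 0 < E -> exists2 X : R, 0 <= X & forall x, X <= x -> `|f x| < E.

Lemma vanish_cvg f : vanish f -> f x @[x --> +oo] --> (0 : R).
Proof.
move=> vf; apply/cvgrPdist_lt => E E0; have [X X0 hX] := vf E E0.
exists X; split; first exact: num_real.
by move=> x /ltW /hX; rewrite sub0r normrN.
Qed.

Lemma vanish_bounded f : vanish f -> (forall x, 0 <= x -> {for x, continuous f}) ->
  exists2 M : R, 0 <= M & forall x, 0 <= x -> `|f x| <= M.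
Proof.
move=> /(_ 1 ltr01) [X X0 hX] cf.
have [|C C0 hC] := @cc_bounded f 0 X X0.
  by apply/continuous_in_subspaceT => x; rewrite inE /= in_itv /= => /andP[x0 _]; exact: cf.
exists (C + 1); first by rewrite addr_ge0.
move=> x x0; have [/hX h|/ltW xX] := leP X x; first by lra.
by have := hC x; rewrite x0 xX => /(_ isT); lra.
Qed.

(** With S a primitive of f^2 + f'^2, both S and S - f^2 are nondecreasing and bounded, so
    f^2 has a limit at infinity; being integrable it tends to 0. *)
Lemma H1_vanish f (f1 : R -> R) : (forall x, 0 <= x -> dv f x (f1 x)) -> continuous f1 ->
  continuous f -> L2 `[0, +oo[ f -> L2 `[0, +oo[ f1 -> vanish f.
Proof.
move=> df cf1 cf lf lf1.
pose h x := f x ^+ 2 + f1 x ^+ 2.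
have ch : continuous h.
  by move=> x; exact: (ctD (ctX (cf x)) (ctX (cf1 x))).
have m0 : measurable (`[0, +oo[ : set R) by exact: measurable_itv.
have ih : integ `[0, +oo[ h by exact: integD (lf.2) (lf1.2).
have [S S0 dS] := primitive ch.
pose M := \int[mu]_(x in `[0, +oo[) h x.
have h0 x : 0 <= h x by rewrite addr_ge0 ?sqr_ge0.
have SM x : 0 <= x -> S x <= M.
  move=> x0.
  have h1 : hasint `[0, x] h (S x - S 0).
    by apply: (@hasint_ftc _ h) => // z _; exact: ch.
  have ix : integ `[x, +oo[ h by apply: (integS _ m0 _ ih) => //; apply: subset_itvr.
  have h2 := hasint_cat_cy x0 h1 (integ_hasint ix).
  have -> : M = S x - S 0 + \int[mu]_(x in `[x, +oo[) h x by apply: hasint_uniq h2.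
  rewrite S0 subr0 lerDl; exact: (hasint_ge0 (integ_hasint ix)).
have [l1 hl1] : exists l : R, S x @[x --> +oo] --> l.
  apply: (bounded_ndecr_cvg (a := 0) _ SM) => x y _ xy.
  by apply: (dv_ge0_le xy (fun z _ => dS z)) => z _; exact: h0.
have [l2 hl2] : exists l : R, S x - f x ^+ 2 @[x --> +oo] --> l.
  apply: (bounded_ndecr_cvg (a := 0) (M := M)).
    move=> x y x0 xy; apply: (dv_ge0_le (f := fun z => S z - f z ^+ 2) (df := fun z => h z - 2 * f z * f1 z) xy).
      move=> z /andP[xz _]; apply: dv_eq (dvB (dS z) (dvX 2 (df z (le_trans x0 xz)))) _.
      by rewrite expr1.
    move=> z _; rewrite /h.
    have -> : f z ^+ 2 + f1 z ^+ 2 - 2 * f z * f1 z = (f z - f1 z) ^+ 2 by ring.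
    exact: sqr_ge0.
  by move=> x /SM h1; have := sqr_ge0 (f x); lra.
have hf : f x ^+ 2 @[x --> +oo] --> l1 - l2.
  have -> : (fun x => f x ^+ 2) = (fun x => S x - (S x - f x ^+ 2)).
    by apply/funext => x; ring.
  exact: cvgB.
have l0 : l1 - l2 = 0.
  apply/eqP; rewrite eq_le; apply/andP; split; last first.
    by apply: (cvgr_to_ge hf); apply: nearW => x; exact: sqr_ge0.
  rewrite leNgt; apply/negP => lp.
  have /cvgrPdist_lt /(_ ((l1 - l2) / 2)) := hf.
  rewrite divr_gt0 // => /(_ isT) [X [_ hX]].
  pose Y := Num.max X 0 + 1.
  have Y0 : 0 <= Y by rewrite addr_ge0 // le_max lexx orbT.
  have YX : X < Y by rewrite ltr_pwDr // le_max lexx.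
  pose Z := Y + (M + 1) / ((l1 - l2) / 2).
  have M0 : 0 <= M by rewrite -S0 SM.
  have YZ : Y < Z by rewrite ltrDl divr_gt0 ?divr_gt0 //; lra.
  have [c /andP[Yc cZ] e] := mvt YZ (fun z _ => dS z).
  have fc : (l1 - l2) / 2 <= h c.
    have := hX c (lt_trans YX Yc); rewrite ltr_norml /h; have := sqr_ge0 (f1 c); lra.
  have : M + 1 <= S Z - S Y.
    rewrite e /Z addrAC subrr add0r -ler_pdivrMr; last by rewrite divr_gt0 ?divr_gt0 //; lra.
    rewrite invf_div mulrCA divff ?mulr1; last by rewrite gt_eqF //; lra.
    exact: fc.
  have := SM Z (le_trans Y0 (ltW YZ)).
  have : S 0 <= S Y by apply: (dv_ge0_le Y0 (fun z _ => dS z)) => z _; exact: h0.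
  rewrite S0; lra.
move=> E E0; have /cvgrPdist_lt /(_ (E ^+ 2)) := hf.
rewrite exprn_gt0 // => /(_ isT) [X [_ hX]].
exists (Num.max X 0 + 1); first by rewrite addr_ge0 // le_max lexx orbT.
move=> x Xx; have : X < x by apply: lt_le_trans Xx; rewrite ltr_pwDr // le_max lexx.
move=> /hX; rewrite l0 sub0r normrN ger0_norm ?sqr_ge0 //.
rewrite -(real_normK (num_real (f x))) => h1; rewrite ltNge; apply/negP => hE.
by have : E ^+ 2 <= `|f x| ^+ 2; [rewrite lerXn2r ?nnegrE ?(ltW E0)|rewrite leNgt h1].
Qed.

(** ** Piecewise smooth functions *)

(** Integration by parts is demanded on all the intervals [a, d], so that adjacent pieces
    glue without any condition on their derivatives. *)
Definition pw a (b : itv_bound R) f g :=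
  [/\ {within [set` Interval (BLeft a) b], continuous f},
      BL2 [set` Interval (BLeft a) b] f, L2 [set` Interval (BLeft a) b] g &
      forall d, a <= d -> (BRight d <= b)%O -> ibp a d f g].

Lemma pw_C1 a b f g F (F1 : R -> R) : a <= b ->
  (forall x, dv F x (F1 x)) -> continuous F1 ->
  (forall x, a <= x <= b -> f x = F x) ->
  (forall x, a < x < b -> g x = F1 x) -> pw a (BRight b) f g.
Proof.
move=> ab dF cF1 fF gF1.
have cF : continuous F by move=> x; exact: dv_cont (dF x).
have mI : measurable (`[a, b] : set R) by exact: measurable_itv.
have fF' x : `[a, b]%classic x -> F x = f x by rewrite /= in_itv /= => /fF ->.
have wf : {within `[a, b], continuous f}.
  apply: subspace_eq_continuous (continuous_subspaceT cF) => x; rewrite inE.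
  exact: fF'.
have [C _ hC] := cc_bounded ab wf.
split=> //.
- split; first by apply: L2_ext fF' (L2_cc _) => // x _; exact: cF.
  by exists C => x; rewrite /= in_itv /=; exact: hC.
- have cF2 : continuous (fun x => F1 x ^+ 2).
    by move=> x; exact: (ctX (cF1 x)).
  have [H _ dH] := primitive cF2.
  have [ig _] : hasint `[a, b] (fun x => g x ^+ 2) (H b - H a).
    apply: (@hasint_ftc _ (fun x => F1 x ^+ 2)) => //; first by move=> x _; exact: cF2.
    by move=> x /gF1 ->.
  split=> //; apply: (@measurable_fun_itv_cc _ _ _ false true).
  apply: (@eq_measurable_fun _ _ _ _ _ F1).
    by move=> x; rewrite inE /= in_itv /= => /gF1 ->.
  apply: (measurable_funS (E := `[a, b]%classic)) => //; first exact: subset_itv_oo_cc.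
  by apply: cc_continuous_measurable => x _; exact: cF1.
move=> d ad; rewrite bnd_simp => db.
apply: (ibp_C1 (F := F) (F1 := F1)) => // x /andP[x1 x2].
  by apply: fF; rewrite x1 (le_trans x2).
by apply: gF1; rewrite x1 (lt_le_trans x2).
Qed.

Lemma pw_ray a f g F (F1 : R -> R) :
  (forall x, dv F x (F1 x)) -> continuous F1 ->
  (forall x, a <= x -> f x = F x) ->
  (forall x, a < x -> g x = F1 x) ->
  BL2 `[a, +oo[ F -> L2 `[a, +oo[ F1 -> pw a +oo%O f g.
Proof.
move=> dF cF1 fF gF1 [lF [M hM]] lF1.
have cF : continuous F by move=> x; exact: dv_cont (dF x).
have mI : measurable (`[a, +oo[ : set R) by exact: measurable_itv.
have fF' x : `[a, +oo[%classic x -> F x = f x by rewrite /= in_itv /= andbT => /fF ->.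
have mo : measurable (`]a, +oo[ : set R) by exact: measurable_itv.
have gF' x : `]a, +oo[%classic x -> F1 x = g x by rewrite /= in_itv /= andbT => /gF1 ->.
split.
- apply: subspace_eq_continuous (continuous_subspaceT cF) => x; rewrite inE.
  exact: fF'.
- split; first exact: L2_ext fF' lF.
  by exists M => x hx; rewrite -fF' // hM.
- have [mg ig] : L2 `]a, +oo[ g.
    apply: (L2_ext mo gF'); apply: (L2S mo mI) lF1.
    by move=> x /=; rewrite !in_itv /= !andbT => /ltW.
  split; first exact/measurable_fun_itv_obnd_cbndP.
  have e1 : `[a, +oo[%classic = [set a] `|` `]a, +oo[ :> set R.
    apply/seteqP; split => x /=; rewrite !in_itv /= !andbT.
      by rewrite le_eqVlt => /orP[/eqP<-|]; [left|right].
    by move=> [->|/ltW].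
  rewrite e1; apply: integU => //.
    by apply/disj_setPS => x /= []; rewrite in_itv /= => ->; rewrite ltxx.
  apply/integrableP; split; first exact: measurable_fun_set1.
  by rewrite integral_set1.
move=> d ad _; apply: (ibp_C1 (F := F) (F1 := F1)) => // x /andP[x1 _].
  exact: fF.
exact: gF1.
Qed.

Lemma pw_cat a c (b : itv_bound R) f g : a <= c -> (BRight c <= b)%O ->
  closed [set` Interval (BLeft c) b] ->
  pw a (BRight c) f g -> pw c b f g -> pw a b f g.
Proof.
move=> ac cb' clb [w1 [l1 [M1 b1]] g1 i1] [w2 [l2 [M2 b2]] g2 i2].
have cb : (BLeft c <= b)%O by apply: le_trans cb'; rewrite bnd_simp.
pose I := [set` Interval (BLeft a) b].
pose I1 := `[a, c]%classic : set R; pose I2 := [set` Interval (BLeft c) b].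
have Iu : I = I1 `|` I2.
  rewrite /I /I1 /I2 (@itv_bndbnd_setU _ _ (BLeft a) (BLeft c) b) ?bnd_simp //.
  apply/seteqP; split => x /=; last first.
    move=> [|]; last by right.
    rewrite !in_itv /= => /andP[ax]; rewrite le_eqVlt => /orP[/eqP->|xc]; last by left; rewrite ax.
    by right; change (is_true (c \in Interval (BLeft c) b)); rewrite itv_boundlr lexx cb'.
  move=> [|]; last by right.
  by rewrite !in_itv /= => /andP[ax /ltW xc]; left; rewrite ax.
have mI : measurable I by exact: measurable_itv.
have m1 : measurable I1 by exact: measurable_itv.
have m2 : measurable I2 by exact: measurable_itv.
have mU k : measurable_fun I1 k -> measurable_fun I2 k -> measurable_fun I k.
  by move=> k1 k2; rewrite Iu; apply/measurable_funU.
have iU k : integ I1 k -> integ I2 k -> integ I k.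
  by move=> k1 k2; case: (hasint_cat ac cb (integ_hasint k1) (integ_hasint k2)).
have lU k : L2 I1 k -> L2 I2 k -> L2 I k.
  by move=> [k1 k2] [k3 k4]; split; [exact: mU|exact: iU].
split.
- rewrite -/I Iu; apply: withinU_continuous => //.
  exact: interval_closed.
- split; first exact: lU.
  exists (Num.max M1 M2) => x; rewrite -/I Iu => -[/b1|/b2] h;
    by apply: le_trans h _; rewrite le_max lexx ?orbT.
- exact: lU.
move=> d ad db; have [dc|/ltW cd] := leP d c.
  by apply: i1 => //; rewrite bnd_simp.
apply: (@ibp_cat _ _ c); first by rewrite ac.
  by apply: i1 => //; rewrite bnd_simp.
exact: i2.
Qed.

End tools.
Arguments ctC {R} c x.

(** * The profile of the ground state *)

Section profile.
Context {R : realType}.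
Implicit Types (a b c x y d t : R).

(** A positive classical solution of the stationary equation, [u] on the circle and [v] on the
    ray, with [m] for -omega. Both are extended to the line as C^2 functions, which spares
    one-sided derivatives at the vertex. *)
Record profile (m : R) (u u1 u2 v v1 v2 : R -> R) : Prop := Profile {
  prm : 0 < m;
  pru : forall x, dv u x (u1 x);
  pru1 : forall x, dv u1 x (u2 x);
  pru2 : continuous u2;
  pruE : forall x, - pi <= x <= pi -> u2 x = m * u x - 3 * u x ^+ 5;
  prv : forall x, dv v x (v1 x);
  prv1 : forall x, dv v1 x (v2 x);
  prv2 : continuous v2;
  prvE : forall x, 0 <= x -> v2 x = m * v x - 3 * v x ^+ 5;
  prup : forall x, - pi <= x <= pi -> 0 < u x;
  prvp : forall x, 0 <= x -> 0 < v x;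
  prvL : L2 `[0, +oo[ v;
  prv1L : L2 `[0, +oo[ v1;
  prver : u pi = u (- pi) /\ u pi = v 0;
  prkir : u1 pi - u1 (- pi) = v1 0 }.

Context (m : R) (u u1 u2 v v1 v2 : R -> R) (P : profile m u u1 u2 v v1 v2).

Let m0 : 0 < m := prm P.

Lemma cu : continuous u. Proof. by move=> x; exact: dv_cont (pru P x). Qed.
Lemma cu1 : continuous u1. Proof. by move=> x; exact: dv_cont (pru1 P x). Qed.
Lemma cv : continuous v. Proof. by move=> x; exact: dv_cont (prv P x). Qed.
Lemma cv1 : continuous v1. Proof. by move=> x; exact: dv_cont (prv1 P x). Qed.

Lemma pi_circle : - pi <= (pi : R) <= pi. Proof. by rewrite lexx ltW // pi2. Qed.
Lemma npi_circle : - pi <= - (pi : R) <= pi. Proof. by rewrite lexx ltW // pi2. Qed.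

(** ** The ray *)

Lemma v_vanish : vanish v.
Proof.
exact: (H1_vanish (fun x _ => prv P x) cv1 cv (prvL P) (prv1L P)).
Qed.

Lemma v2_L2 : L2 `[0, +oo[ v2.
Proof.
have [|M M0 hM] := vanish_bounded v_vanish; first by move=> x _; exact: cv.
have mI : measurable (`[0, +oo[ : set R) by exact: measurable_itv.
apply: (@L2_ext _ _ (fun x => (m - 3 * v x ^+ 4) * v x)) => //.
  by move=> x /=; rewrite in_itv /= andbT => x0; rewrite (prvE P x0); ring.
apply: (@L2_bounded_mul _ _ _ _ (m + 3 * M ^+ 4)) (prvL P) => //.
  apply: measurable_funB => //; apply: measurable_funM => //; apply: measurable_funX.
  by case: (prvL P).
move=> x /=; rewrite in_itv /= andbT => x0; apply: le_trans (ler_normB _ _) _.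
rewrite (gtr0_norm m0) lerD2l normrM normrX (ger0_norm (_ : 0 <= 3)) // ler_wpM2l //.
by rewrite lerXn2r ?nnegrE ?hM.
Qed.

Lemma v1_vanish : vanish v1.
Proof.
exact: (H1_vanish (fun x _ => prv1 P x) (prv2 P) cv1 (prv1L P) v2_L2).
Qed.

(** The first integral vanishes, as it does at infinity. *)
Lemma ray_energy x : 0 <= x -> v1 x ^+ 2 = v x ^+ 2 * (m - v x ^+ 4).
Proof.
move=> x0; pose I y := v1 y ^+ 2 - m * v y ^+ 2 + v y ^+ 6.
have dI y : 0 <= y -> dv I y 0.
  move=> y0; apply: dv_eq (dvD (dvB (dvX 2 (prv1 P y))
    (dvM (dv_cst m y) (dvX 2 (prv P y)))) (dvX 6 (prv P y))) _.
  by rewrite (prvE P y0) /=; ring.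
have cI y : 0 <= y -> I y = I x.
  move=> y0; apply: (@dv0_cst _ I 0 (Num.max x y)); rewrite ?x0 ?y0 ?le_max ?lexx ?orbT //.
  by move=> z /andP[z0 _]; exact: dI.
have lI : I y @[y --> +oo] --> (0 ^+ 2 - m * 0 ^+ 2 + 0 ^+ 6 : R).
  have c1 := vanish_cvg v_vanish; have c2 := vanish_cvg v1_vanish.
  have e (f : R -> R) n : f y @[y --> +oo] --> (0 : R) -> f y ^+ n @[y --> +oo] --> (0 ^+ n : R).
    move=> h; exact: (cvg_comp _ _ h (@exprn_continuous _ n 0)).
  apply: cvgD; last exact: e.
  by apply: cvgB; [exact: e|apply: cvgM; [exact: cvg_cst|exact: e]].
have : I x = 0.
  have lI' : I y @[y --> +oo] --> I x.
    apply: cvg_near_cst; exists 0; split; first exact: num_real.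
    by move=> y /ltW; exact: cI.
  by rewrite (cvg_unique _ lI' lI) // !expr0n /= mulr0 subrr addr0.
by rewrite /I => h; rewrite -[LHS]subr0 -h; ring.
Qed.

Lemma v4_le x : 0 <= x -> v x ^+ 4 <= m.
Proof.
move=> x0; have h := ray_energy x0; have v0 := prvp P x0.
have : 0 <= v x ^+ 2 * (m - v x ^+ 4) by rewrite -h sqr_ge0.
by rewrite pmulr_rge0 ?exprn_gt0 // subr_ge0.
Qed.

Lemma pow4_lt x y : 0 < x -> x < y -> x ^+ 4 < y ^+ 4.
Proof. by move=> x0 xy; rewrite ltrXn2r // ?nnegrE ltW // (lt_trans x0). Qed.

(** A zero of v' is a maximum of v; before it v would have to turn around. *)
Lemma ray_monotone : v1 0 < 0 -> forall x, 0 <= x -> v1 x < 0.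
Proof.
move=> v10 x x0; rewrite ltNge; apply/negP => v1x.
have xp : 0 < x.
  by rewrite lt_neqAle x0 andbT; apply/eqP => e; move: v1x; rewrite -e leNgt v10.
have [||c /andP[c0 cx] v1c] := @ivt R v1 0 x 0 x0.
- by move=> z _; exact: cv1.
- by left; rewrite ltW.
have top z : 0 <= z -> v1 z = 0 -> v z ^+ 4 = m.
  move=> z0 e; have := ray_energy z0; rewrite e expr0n /= => /esym/eqP.
  rewrite mulf_eq0 sqrf_eq0 gt_eqF ?(prvp P) //= subr_eq0 => /eqP ->//.
have cp : 0 < c.
  by rewrite lt_neqAle c0 andbT; apply/eqP => e; have h := v1c; rewrite -e in h; move: v10; rewrite h ltxx.
have v0c : v 0 < v c.
  rewrite ltNge; apply/negP; rewrite le_eqVlt => /orP[/eqP e|lt].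
    have := ray_energy (lexx 0); rewrite -e (top c c0 v1c) subrr mulr0 => /eqP.
    by rewrite sqrf_eq0 lt_eqF.
  have := pow4_lt (prvp P c0) lt; rewrite (top c c0 v1c) ltNge v4_le //.
have [||||y /andP[y0 yc] vy] := @lower_left R (fun z => v (- z)) (fun z => - v1 (- z)) (- c) 0.
- by rewrite oppr_lt0.
- by move=> z _; exact: dv_neg (prv P _).
- apply: ctN; apply: (@continuous_comp _ _ _ (fun z : R => - z) v1).
    exact: (ctN (dv_cont (dv_id 0))).
  exact: cv1.
- by rewrite oppr0 oppr_gt0.
rewrite oppr0 in vy.
have yc' : 0 <= - y <= c by apply/andP; split; lra.
have [] := interior_min (fun z _ => prv P z) yc' vy (lt_trans vy v0c).
move=> z [/andP[z0 zc] v1z vz].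
have := pow4_lt (prvp P (ltW z0)) (le_lt_trans vz (lt_trans vy v0c)).
by rewrite (top z (ltW z0) v1z) (top c c0 v1c) ltxx.
Qed.

(** ** The circle *)

Let p := u pi.
Let q := u1 pi.
Let r := m * p - 3 * p ^+ 5.

Lemma p_gt0 : 0 < p. Proof. exact: (prup P pi_circle). Qed.
Lemma v0E : v 0 = p. Proof. by rewrite /p (prver P).2. Qed.
Lemma unpi : u (- pi) = p. Proof. by rewrite /p (prver P).1. Qed.
Lemma u2pi : u2 pi = r. Proof. exact: (pruE P pi_circle). Qed.

Lemma circle_energy x : - pi <= x <= pi ->
  u1 x ^+ 2 - m * u x ^+ 2 + u x ^+ 6 = q ^+ 2 - m * p ^+ 2 + p ^+ 6.
Proof.
move=> hx; pose I y := u1 y ^+ 2 - m * u y ^+ 2 + u y ^+ 6.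
apply: (@dv0_cst _ I (- pi) pi) => //; last exact: pi_circle.
move=> y hy; apply: dv_eq (dvD (dvB (dvX 2 (pru1 P y))
    (dvM (dv_cst m y) (dvX 2 (pru P y)))) (dvX 6 (pru P y))) _.
by rewrite (pruE P hy) /=; ring.
Qed.

(** Equal slopes at both ends of the loop would make v start at its maximum and
    force u to dip below it, where the first integral forbids a turning point. *)
Lemma u1npi : u1 (- pi) = - q.
Proof.
have := circle_energy npi_circle; rewrite unpi => e.
have : (u1 (- pi) - q) * (u1 (- pi) + q) = 0.
  by rewrite -subr_sqr; apply/eqP; rewrite subr_eq0; apply/eqP; lra.
move/eqP; rewrite mulf_eq0 => /orP[|/eqP h]; last by lra.
rewrite subr_eq0 => /eqP e1; exfalso.
have p4 : p ^+ 4 = m.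
  have := ray_energy (lexx 0); rewrite v0E -(prkir P) e1 subrr expr0n /= => /esym/eqP.
  rewrite mulf_eq0 sqrf_eq0 gt_eqF ?p_gt0 //= subr_eq0 => /eqP ->//.
have [y hy uy] : exists2 y, - pi < y < pi & u y < p.
  have [q0|q0|q0] := ltgtP q 0.
  - have [||||y /andP[y1 y2] uy] := @lower_left R (fun z => u (- z)) (fun z => - u1 (- z)) (- pi) pi.
    + exact: pi2.
    + by move=> z _; exact: dv_neg (pru P _).
    + apply: ctN; apply: (@continuous_comp _ _ _ (fun z : R => - z) u1).
        exact: (ctN (dv_cont (dv_id _))).
      exact: cu1.
    + by rewrite e1 oppr_gt0.
    exists (- y); first by apply/andP; split; lra.
    by rewrite unpi in uy.
  - have [|y hy uy] := lower_left pi2 (fun z _ => pru P z) _ q0; first exact: cu1.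
    by exists y.
  - have [||y hy uy] := lower_left2 pi2 (fun z _ => pru P z) (fun z _ => pru1 P z) _ q0.
    + exact: (pru2 P).
    + have -> : u2 pi = - 2 * m * p by rewrite u2pi /r -p4; ring.
      by rewrite -mulrA mulNr oppr_lt0 !mulr_gt0 ?p_gt0.
    by exists y.
have hy' : - pi <= y <= pi by case/andP: hy => ? ?; apply/andP; split; lra.
have uy' : u y < u (- pi) by rewrite unpi.
have [] := interior_min (fun z _ => pru P z) hy' uy' uy.
move=> c [/andP[c1 c2] u1c uc].
have hc : - pi <= c <= pi by apply/andP; split; lra.
have uc0 := prup P hc.
have := circle_energy hc; rewrite u1c.
have lt4 : u c ^+ 4 < m by rewrite -p4; apply: pow4_lt => //; exact: le_lt_trans uc uy.
have : u c ^+ 2 * (m - u c ^+ 4) > 0 by rewrite mulr_gt0 ?exprn_gt0 // subr_gt0.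
have -> : p ^+ 6 = m * p ^+ 2 by rewrite -p4; ring.
have := sqr_ge0 q; nra.
Qed.

Lemma v10E : v1 0 = 2 * q.
Proof. by rewrite -(prkir P) u1npi /q; ring. Qed.

Lemma q_ray : 4 * q ^+ 2 = p ^+ 2 * (m - p ^+ 4).
Proof. by have := ray_energy (lexx 0); rewrite v10E v0E => <-; ring. Qed.

Lemma circle_energy' x : - pi <= x <= pi ->
  u1 x ^+ 2 = u x ^+ 2 * (m - u x ^+ 4) - 3 * q ^+ 2.
Proof. by move=> /circle_energy; have := q_ray; lra. Qed.

(** For q = 0 the solution on the ray starts at its maximum, m^(1/4), and u has to dip below
    this value on the circle, where it cannot turn around. *)
Lemma q_neq0 : q != 0.
Proof.
apply/eqP => q0; have := u1npi; rewrite q0 oppr0 => n0.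
have p4 : p ^+ 4 = m.
  have := q_ray; rewrite q0 expr0n /= mulr0 => /esym/eqP.
  by rewrite mulf_eq0 sqrf_eq0 gt_eqF ?p_gt0 //= subr_eq0 => /eqP.
have [||y hy uy] := lower_left2 pi2 (fun z _ => pru P z) (fun z _ => pru1 P z) _ q0.
- exact: (pru2 P).
- have -> : u2 pi = - 2 * m * p by rewrite u2pi /r -p4; ring.
  by rewrite -mulrA mulNr oppr_lt0 !mulr_gt0 ?p_gt0.
have hy' : - pi <= y <= pi by case/andP: hy => ? ?; apply/andP; split; lra.
have uy' : u y < u (- pi) by rewrite unpi.
have [] := interior_min (fun z _ => pru P z) hy' uy' uy.
move=> c [/andP[c1 c2] u1c uc].
have hc : - pi <= c <= pi by apply/andP; split; lra.
have uc0 := prup P hc.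
have := circle_energy' hc; rewrite u1c q0.
have lt4 : u c ^+ 4 < m by rewrite -p4; apply: pow4_lt => //; exact: le_lt_trans uc uy.
have : u c ^+ 2 * (m - u c ^+ 4) > 0 by rewrite mulr_gt0 ?exprn_gt0 // subr_gt0.
by rewrite !expr0n /=; lra.
Qed.

Lemma opp_circle x : - pi <= x <= pi -> - pi <= - x <= pi.
Proof. by move=> /andP[? ?]; apply/andP; split; lra. Qed.

(** The difference of u(x) and u(-x) solves a linear equation, with zero data at pi. *)
Lemma u_even x : - pi <= x <= pi -> u (- x) = u x /\ u1 (- x) = - u1 x.
Proof.
move=> hx; pose w y := u y - u (- y); pose w1 y := u1 y + u1 (- y).
pose k y := m - 3 * (u y ^+ 4 + u y ^+ 3 * u (- y) + u y ^+ 2 * u (- y) ^+ 2 +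
   u y * u (- y) ^+ 3 + u (- y) ^+ 4).
have ck : continuous k.
  move=> y; have a := pru P y; have b := dv_neg (pru P (- y)).
  exact: (dv_cont (dvB (dv_cst m y) (dvM (dv_cst 3 y) (dvD (dvD (dvD (dvD (dvX 4 a)
    (dvM (dvX 3 a) b)) (dvM (dvX 2 a) (dvX 2 b))) (dvM a (dvX 3 b))) (dvX 4 b))))).
have [C C0 hC] := cc_bounded (ltW pi2) (continuous_subspaceT ck).
have [||||h1 h2] := @lin_ode_uniq R w w1 k C (- pi) pi pi C0 _ _ hC pi_circle _ _ x hx.
- move=> y hy; apply: dv_eq (dvB (pru P y) (dv_neg (pru P (- y)))) _.
  by rewrite opprK.
- move=> y hy; apply: dv_eq (dvD (pru1 P y) (dv_neg (pru1 P (- y)))) _.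
  by rewrite (pruE P hy) (pruE P (opp_circle hy)) /k /w; ring.
- by rewrite /w unpi subrr.
- by rewrite /w1 u1npi subrr.
by move: h1 h2; rewrite /w /w1 => h1 h2; split; lra.
Qed.

Lemma u1_0 : u1 0 = 0.
Proof.
have h0 : - pi <= (0 : R) <= pi by rewrite oppr_le0 pi_ge0.
by have [_] := u_even h0; rewrite oppr0; lra.
Qed.

End profile.

(** ** Consequences of minimality *)

Section minimal_profile.
Context {R : realType}.
Implicit Types (a b c x y d t : R).

Lemma energy_pw (w dw : edge -> R -> R) :
  pw (- pi) (BRight pi) (w Circle) (dw Circle) -> pw 0 +oo%O (w Ray) (dw Ray) ->
  w Circle pi = w Circle (- pi) -> w Circle pi = w Ray 0 -> energy w dw.
Proof.
move=> [c1 c2 c3 c4] [r1 r2 r3 r4] e1 e2; split => //.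
- by case; [exact: c1|exact: r1].
- by case; [exact: c2|exact: r2].
- by case; [exact: c3|exact: r3].
case; apply: rweak_ibp => d.
  by rewrite domE => /andP[d1 d2]; apply: c4; rewrite ?bnd_simp.
by rewrite domE => d1; apply: r4.
Qed.

Lemma pw_zero : pw 0 +oo%O (fun=> 0 : R) (fun=> 0 : R).
Proof.
have m0 : measurable (`[0, +oo[ : set R) by exact: measurable_itv.
have l0 : L2 `[0, +oo[ (fun=> 0 : R).
  split; first exact: measurable_cst.
  by apply: (hasint0 m0 _).1 => x _; rewrite expr0n.
apply: (@pw_ray R 0 (fun=> 0) (fun=> 0) (fun=> 0) (fun=> 0)) => //.
  by move=> x; exact: cst_continuous.
by split=> //; exists 0 => x _; rewrite normr0.
Qed.

Lemma pw_cat_cc a c b (f g : R -> R) : a <= c -> c <= b ->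
  pw a (BRight c) f g -> pw c (BRight b) f g -> pw a (BRight b) f g.
Proof.
by move=> ac cb; apply: pw_cat => //; exact: interval_closed.
Qed.

Lemma pw_cat_cy a c (f g : R -> R) : a <= c ->
  pw a (BRight c) f g -> pw c +oo%O f g -> pw a +oo%O f g.
Proof. by move=> ac; apply: pw_cat => //; exact: interval_closed. Qed.

Context (m : R) (u u1 u2 v v1 v2 : R -> R) (P : profile m u u1 u2 v v1 v2).

Definition phi e := match e with Circle => u | Ray => v end.
Definition dphi e := match e with Circle => u1 | Ray => v1 end.

(** What minimality gives: the second variation is nonnegative on the tangent space of
    the constraint. *)
Definition stable := forall (w dw : edge -> R -> R) z, energy w dw ->
  ht (fun e x => phi e x ^+ 5 * w e x) 0 ->
  ht (fun e x => dw e x ^+ 2 + (m - 15 * phi e x ^+ 4) * w e x ^+ 2) z -> 0 <= z.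

Lemma v_BL2 : BL2 `[0, +oo[ v.
Proof.
split; first exact: (prvL P).
have [|M M0 hM] := vanish_bounded (v_vanish P); first by move=> x _; exact: (cv P).
by exists M => x; rewrite /= in_itv /= andbT; exact: hM.
Qed.

Lemma v1_BL2 : BL2 `[0, +oo[ v1.
Proof.
split; first exact: (prv1L P).
have [|M M0 hM] := vanish_bounded (v1_vanish P); first by move=> x _; exact: (cv1 P).
by exists M => x; rewrite /= in_itv /= andbT; exact: hM.
Qed.

Lemma phi_energy : energy phi dphi.
Proof.
apply: energy_pw => /=; rewrite ?(prver P).1 //.
- by apply: (pw_C1 (F := u) (F1 := u1)) => //; [exact: ltW pi2|exact: (pru P)|exact: (cu1 P)].
- by apply: (pw_ray (F := v) (F1 := v1)) => //; [exact: (prv P)|exact: (cv1 P)|exact: v_BL2|exact: (prv1L P)].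
- by rewrite -(prver P).1 (prver P).2.
Qed.

(** Shorthand for the second derivatives; differentiating them linearizes the equation. *)
Let U2 x := m * u x - 3 * u x ^+ 5.
Let V2 x := m * v x - 3 * v x ^+ 5.

Lemma dvU2 x : dv U2 x ((m - 15 * u x ^+ 4) * u1 x).
Proof.
apply: dv_eq (dvB (dvM (dv_cst m x) (pru P x)) (dvM (dv_cst 3 x) (dvX 5 (pru P x)))) _.
by rewrite /=; ring.
Qed.

Lemma dvV2 x : dv V2 x ((m - 15 * v x ^+ 4) * v1 x).
Proof.
apply: dv_eq (dvB (dvM (dv_cst m x) (prv P x)) (dvM (dv_cst 3 x) (dvX 5 (prv P x)))) _.
by rewrite /=; ring.
Qed.

Lemma dvu1 x : - pi <= x <= pi -> dv u1 x (U2 x).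
Proof. by move=> hx; rewrite /U2 -(pruE P hx); exact: (pru1 P). Qed.

Lemma dvv1 x : 0 <= x -> dv v1 x (V2 x).
Proof. by move=> hx; rewrite /V2 -(prvE P hx); exact: (prv1 P). Qed.

Lemma pot_cont (f : R -> R) : continuous f -> continuous (fun x => m - 15 * f x ^+ 4).
Proof. by move=> cf x; exact: (ctB (ctC m x) (ctM (ctC 15 x) (ctX (cf x)))). Qed.

Lemma pot_bounded : exists2 C : R, 0 <= C &
  forall x, - pi <= x <= pi -> `|m - 15 * u x ^+ 4| <= C.
Proof.
exact: (cc_bounded (ltW pi2) (continuous_subspaceT (pot_cont (cu P)))).
Qed.

Lemma u1_nontriv x : - pi <= x <= pi -> u1 x = 0 -> U2 x != 0.
Proof.
move=> hx e; apply/eqP => e2; have [C C0 hC] := pot_bounded.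
have [] := lin_ode_uniq C0 (fun y hy => dvu1 hy) (fun y _ => dvU2 y) hC hx e e2 (x := pi).
  exact: pi_circle.
by move=> h _; have := q_neq0 P; rewrite h eqxx.
Qed.

Context (SV : stable).

Lemma ht_ray0 (k : edge -> R -> R) z : hasint `[- pi, pi] (k Circle) z ->
  (forall x, 0 <= x -> k Ray x = 0) -> ht k z.
Proof.
move=> h k0; exists z, 0; split=> //; last by rewrite addr0.
apply: hasint0; first exact: measurable_dom.
by move=> x /=; rewrite in_itv /= andbT; exact: k0.
Qed.

(** A critical point x1 of u inside the loop makes u', cut off to [-x1, x1], an odd
    direction of vanishing second variation with corners; rounding the corners with the
    odd function sin gives a negative direction. *)
Lemma no_critical x1 : 0 < x1 < pi -> u1 x1 != 0.
Proof.
move=> /andP[x10 x1p]; apply/eqP => e1.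
have hx1 : - pi <= x1 <= pi by apply/andP; split; lra.
have [ue un] := u_even P hx1; rewrite e1 oppr0 in un.
have cuu : continuous u := cu P.
have cuu1 : continuous u1 := cu1 P.
have cuu2 : continuous u2 := pru2 P.
have cpu := pot_cont cuu : continuous (fun x => m - 15 * u x ^+ 4).
pose inn x := (- x1 <= x <= x1).
have cs : continuous (@sin R) by exact: continuous_sin.
have cc : continuous (@cos R) by exact: continuous_cos.
pose CC x := cos x ^+ 2 + (m - 15 * u x ^+ 4) * sin x ^+ 2.
have cCC : continuous CC.
  by move=> x; exact: (ctD (ctX (cc x)) (ctM (cpu x) (ctX (cs x)))).
have [HC _ dHC] := primitive cCC.
pose SS x := u x ^+ 5 * sin x.
have cSS : continuous SS by move=> x; exact: (ctM (ctX (cuu x)) (cs x)).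
have [HS _ dHS] := primitive cSS.
have HSe : HS pi - HS (- pi) = 0.
  pose D x := HS x - HS (- x).
  have dD x : 0 <= x <= pi -> dv D x 0.
    move=> /andP[a1 a2]; apply: dv_eq (dvB (dHS x) (dv_neg (dHS (- x)))) _.
    have hx : - pi <= x <= pi by apply/andP; split; lra.
    by rewrite /SS (u_even P hx).1 sinN; ring.
  have := dv0_cst dD (x := pi) (y := 0); rewrite lexx pi_ge0 lexx => /(_ isT isT).
  by rewrite /D oppr0 subrr.
pose K := U2 x1 * sin x1.
have K0 : K != 0.
  by rewrite mulf_neq0 ?(u1_nontriv hx1) // gt_eqF // sin_gt0_pi // x10.
have U2e : U2 (- x1) = U2 x1 by rewrite /U2 ue.
have key t : 0 <= t ^+ 2 * (HC pi - HC (- pi)) + 4 * t * K.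
  pose w e x := match e with
    Circle => (if inn x then u1 x else 0) + t * sin x | Ray => 0 : R end.
  pose dw e x := match e with
    Circle => (if inn x then u2 x else 0) + t * cos x | Ray => 0 : R end.
  have dts x : dv (fun x => t * sin x) x (t * cos x).
    by apply: dv_eq (dvM (dv_cst t x) (is_derive_sin x)) _; rewrite mulr0 addr0.
  have cts : continuous (fun x => t * cos x).
    by move=> x; exact: (ctM (ctC t x) (cc x)).
  have o1 x : x < - x1 -> inn x = false by move=> ?; apply/negbTE; rewrite negb_and -!ltNge; apply/orP; left.
  have o2 x : x1 < x -> inn x = false by move=> ?; apply/negbTE; rewrite negb_and -!ltNge; apply/orP; right.
  have w1 x : x <= - x1 -> w Circle x = t * sin x.
    rewrite le_eqVlt => /orP[/eqP->|/o1 /= ->]; last by rewrite add0r.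
    by rewrite /= /inn lexx un; case: ifP => _; rewrite add0r.
  have w3 x : x1 <= x -> w Circle x = t * sin x.
    rewrite le_eqVlt => /orP[/eqP<-|/o2 /= ->]; last by rewrite add0r.
    by rewrite /= /inn lexx e1; case: ifP => _; rewrite add0r.
  have w2 x : - x1 <= x <= x1 -> w Circle x = u1 x + t * sin x.
    by move=> h; rewrite /= /inn h.
  have d1 x : x < - x1 -> dw Circle x = t * cos x by move=> /o1 /= ->; rewrite add0r.
  have d3 x : x1 < x -> dw Circle x = t * cos x by move=> /o2 /= ->; rewrite add0r.
  have d2 x : - x1 < x < x1 -> dw Circle x = u2 x + t * cos x.
    by move=> /andP[/ltW a1 /ltW a2]; rewrite /= /inn a1 a2.
  have n1 : - pi <= - x1 by lra.
  have n2 : - x1 <= x1 by lra.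
  have n3 : x1 <= pi by lra.
  have ew : energy w dw.
    apply: energy_pw; last first.
    - by rewrite w3 // sinpi mulr0.
    - by rewrite w3 // w1 // sinN sinpi oppr0.
    - exact: pw_zero.
    apply: (@pw_cat_cc _ (- x1)) => //; first by lra.
      apply: (pw_C1 (F := fun x => t * sin x) (F1 := fun x => t * cos x)) => //.
        by move=> x /andP[_]; exact: w1.
      by move=> x /andP[_]; exact: d1.
    apply: (@pw_cat_cc _ x1) => //.
      apply: (pw_C1 (F := fun x => u1 x + t * sin x) (F1 := fun x => u2 x + t * cos x)) => //.
        by move=> x; exact: dvD (pru1 P x) (dts x).
      by move=> x; exact: (ctD (cuu2 x) (cts x)).
    apply: (pw_C1 (F := fun x => t * sin x) (F1 := fun x => t * cos x)) => //.
      by move=> x /andP[+ _]; exact: w3.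
    by move=> x /andP[+ _]; exact: d3.
  apply: (SV ew).
    apply: ht_ray0 => /=; last by move=> x _; rewrite mulr0.
    pose H x := t * HS x.
    have dH x : dv H x (t * SS x).
      by apply: dv_eq (dvM (dv_cst t x) (dHS x)) _; rewrite mulr0 addr0.
    have ctS : continuous (fun x => t * SS x) by move=> x; exact: (ctM (ctC t x) (cSS x)).
    have h1 : hasint `[- pi, - x1] (fun x => u x ^+ 5 * w Circle x) (H (- x1) - H (- pi)).
      apply: (@hasint_ftc _ (fun x => t * SS x)) => //; first by move=> x _; exact: ctS.
      by move=> x /andP[_ /ltW h]; rewrite w1 // /SS; ring.
    have h3 : hasint `[x1, pi] (fun x => u x ^+ 5 * w Circle x) (H pi - H x1).
      apply: (@hasint_ftc _ (fun x => t * SS x)) => //; first by move=> x _; exact: ctS.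
      by move=> x /andP[/ltW h _]; rewrite w3 // /SS; ring.
    have h2 : hasint `[- x1, x1] (fun x => u x ^+ 5 * w Circle x)
        ((u x1 ^+ 6 / 6 + H x1) - (u (- x1) ^+ 6 / 6 + H (- x1))).
      apply: (@hasint_ftc _ (fun x => u x ^+ 5 * u1 x + t * SS x) _
        (fun x => u x ^+ 6 / 6 + H x)) => //.
      - move=> x _; apply: dv_eq (dvD (dvM (dvX 6 (pru P x)) (dv_cst 6^-1 x)) (dH x)) _.
        by rewrite /=; field.
      - by move=> x _; exact: (ctD (ctM (ctX (cuu x)) (cuu1 x)) (ctS x)).
      by move=> x /andP[/ltW a1 /ltW a2]; rewrite w2 ?a1 // /SS; ring.
    have h12 := hasint_cat_cc (_ : - pi <= - x1 <= x1) h1 h2.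
    have h := hasint_cat_cc (_ : - pi <= x1 <= pi) (h12 _) h3.
    apply: hasint_eqv (h _ _) _; rewrite ?n1 ?n2 ?n3 ?andbT //; try by lra.
    by rewrite ue /H; have := HSe; nra.
  apply: ht_ray0 => /=; last by move=> x _; rewrite expr0n /= mulr0 addr0.
  pose k x := dw Circle x ^+ 2 + (m - 15 * u x ^+ 4) * w Circle x ^+ 2.
  pose H x := t ^+ 2 * HC x.
  have dH x : dv H x (t ^+ 2 * CC x).
    by apply: dv_eq (dvM (dv_cst (t ^+ 2) x) (dHC x)) _; rewrite mulr0 addr0.
  have ctC' : continuous (fun x => t ^+ 2 * CC x).
    by move=> x; exact: (ctM (ctC (t ^+ 2) x) (cCC x)).
  have h1 : hasint `[- pi, - x1] k (H (- x1) - H (- pi)).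
    apply: (@hasint_ftc _ (fun x => t ^+ 2 * CC x)) => //; first by move=> x _; exact: ctC'.
    by move=> x /andP[_ h]; rewrite /k w1 ?ltW // d1 // /CC; ring.
  have h3 : hasint `[x1, pi] k (H pi - H x1).
    apply: (@hasint_ftc _ (fun x => t ^+ 2 * CC x)) => //; first by move=> x _; exact: ctC'.
    by move=> x /andP[h _]; rewrite /k w3 ?ltW // d3 // /CC; ring.
  have h2 : hasint `[- x1, x1] k
      ((u1 x1 * U2 x1 + 2 * t * (U2 x1 * sin x1) + H x1) -
       (u1 (- x1) * U2 (- x1) + 2 * t * (U2 (- x1) * sin (- x1)) + H (- x1))).
    apply: (@hasint_ftc _ (fun x => (U2 x ^+ 2 + (m - 15 * u x ^+ 4) * u1 x ^+ 2) +
      2 * t * ((m - 15 * u x ^+ 4) * u1 x * sin x + U2 x * cos x) + t ^+ 2 * CC x) _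
      (fun x => u1 x * U2 x + 2 * t * (U2 x * sin x) + H x)) => //.
    - move=> x /andP[a1 a2]; have hx : - pi <= x <= pi by apply/andP; split; lra.
      apply: dv_eq (dvD (dvD (dvM (dvu1 hx) (dvU2 x))
        (dvM (dv_cst (2 * t) x) (dvM (dvU2 x) (is_derive_sin x)))) (dH x)) _.
      by rewrite /=; ring.
    - move=> x _; have c1 := dv_cont (dvU2 x); have c2 := cpu x.
      exact: (ctD (ctD (ctD (ctX c1) (ctM c2 (ctX (cuu1 x))))
        (ctM (ctC (2 * t) x) (ctD (ctM (ctM c2 (cuu1 x)) (cs x)) (ctM c1 (cc x))))) (ctC' x)).
    move=> x /andP[a1 a2]; have hx : - pi <= x <= pi by apply/andP; split; lra.
    rewrite /k w2 ?ltW // d2 ?a1 // (pruE P hx) -/(U2 x) /CC; ring.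
  have h12 := hasint_cat_cc (_ : - pi <= - x1 <= x1) h1 h2.
  have h := hasint_cat_cc (_ : - pi <= x1 <= pi) (h12 _) h3.
  apply: hasint_eqv (h _ _) _; rewrite ?n1 ?n2 ?n3 ?andbT //; try by lra.
  by rewrite e1 un U2e sinN /K /H; ring.
set A := HC pi - HC (- pi) in key.
(* Near t = 0 the linear term 4 t K dominates, so a small t of sign opposite to K will do. *)
have := key (- K / (`|A| + 1)); set B := `|A| + 1.
have B0 : 0 < B by rewrite ltr_wpDl.
have AB : A < B by rewrite /B; have := ler_norm A; lra.
have K2 : 0 < K ^+ 2 by rewrite lt_neqAle sqr_ge0 andbT eq_sym sqrf_eq0.
have -> : (- K / B) ^+ 2 * A + 4 * (- K / B) * K = K ^+ 2 * (A / B - 4) / B by field; rewrite gt_eqF.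
rewrite leNgt => /negP; apply; rewrite pmulr_llt0 ?invr_gt0 // pmulr_rlt0 //.
by rewrite subr_lt0 ltr_pdivrMr //; lra.
Qed.

End minimal_profile.

(** ** Monotonicity *)

Section decreasing_profile.
Context {R : realType}.
Implicit Types (a b c x y d t : R).
Local Notation mu := (@lebesgue_measure R).
Context (m : R) (u u1 u2 v v1 v2 : R -> R) (P : profile m u u1 u2 v v1 v2).
Context (SV : stable m u v).

Let U2 x := m * u x - 3 * u x ^+ 5.
Let V2 x := m * v x - 3 * v x ^+ 5.
Let p := u pi.
Let q := u1 pi.
Let r := m * p - 3 * p ^+ 5.

Lemma V2_cvg : v1 x * V2 x @[x --> +oo] --> (0 : R).
Proof.
have c1 := vanish_cvg (v_vanish P); have c2 := vanish_cvg (v1_vanish P).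
have e (f : R -> R) n : f y @[y --> +oo] --> (0 : R) -> f y ^+ n @[y --> +oo] --> (0 ^+ n : R).
  by move=> h; exact: (cvg_comp _ _ h (@exprn_continuous _ n 0)).
have h : v1 x * V2 x @[x --> +oo] --> (0 * (m * 0 - 3 * 0 ^+ 5) : R).
  apply: cvgM => //; apply: cvgB; apply: cvgM; try exact: cvg_cst; first exact: c1.
  exact: e.
by rewrite mul0r in h.
Qed.

(** Cutting v' at a zero x0 gives a direction of vanishing second variation beyond x0,
    which makes any competitor on the rest of the graph orthogonal to phi^5: so the
    second variation is not negative on the part of the graph before x0. *)
Lemma cut_competitor x0 (alpha : R) (w dw : R -> R) z : 0 < x0 -> v1 x0 = 0 ->
  pw (- pi) (BRight pi) w dw -> w pi = w (- pi) -> w pi = alpha * v1 0 ->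
  hasint `[- pi, pi] (fun x => dw x ^+ 2 + (m - 15 * u x ^+ 4) * w x ^+ 2) z ->
  0 <= z - alpha ^+ 2 * (v1 0 * V2 0).
Proof.
move=> x00 e0 pww w1 w2 hz.
have cuu : continuous u := cu P.
have cvv : continuous v := cv P.
have cvv1 : continuous v1 := cv1 P.
have cvv2 : continuous v2 := prv2 P.
have cpv := pot_cont cvv (m := m) : continuous (fun x => m - 15 * v x ^+ 4).
have mC : measurable (`[- pi, pi] : set R) by exact: measurable_itv.
have [c5 h5] : exists c5, hasint `[- pi, pi] (fun x => u x ^+ 5 * w x) c5.
  exists (\int[mu]_(x in `[- pi, pi]) (u x ^+ 5 * w x)); split=> //.
  case: pww => _ [lw _] _ _; apply: L2_mul => //.
  by apply: L2_cc => x _; exact: (ctX (cuu x)).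
have vx0 := prvp P (ltW x00).
(* This amplitude on the far part of the ray makes the competitor orthogonal to phi^5. *)
pose beta := (c5 + alpha * ((v x0 ^+ 6 - v 0 ^+ 6) / 6)) / (v x0 ^+ 6 / 6).
pose W e x := match e with Circle => w x | Ray => if x <= x0 then alpha * v1 x else beta * v1 x end.
pose dW e x := match e with Circle => dw x | Ray => if x < x0 then alpha * v2 x else beta * v2 x end.
have le00 : 0 <= x0 := ltW x00.
have Wl x : x <= x0 -> W Ray x = alpha * v1 x by move=> /= ->.
have Wr x : x0 <= x -> W Ray x = beta * v1 x.
  by rewrite le_eqVlt => /orP[/eqP<-|/lt_geF /= ->//]; rewrite /= lexx e0 !mulr0.
have dWl x : x < x0 -> dW Ray x = alpha * v2 x by move=> /= ->.
have dWr x : x0 <= x -> dW Ray x = beta * v2 x by move=> /le_gtF /= ->.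
have dva (k : R) x : dv (fun x => k * v1 x) x (k * v2 x).
  by apply: dv_eq (dvM (dv_cst k x) (prv1 P x)) _; rewrite mulr0 addr0.
have cva (k : R) : continuous (fun x => k * v2 x).
  by move=> x; exact: (ctM (ctC k x) (cvv2 x)).
have m0 : measurable (`[0, +oo[ : set R) by exact: measurable_itv.
have mx : measurable (`[x0, +oo[ : set R) by exact: measurable_itv.
have sub : (`[x0, +oo[%classic : set R) `<=` `[0, +oo[%classic.
  by move=> x /=; rewrite !in_itv /= !andbT; exact: le_trans.
have bx : BL2 `[x0, +oo[ v1.
  have [l [M hM]] := v1_BL2 P; split; first exact: (L2S mx m0 sub).
  by exists M => x /sub; exact: hM.
have lx2 : L2 `[x0, +oo[ v2 by exact: (L2S mx m0 sub (v2_L2 P)).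
have eW : energy W dW.
  apply: energy_pw => //=; last by rewrite le00.
  apply: (@pw_cat_cy _ 0 x0) => //.
    apply: (pw_C1 (F := fun x => alpha * v1 x) (F1 := fun x => alpha * v2 x)) => //.
      by move=> x /andP[_]; exact: Wl.
    by move=> x /andP[_]; exact: dWl.
  apply: (pw_ray (F := fun x => beta * v1 x) (F1 := fun x => beta * v2 x)) => //.
  - by move=> x /ltW; exact: dWr.
  - exact: BL2Z.
  - exact: L2Z.
have tail5 : hasint `[x0, +oo[ (fun x => v x ^+ 5 * v1 x) (0 - v x0 ^+ 6 / 6).
  apply: (@hasint_ray R _ (fun x => v x ^+ 6 / 6)).
  - apply: L2_mul => //; last by case: bx.
    have bv : BL2 `[x0, +oo[ v.
      have [l [M hM]] := v_BL2 P; split; first exact: (L2S mx m0 sub).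
      by exists M => x /sub; exact: hM.
    by case: (BL2_exp 4 mx bv).
  - move=> b xb; apply: (@hasint_ftc _ (fun x => v x ^+ 5 * v1 x) _ (fun x => v x ^+ 6 / 6)) => //.
      move=> x _; apply: dv_eq (dvM (dvX 6 (prv P x)) (dv_cst 6^-1 x)) _.
      by rewrite /=; field.
    by move=> x _; exact: (ctM (ctX (cvv x)) (cvv1 x)).
  - have c1 := vanish_cvg (v_vanish P).
    have h : v x ^+ 6 / 6 @[x --> +oo] --> (0 ^+ 6 / 6 : R).
      apply: cvgM; last exact: cvg_cst.
      exact: (cvg_comp _ _ c1 (@exprn_continuous _ 6 0)).
    by rewrite expr0n /= mul0r in h.
have head5 : hasint `[0, x0] (fun x => v x ^+ 5 * v1 x) (v x0 ^+ 6 / 6 - v 0 ^+ 6 / 6).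
  apply: (@hasint_ftc _ (fun x => v x ^+ 5 * v1 x) _ (fun x => v x ^+ 6 / 6)) => //.
    move=> x _; apply: dv_eq (dvM (dvX 6 (prv P x)) (dv_cst 6^-1 x)) _.
    by rewrite /=; field.
  by move=> x _; exact: (ctM (ctX (cvv x)) (cvv1 x)).
have dVV x : 0 <= x -> dv (fun x => v1 x * V2 x) x (v2 x ^+ 2 + (m - 15 * v x ^+ 4) * v1 x ^+ 2).
  move=> hx; apply: dv_eq (dvM (prv1 P x) (dvV2 P x)) _.
  by rewrite -(prvE P hx); ring.
have cVV : continuous (fun x => v2 x ^+ 2 + (m - 15 * v x ^+ 4) * v1 x ^+ 2).
  by move=> x; exact: (ctD (ctX (cvv2 x)) (ctM (cpv x) (ctX (cvv1 x)))).
have tailQ : hasint `[x0, +oo[ (fun x => v2 x ^+ 2 + (m - 15 * v x ^+ 4) * v1 x ^+ 2) (0 - v1 x0 * V2 x0).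
  apply: (@hasint_ray R _ (fun x => v1 x * V2 x)).
  - apply: integD => //; first by case: lx2.
    have [lv [M hM]] := v_BL2 P.
    have l1 : L2 `[x0, +oo[ (fun x => (m - 15 * v x ^+ 4) * v1 x).
      apply: (@L2_bounded_mul _ _ _ _ (`|m| + 15 * M ^+ 4)) => //; last by case: bx.
        apply: measurable_funB => //; apply: measurable_funM => //; apply: measurable_funX.
        by apply: measurable_funS (lv.1) => //.
      move=> x /sub hx; apply: le_trans (ler_normB _ _) _; rewrite lerD2l normrM normrX.
      rewrite (ger0_norm (_ : 0 <= 15)) // ler_wpM2l // lerXn2r ?nnegrE ?hM //.
      exact: le_trans (normr_ge0 _) (hM _ hx).
    apply: integ_ext (L2_mul mx l1 (bx.1)) => // x _; ring.
  - move=> b xb; apply: (@hasint_ftc _ (fun x => v2 x ^+ 2 + (m - 15 * v x ^+ 4) * v1 x ^+ 2) _ (fun x => v1 x * V2 x)) => //.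
      by move=> x /andP[hx _]; apply: dVV; exact: le_trans hx.
    by move=> x _; exact: cVV.
  - exact: V2_cvg.
have v6 : v x0 ^+ 6 != 0 by rewrite gt_eqF // exprn_gt0.
have mh : measurable (`[0, x0] : set R) by exact: measurable_itv.
have b5 : hasint `[0, +oo[ (fun x => v x ^+ 5 * W Ray x)
    (alpha * (v x0 ^+ 6 / 6 - v 0 ^+ 6 / 6) + beta * (0 - v x0 ^+ 6 / 6)).
  apply: (hasint_cat_cy le00).
    apply: hasint_ext (hasintZ alpha mh head5) => // x hx.
    have /andP[_ h] : 0 <= x <= x0 by move: hx; rewrite /= in_itv.
    by rewrite (Wl _ h); ring.
  apply: hasint_ext (hasintZ beta mx tail5) => // x hx.
  have h : x0 <= x by move: hx; rewrite /= in_itv /= andbT.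
  by rewrite (Wr _ h); ring.
have bQ : hasint `[0, +oo[ (fun x => dW Ray x ^+ 2 + (m - 15 * v x ^+ 4) * W Ray x ^+ 2)
    (alpha ^+ 2 * (v1 x0 * V2 x0) - alpha ^+ 2 * (v1 0 * V2 0) + beta ^+ 2 * (0 - v1 x0 * V2 x0)).
  apply: (hasint_cat_cy le00).
    apply: (@hasint_ftc _ (fun x => alpha ^+ 2 * (v2 x ^+ 2 + (m - 15 * v x ^+ 4) * v1 x ^+ 2)) _
      (fun x => alpha ^+ 2 * (v1 x * V2 x))) => //.
    - move=> x /andP[hx _]; apply: dv_eq (dvM (dv_cst (alpha ^+ 2) x) (dVV x hx)) _.
      by rewrite mulr0 addr0.
    - by move=> x _; exact: (ctM (ctC (alpha ^+ 2) x) (cVV x)).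
    by move=> x /andP[_ h]; rewrite dWl // Wl ?ltW //; ring.
  apply: hasint_ext (hasintZ (beta ^+ 2) mx tailQ) => // x hx.
  have h : x0 <= x by move: hx; rewrite /= in_itv /= andbT.
  by rewrite (dWr _ h) (Wr _ h); ring.
apply: (SV eW).
  exists c5, (alpha * (v x0 ^+ 6 / 6 - v 0 ^+ 6 / 6) + beta * (0 - v x0 ^+ 6 / 6)); split=> //.
  rewrite /beta sub0r mulrN divfK; first by ring.
  by rewrite mulf_neq0.
exists z, (alpha ^+ 2 * (v1 x0 * V2 x0) - alpha ^+ 2 * (v1 0 * V2 0) + beta ^+ 2 * (0 - v1 x0 * V2 x0)).
by split=> //; rewrite e0; ring.
Qed.

(** If v' > 0 at the vertex, v has a maximum at some x0. According to the sign of
    r = phi'' at the vertex, a competitor made of |u'| and v' / 2, respectively of u and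
    a multiple of v', lowers the energy. *)
Lemma v10_le0 : v1 0 <= 0.
Proof.
rewrite leNgt; apply/negP => v10.
have cuu : continuous u := cu P.
have cuu1 : continuous u1 := cu1 P.
have cuu2 : continuous u2 := pru2 P.
have cpu := pot_cont cuu (m := m) : continuous (fun x => m - 15 * u x ^+ 4).
have qE : v1 0 = 2 * q := v10E P.
have q0 : 0 < q by lra.
have p0 : 0 < p := p_gt0 P.
have [x0 x00 e0] : exists2 x0, 0 < x0 & v1 x0 = 0.
  have [y y0 vy] : exists2 y, 0 <= y & v1 y <= 0.
    apply: contrapT => nx.
    have pos y : 0 <= y -> 0 < v1 y.
      by move=> y0; rewrite ltNge; apply/negP => h; apply: nx; exists y.
    have v0 := prvp P (lexx 0).
    have [X X0 hX] := v_vanish P v0.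
    have := hX X (lexx X); rewrite ltNge => /negP; apply.
    apply: le_trans (ler_norm _).
    by apply: (dv_ge0_le X0 (fun z _ => prv P z)) => z /andP[/ltW z0 _]; exact: ltW (pos z z0).
  have [||c /andP[c0 _] e] := @ivt R v1 0 y 0 y0.
  - by move=> z _; exact: (cv1 P).
  - by right; rewrite vy ltW.
  exists c => //; rewrite lt_neqAle c0 andbT; apply/eqP => ec.
  by move: v10; rewrite [in v1 0]ec e ltxx.
have hpi : - pi <= (0 : R) <= pi by rewrite oppr_le0 pi_ge0.
have [npi0 pi0] : - pi <= (0 : R) /\ (0 : R) <= pi by rewrite oppr_le0 pi_ge0.
have V20 : V2 0 = r by rewrite /V2 (v0E P).
have u10 := u1_0 P.
have u1n := u1npi P.
have U2n : U2 (- pi) = r by rewrite /U2 (unpi P).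
have [r0|r0] := ltP r 0.
  pose w x := if x <= 0 then - u1 x else u1 x.
  pose dw x := if x <= 0 then - u2 x else u2 x.
  have wl x : x <= 0 -> w x = - u1 x by rewrite /w => ->.
  have wr x : 0 <= x -> w x = u1 x.
    rewrite le_eqVlt => /orP[/eqP<-|/lt_geF h]; last by rewrite /w h.
    by rewrite /w lexx u10 oppr0.
  have dwl x : x < 0 -> dw x = - u2 x by rewrite /dw => /ltW ->.
  have dwr x : 0 < x -> dw x = u2 x by rewrite /dw => /lt_geF ->.
  have cnu2 : continuous (fun x => - u2 x) by move=> x; exact: (ctN (cuu2 x)).
  have pww : pw (- pi) (BRight pi) w dw.
    apply: (@pw_cat_cc _ _ 0) => //.
      apply: (pw_C1 (F := fun x => - u1 x) (F1 := fun x => - u2 x)) => //.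
      - by move=> x; exact: dvN (pru1 P x).
      - by move=> x /andP[_]; exact: wl.
      - by move=> x /andP[_]; exact: dwl.
    apply: (pw_C1 (F := u1) (F1 := u2)) => //.
    - exact: (pru1 P).
    - by move=> x /andP[+ _]; exact: wr.
    - by move=> x /andP[+ _]; exact: dwr.
  pose h x := u2 x ^+ 2 + (m - 15 * u x ^+ 4) * u1 x ^+ 2.
  have ch : continuous h.
    by move=> x; exact: (ctD (ctX (cuu2 x)) (ctM (cpu x) (ctX (cuu1 x)))).
  have dH x : - pi <= x <= pi -> dv (fun x => u1 x * U2 x) x (h x).
    move=> hx; apply: dv_eq (dvM (pru1 P x) (dvU2 P x)) _.
    by rewrite /h (pruE P hx); ring.
  have i1 : hasint `[- pi, 0] (fun x => dw x ^+ 2 + (m - 15 * u x ^+ 4) * w x ^+ 2)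
      (u1 0 * U2 0 - u1 (- pi) * U2 (- pi)).
    apply: (@hasint_ftc _ h _ (fun x => u1 x * U2 x)) => //.
    - by move=> x /andP[a1 a2]; apply: dH; apply/andP; split=> //; exact: le_trans pi0.
    - by move=> x _; exact: ch.
    by move=> x /andP[_ hx]; rewrite wl ?ltW // dwl // !sqrrN.
  have i2 : hasint `[0, pi] (fun x => dw x ^+ 2 + (m - 15 * u x ^+ 4) * w x ^+ 2)
      (u1 pi * U2 pi - u1 0 * U2 0).
    apply: (@hasint_ftc _ h _ (fun x => u1 x * U2 x)) => //.
    - by move=> x /andP[a1 a2]; apply: dH; apply/andP; split=> //; exact: le_trans a1.
    - by move=> x _; exact: ch.
    by move=> x /andP[hx _]; rewrite wr ?ltW // dwr.
  have := @cut_competitor x0 (2^-1) w dw _ x00 e0 pww _ _ (hasint_cat_cc hpi i1 i2).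
  have -> : w pi = q by rewrite wr.
  have -> : w (- pi) = q by rewrite wl // u1n opprK.
  rewrite qE => /(_ erefl); rewrite mulKf // => /(_ erefl).
  rewrite V20 u1n U2n -/q -/(U2 pi) -/r.
  have -> : U2 pi = r by [].
  have qr0 : q * r < 0 by rewrite pmulr_rlt0.
  rewrite u10; lra.
(* For r >= 0 the function u is convex on the loop, so u' <= q. Hence 7 q times the integral
   of u^6 over [0, pi] is at least p^7 - a^7, where a = u(0), and the energies at 0 and pi give
   4 a^2 <= 3 p^2. *)
have pos x : 0 < x <= pi -> 0 < u1 x.
  move=> /andP[x1 x2]; rewrite ltNge; apply/negP => u1x.
  have [||c /andP[c1 c2] e] := @ivt R u1 x pi 0 x2.
  - by move=> z _; exact: cuu1.
  - by left; rewrite u1x ltW.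
  have cp : c < pi.
    rewrite lt_neqAle c2 andbT; apply/eqP => ec; move: q0; rewrite /q -ec e ltxx //.
  have hc : 0 < c < pi by rewrite cp (lt_le_trans x1).
  by have := no_critical P SV hc; rewrite e eqxx.
have ulep x : 0 <= x <= pi -> u x <= p.
  move=> /andP[x1 x2]; apply: (dv_ge0_le x2 (fun z _ => pru P z)) => z /andP[z1 /ltW z2].
  by apply: ltW; apply: pos; rewrite z2 (le_lt_trans x1).
have m3 : 3 * p ^+ 4 <= m.
  have : 0 <= p * (m - 3 * p ^+ 4) by have := r0; rewrite /r; congr (_ <= _); ring.
  by rewrite pmulr_rge0 // subr_ge0.
have u1q x : 0 <= x <= pi -> u1 x <= q.
  move=> /andP[x1 x2]; apply: (dv_ge0_le x2 (fun z _ => pru1 P z)) => z /andP[z1 /ltW z2].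
  have z0 : 0 <= z by lra.
  have hz : - pi <= z <= pi by rewrite z2 (le_trans npi0).
  have uz := prup P hz; have uzp : u z <= p by apply: ulep; rewrite z0.
  rewrite (pruE P hz) (_ : _ - _ = u z * (m - 3 * u z ^+ 4)); last by ring.
  apply: mulr_ge0; first exact: ltW.
  rewrite subr_ge0; apply: le_trans m3.
  by rewrite ler_wpM2l // lerXn2r ?nnegrE // ltW.
pose a := u 0.
have a0 : 0 < a := prup P hpi.
have cu6 : continuous (fun x => u x ^+ 6) by move=> x; exact: (ctX (cuu x)).
have [K6 _ dK6] := primitive cu6.
have pww : pw (- pi) (BRight pi) u u1.
  by apply: (pw_C1 (F := u) (F1 := u1)) => //; [exact: ltW pi2|exact: (pru P)].
have iQ : hasint `[- pi, pi] (fun x => u1 x ^+ 2 + (m - 15 * u x ^+ 4) * u x ^+ 2)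
   ((u pi * u1 pi - 12 * K6 pi) - (u (- pi) * u1 (- pi) - 12 * K6 (- pi))).
  apply: (@hasint_ftc _ (fun x => u1 x ^+ 2 + (m - 15 * u x ^+ 4) * u x ^+ 2) _
    (fun x => u x * u1 x - 12 * K6 x)) => //; first exact: ltW pi2.
  - move=> x hx; apply: dv_eq (dvB (dvM (pru P x) (pru1 P x)) (dvM (dv_cst 12 x) (dK6 x))) _.
    by rewrite (pruE P hx); ring.
  - by move=> x _; exact: (ctD (ctX (cuu1 x)) (ctM (cpu x) (ctX (cuu x)))).
have K1 : p ^+ 7 - a ^+ 7 <= 7 * q * (K6 pi - K6 0).
  have d7 x : dv (fun x => 7 * q * K6 x - u x ^+ 7) x (7 * q * u x ^+ 6 - 7 * u x ^+ 6 * u1 x).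
    by apply: dv_eq (dvB (dvM (dv_cst (7 * q) x) (dK6 x)) (dvX 7 (pru P x))) _; rewrite /=; ring.
  have : 7 * q * K6 0 - u 0 ^+ 7 <= 7 * q * K6 pi - u pi ^+ 7.
    apply: (dv_ge0_le pi0 (fun z _ => d7 z)) => z /andP[/ltW z1 /ltW z2].
    rewrite (_ : _ - _ = 7 * u z ^+ 6 * (q - u1 z)); last by ring.
    rewrite mulr_ge0 ?subr_ge0 ?u1q ?z1 // mulr_ge0 // exprn_ge0 // ltW // (prup P) //.
    by rewrite z2 (le_trans npi0).
  by rewrite -/p -/a; lra.
have K2 : p ^+ 7 - a ^+ 7 <= 7 * q * (K6 0 - K6 (- pi)).
  have d7 x : dv (fun x => 7 * q * K6 x + u x ^+ 7) x (7 * q * u x ^+ 6 + 7 * u x ^+ 6 * u1 x).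
    by apply: dv_eq (dvD (dvM (dv_cst (7 * q) x) (dK6 x)) (dvX 7 (pru P x))) _; rewrite /=; ring.
  have : 7 * q * K6 (- pi) + u (- pi) ^+ 7 <= 7 * q * K6 0 + u 0 ^+ 7.
    apply: (dv_ge0_le npi0 (fun z _ => d7 z)) => z /andP[/ltW z1 /ltW z2].
    have hz : - pi <= z <= pi by rewrite z1 (le_trans z2).
    rewrite (_ : _ + _ = 7 * u z ^+ 6 * (q - - u1 z)); last by ring.
    rewrite -(u_even P hz).2 mulr_ge0 //; last first.
      by rewrite subr_ge0 u1q // oppr_ge0 z2 lerNl z1.
    by rewrite mulr_ge0 // exprn_ge0 // ltW // (prup P).
  by rewrite (unpi P) -/p -/a; lra.
have qr := q_ray P; rewrite -/p -/q in qr.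
have ea : 0 = a ^+ 2 * (m - a ^+ 4) - 3 * q ^+ 2.
  by have := circle_energy' P hpi; rewrite u10 expr0n.
have ap : a <= p by apply: ulep; rewrite lexx pi_ge0.
have a4 : a ^+ 4 <= p ^+ 4 by rewrite lerXn2r // nnegrE ltW.
have a2 : 4 * a ^+ 2 <= 3 * p ^+ 2.
  have mp : 0 < m - p ^+ 4 by have := exprn_gt0 4 p0; lra.
  rewrite -(ler_pM2r mp).
  have : a ^+ 2 * (m - p ^+ 4) <= a ^+ 2 * (m - a ^+ 4) by rewrite ler_wpM2l ?sqr_ge0 //; lra.
  lra.
have a7 : 64 * a ^+ 7 <= 27 * p ^+ 7.
  have a6 : (4 * a ^+ 2) ^+ 3 <= (3 * p ^+ 2) ^+ 3.
    by rewrite lerXn2r // nnegrE mulr_ge0 // sqr_ge0.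
  have e1 : (4 * a ^+ 2) ^+ 3 = 64 * a ^+ 6 by ring.
  have e2 : (3 * p ^+ 2) ^+ 3 = 27 * p ^+ 6 by ring.
  rewrite e1 e2 in a6.
  have -> : 64 * a ^+ 7 = (64 * a ^+ 6) * a by ring.
  have -> : 27 * p ^+ 7 = (27 * p ^+ 6) * p by ring.
  by apply: ler_pM => //; rewrite ?mulr_ge0 ?exprn_ge0 ?ltW.
have qn : q != 0 by rewrite gt_eqF.
have := @cut_competitor x0 (p / (2 * q)) u u1 _ x00 e0 pww _ _ iQ.
rewrite (unpi P) -/p qE divfK ?mulf_neq0 ?pnatr_eq0 // => /(_ erefl erefl).
rewrite V20 u1n -/q leNgt => /negP; apply.
rewrite -(pmulr_rlt0 _ (_ : 0 < 7 * q)); last by rewrite mulr_gt0.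
have -> : 7 * q * (p * q - 12 * K6 pi - (p * - q - 12 * K6 (- pi)) - (p / (2 * q)) ^+ 2 * (2 * q * r)) =
  7 * (2 * p * q ^+ 2 - p ^+ 2 * r / 2) - 12 * (7 * q * (K6 pi - K6 0)) - 12 * (7 * q * (K6 0 - K6 (- pi))).
  by field.
have -> : 2 * p * q ^+ 2 - p ^+ 2 * r / 2 = p ^+ 7.
  have -> : 2 * p * q ^+ 2 = p / 2 * (4 * q ^+ 2) by field.
  by rewrite qr /r; field.
by have := exprn_gt0 7 p0; lra.
Qed.

Lemma q_lt0 : q < 0.
Proof.
by have := v10_le0; rewrite (v10E P) -/q; have := q_neq0 P; rewrite neq_lt -/q => /orP[|] ? ?; lra.
Qed.

Lemma v1_lt0 x : 0 <= x -> v1 x < 0.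
Proof.
apply: (ray_monotone P); rewrite (v10E P).
by have := q_lt0; rewrite /q; lra.
Qed.

Lemma u1_lt0 x : 0 < x <= pi -> u1 x < 0.
Proof.
move=> /andP[x1 x2]; rewrite ltNge; apply/negP => u1x.
have [||c /andP[c1 c2] e] := @ivt R u1 x pi 0 x2.
- by move=> z _; exact: (cu1 P).
- by right; rewrite u1x ltW ?q_lt0.
have cp : c < pi.
  by rewrite lt_neqAle c2 andbT; apply/eqP => ec; move: q_lt0; rewrite /q -ec e ltxx.
have hc : 0 < c < pi by rewrite cp (lt_le_trans x1).
by have := no_critical P SV hc; rewrite e eqxx.
Qed.

End decreasing_profile.

(** * The even solution of the linearized equation on the circle *)

Section amplitude_variation.
Context {R : realType}.
Implicit Types (x z : R) (f : R -> R).
Context (b : R) (b0 : 0 < b).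

(** The rational functions of u from which the even solution is built. The square of the
    positive constant solution is b = (m / 3)^(1/2), and N stands for - 2 K (m u - 3 u^5). *)
Definition ampG z := (z ^+ 2 - b) * (z ^+ 2 + 2 * b) / (6 * z * (z ^+ 2 + b)).
Definition ampK z :=
  - (z ^+ 4 + 3 * b * z ^+ 2 + b ^+ 2) / (9 * z ^+ 3 * (z ^+ 2 + b) ^+ 3).
Definition ampK' z :=
  (5 * z ^+ 6 + 20 * b * z ^+ 4 + 12 * b ^+ 2 * z ^+ 2 + 3 * b ^+ 3) /
  (9 * z ^+ 4 * (z ^+ 2 + b) ^+ 4).
Definition ampN z :=
  2 / 3 * ((b - z ^+ 2) * (z ^+ 4 + 3 * b * z ^+ 2 + b ^+ 2)) /
  (z ^+ 2 * (z ^+ 2 + b) ^+ 2).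
Definition ampN' z :=
  2 * ((3 * b ^+ 2 - 15 * z ^+ 4) * (z ^+ 4 + 3 * b * z ^+ 2 + b ^+ 2) / (9 * z ^+ 3 * (z ^+ 2 + b) ^+ 3)
   - (3 * b ^+ 2 * z - 3 * z ^+ 5) * ampK' z).

Lemma amp_neq0 z : 0 < z -> z != 0 /\ z ^+ 2 + b != 0.
Proof.
by move=> z0; rewrite !gt_eqF // ltr_wpDl // ltW // exprn_gt0.
Qed.

Let dvVr f z (d : R) : dv f z d -> f z != 0 ->
  dv (fun y => (f y)^-1) z (- d / f z ^+ 2).
Proof. by move=> df f0; exact: dvV. Qed.

Lemma dvampG z : 0 < z -> dv ampG z ((1 + ampN z) / 2).
Proof.
move=> z0; have [n1 n2] := amp_neq0 z0.
have hz := dv_id z.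
have d0 : 6 * z * (z ^+ 2 + b) != 0 by rewrite !mulf_neq0.
apply: dv_eq (dvM (dvM (dvB (dvX 2 hz) (dv_cst b z)) (dvD (dvX 2 hz) (dv_cst (2 * b) z)))
  (dvVr (dvM (dvM (dv_cst 6 z) hz) (dvD (dvX 2 hz) (dv_cst b z))) d0)) _.
by rewrite /ampN /=; field; rewrite n1 n2.
Qed.

Lemma dvampK z : 0 < z -> dv ampK z (ampK' z).
Proof.
move=> z0; have [n1 n2] := amp_neq0 z0.
have hz := dv_id z.
have d0 : 9 * z ^+ 3 * (z ^+ 2 + b) ^+ 3 != 0 by rewrite !mulf_neq0 ?expf_neq0.
apply: dv_eq (dvM (dvN (dvD (dvD (dvX 4 hz) (dvM (dv_cst (3 * b) z) (dvX 2 hz))) (dv_cst (b ^+ 2) z)))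
  (dvVr (dvM (dvM (dv_cst 9 z) (dvX 3 hz)) (dvX 3 (dvD (dvX 2 hz) (dv_cst b z)))) d0)) _.
by rewrite /ampK' /=; field; rewrite n1 n2.
Qed.

Lemma dvampN z : 0 < z -> dv ampN z (ampN' z).
Proof.
move=> z0; have [n1 n2] := amp_neq0 z0.
have hz := dv_id z.
have d0 : z ^+ 2 * (z ^+ 2 + b) ^+ 2 != 0 by rewrite !mulf_neq0 ?expf_neq0.
apply: dv_eq (dvM (dvM (dv_cst (2 / 3) z) (dvM (dvB (dv_cst b z) (dvX 2 hz))
  (dvD (dvD (dvX 4 hz) (dvM (dv_cst (3 * b) z) (dvX 2 hz))) (dv_cst (b ^+ 2) z))))
  (dvVr (dvM (dvX 2 hz) (dvX 2 (dvD (dvX 2 hz) (dv_cst b z)))) d0)) _.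
by rewrite /ampN' /ampK' /=; field; rewrite n1 n2.
Qed.

Lemma ampK'_gt0 z : 0 < z -> 0 < ampK' z.
Proof.
move=> z0; rewrite /ampK'; apply: divr_gt0.
  by rewrite !addr_gt0 ?mulr_gt0 ?exprn_gt0.
by rewrite !mulr_gt0 ?exprn_gt0 // addr_gt0 ?exprn_gt0.
Qed.

Lemma ampK_N z : 0 < z -> 2 * ampK z * (3 * b ^+ 2 * z - 3 * z ^+ 5) = - ampN z.
Proof.
by move=> /amp_neq0 [n1 n2]; rewrite /ampK /ampN; field; rewrite n1 n2.
Qed.

Lemma ampG_N z : 0 < z ->
  (3 * b ^+ 2 - 15 * z ^+ 4) * ampG z = (3 * b ^+ 2 * z - 3 * z ^+ 5) * ((1 - ampN z) / 2).
Proof.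
by move=> /amp_neq0 [n1 n2]; rewrite /ampG /ampN; field; rewrite n1 n2.
Qed.

Lemma ampN_K z : 0 < z ->
  - ampN' z / 2 - (3 * b ^+ 2 * z - 3 * z ^+ 5) * ampK' z = (3 * b ^+ 2 - 15 * z ^+ 4) * ampK z.
Proof.
by move=> /amp_neq0 [n1 n2]; rewrite /ampN' /ampK; field; rewrite n1 n2.
Qed.

End amplitude_variation.

Section even_solution.
Context {R : realType}.
Implicit Types (a c x y d t : R).
Context (m : R) (u u1 u2 v v1 v2 : R -> R) (P : profile m u u1 u2 v v1 v2).
Context (SV : stable m u v).

Let U2 x := m * u x - 3 * u x ^+ 5.
Let p := u pi.
Let q := u1 pi.
Let r := m * p - 3 * p ^+ 5.

(** Up to a factor, s is the derivative of the even solutions of the nonlinear equation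
    with respect to their amplitude. Reduction of order by u' is singular at 0, where u'
    vanishes; the part G + K u'^2 absorbs the singularity, and P0 is the remaining
    quadrature. The Wronskian is s u'' - s' u' = - h / 2, with h > 0 at pi. The sign of the last
    quantity decides both about the kernel and about a negative eigenvalue. *)
Lemma even_solution : exists s s1 : R -> R,
  [/\ forall x, - pi <= x <= pi -> dv s x (s1 x),
      forall x, - pi <= x <= pi -> dv s1 x ((m - 15 * u x ^+ 4) * s x),
      forall x, - pi <= x <= pi -> s (- x) = s x /\ s1 (- x) = - s1 x,
      s1 0 = 0 /\ 0 < s 0 &
      s pi * r - 4 * s1 pi * q < 0].
Proof.
have m0 : 0 < m := prm P.
pose b := Num.sqrt (m / 3).
have b0 : 0 < b by rewrite sqrtr_gt0 divr_gt0.
have mE : m = 3 * b ^+ 2.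
  by rewrite sqr_sqrtr ?divr_ge0 ?ltW //; field.
have [npi0 pi0] : - pi <= (0 : R) /\ (0 : R) <= pi by rewrite oppr_le0 pi_ge0.
have hpi : - pi <= (0 : R) <= pi by rewrite npi0.
have uclamp x : 0 < u (clamp Circle x).
  by apply: (prup P); have := clamp_dom Circle x; rewrite domE.
have cuu : continuous u := cu P.
have cuu1 : continuous u1 := cu1 P.
have q0 : q < 0 := q_lt0 P SV.
have u10 := u1_0 P.
pose k x := ampK' b (u (clamp Circle x)) * u1 (clamp Circle x) ^+ 2.
have ck : continuous k.
  have cl1 : continuous (fun x => u (clamp Circle x)).
    exact: (clamp_continuous (continuous_subspaceT cuu)).
  have cl2 : continuous (fun x => u1 (clamp Circle x)).
    exact: (clamp_continuous (continuous_subspaceT cuu1)).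
  move=> x; have c1 := cl1 x; have c2 := cl2 x.
  pose f y := ampK' b (u (clamp Circle y)); pose g y := u1 (clamp Circle y).
  suff cf : {for x, continuous f} by exact: (@ctM R f (fun y => g y ^+ 2) x cf (ctX c2)).
  apply: (@continuous_comp _ _ _ (fun x => u (clamp Circle x)) (ampK' b) x c1).
  have [n1 n2] := amp_neq0 b0 (uclamp x).
  set z := u _ in n1 n2 *.
  have iz : {for z, continuous (fun y : R => y)} by exact: (dv_cont (dv_id z)).
  have i2 : {for z, continuous (fun y => y ^+ 2 + b)} by exact: (ctD (ctX iz) (ctC b z)).
  pose e y := 5 * y ^+ 6 + 20 * b * y ^+ 4 + 12 * b ^+ 2 * y ^+ 2 + 3 * b ^+ 3.
  have ce : {for z, continuous e}.
    exact: (ctD (ctD (ctD (ctM (ctC 5 z) (ctX iz)) (ctM (ctC (20 * b) z) (ctX iz)))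
      (ctM (ctC (12 * b ^+ 2) z) (ctX iz))) (ctC (3 * b ^+ 3) z)).
  pose d y := 9 * y ^+ 4 * (y ^+ 2 + b) ^+ 4.
  have cd : {for z, continuous d} by exact: (ctM (ctM (ctC 9 z) (ctX iz)) (ctX i2)).
  have nd : d z != 0 by rewrite !mulf_neq0 ?expf_neq0.
  exact: (@ctM R e (fun y => (d y)^-1) z ce (continuousV nd cd)).
have [P0 P00 dP0] := primitive ck.
have kE x : - pi <= x <= pi -> k x = ampK' b (u x) * u1 x ^+ 2.
  by move=> hx; rewrite /k clamp_id // domE.
pose s x := ampG b (u x) + ampK b (u x) * u1 x ^+ 2 - u1 x * P0 x.
pose s1 x := u1 x * ((1 - ampN b (u x)) / 2) - U2 x * P0 x.
have ds x : - pi <= x <= pi -> dv s x (s1 x).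
  move=> hx; have ux := prup P hx; have KN := ampK_N b0 ux.
  have dG := dv_comp (dvampG b0 ux) (pru P x).
  have dK := dv_comp (dvampK b0 ux) (pru P x).
  apply: dv_eq (dvB (dvD dG (dvM dK (dvX 2 (dvu1 P hx)))) (dvM (dvu1 P hx) (dP0 x))) _.
  rewrite /s1 (kE x hx) /= -/(U2 x).
  have -> : ampN b (u x) = - (2 * ampK b (u x) * U2 x) by rewrite /U2 mE KN opprK.
  by field.
have ds1 x : - pi <= x <= pi -> dv s1 x ((m - 15 * u x ^+ 4) * s x).
  move=> hx; have ux := prup P hx; have GN := ampG_N b0 ux; have NK := ampN_K b0 ux.
  have dN := dv_comp (dvampN b0 ux) (pru P x).
  apply: dv_eq (dvB (dvM (dvu1 P hx) (dvM (dvB (dv_cst 1 x) dN) (dv_cst 2^-1 x)))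
    (dvM (dvU2 P x) (dP0 x))) _.
  rewrite (kE x hx) /s /=.
  have -> : (m - 15 * u x ^+ 4) * (ampG b (u x) + ampK b (u x) * u1 x ^+ 2 - u1 x * P0 x) =
    (3 * b ^+ 2 - 15 * u x ^+ 4) * ampG b (u x) +
    (3 * b ^+ 2 - 15 * u x ^+ 4) * ampK b (u x) * u1 x ^+ 2 -
    (3 * b ^+ 2 - 15 * u x ^+ 4) * u1 x * P0 x by rewrite mE; ring.
  by rewrite GN -NK mE; field.
have sE x : - pi <= x <= pi ->
    s x * U2 x - s1 x * u1 x = - (u1 x ^+ 2 + (u x ^+ 2 - b) ^+ 2 * (u x ^+ 2 + 2 * b)) / 2.
  move=> hx; have ux := prup P hx; have [n1 n2] := amp_neq0 b0 ux.
  rewrite /s /s1 /U2 mE /ampG /ampK /ampN; field; by rewrite n1 n2.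
have P0odd x : - pi <= x <= pi -> P0 (- x) = - P0 x.
  move=> hx; pose D y := P0 y + P0 (- y).
  have dD y : - pi <= y <= pi -> dv D y 0.
    move=> hy; apply: dv_eq (dvD (dP0 y) (dv_neg (dP0 (- y)))) _.
    by rewrite (kE _ hy) (kE _ (opp_circle hy)) (u_even P hy).1 (u_even P hy).2 sqrrN subrr.
  by have := dv0_cst dD hx hpi; rewrite /D oppr0 P00; lra.
have sodd x : - pi <= x <= pi -> s (- x) = s x /\ s1 (- x) = - s1 x.
  move=> hx; rewrite /s /s1 /U2 (u_even P hx).1 (u_even P hx).2 P0odd //.
  by split; ring.
have a0 : 0 < u 0 by exact: (prup P).
have U20 : U2 0 < 0.
  rewrite ltNge; apply/negP => U20.
  have {}U20 : 0 < U2 0 by rewrite lt_neqAle U20 andbT eq_sym (u1_nontriv P).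
  have np : - pi < (0 : R) by rewrite oppr_lt0 pi_gt0.
  have [||y /andP[y1 y2]] := lower_left np (fun z _ => pru1 P z).
  - exact: (pru2 P).
  - by rewrite (pruE P hpi).
  rewrite u10 => uy.
  have hy : 0 < - y <= pi by apply/andP; split; lra.
  have hy' : - pi <= y <= pi by apply/andP; split; lra.
  by have := u1_lt0 P SV hy; rewrite (u_even P hy').2; lra.
have s00 : 0 < s 0.
  rewrite /s u10 expr0n /= mulr0 mul0r subr0 addr0 /ampG.
  have ab : b ^+ 2 < u 0 ^+ 4.
    have : 0 < - U2 0 by rewrite oppr_gt0.
    have -> : - U2 0 = 3 * u 0 * (u 0 ^+ 4 - b ^+ 2) by rewrite /U2 mE; ring.
    by rewrite pmulr_rgt0 ?mulr_gt0 // subr_gt0.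
  have ab' : b < u 0 ^+ 2.
    rewrite -(@ltr_pXn2r R 2%N isT) ?nnegrE ?ltW ?exprn_gt0 //.
    by rewrite -exprM.
  have ? : 0 < u 0 ^+ 2 by rewrite exprn_gt0.
  by apply: divr_gt0; rewrite !mulr_gt0 //; lra.
have s10 : s1 0 = 0 by rewrite /s1 u10 P00 mul0r mulr0 subrr.
exists s, s1; split=> //.
set h := u1 pi ^+ 2 + (u pi ^+ 2 - b) ^+ 2 * (u pi ^+ 2 + 2 * b).
have Wpi : s pi * r - s1 pi * q = - h / 2 by exact: (sE pi pi_circle).
have p0 : 0 < p := p_gt0 P.
have hp : 0 < h.
  have q2 : 0 < q ^+ 2 by rewrite exprn_even_gt0 //= lt_eqF.
  apply: ltr_pwDl q2 _; rewrite mulr_ge0 ?sqr_ge0 //.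
  by rewrite ltW // addr_gt0 ?exprn_gt0 // mulr_gt0.
(* In view of the Wronskian the claim is h / 6 + s'(pi) q > 0. For r >= 0 the quadrature
   contributes with the good sign, and what remains is a polynomial inequality in p^2
   and b, where p^2 <= b. *)
have [r0|r0] := leP 0 r.
  suff : 0 < h / 6 + s1 pi * q by lra.
  have P0pi : 0 <= P0 pi.
    rewrite -P00; apply: (dv_ge0_le pi0 (fun z _ => dP0 z)) => z _.
    by rewrite /k mulr_ge0 ?sqr_ge0 // ltW // ampK'_gt0.
  have -> : s1 pi * q = q ^+ 2 * ((1 - ampN b p) / 2) + r * (- q) * P0 pi.
    rewrite /s1 -/q -/p -/(U2 pi); have -> : U2 pi = r by [].
    by ring.
  have rp : 0 <= r * - q * P0 pi by rewrite !mulr_ge0 // oppr_ge0 ltW.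
  suff : 0 < h / 6 + q ^+ 2 * ((1 - ampN b p) / 2) by lra.
  have q2 : q ^+ 2 = p ^+ 2 * (3 * b ^+ 2 - p ^+ 4) / 4.
    by have := q_ray P; rewrite -/p -/q mE; lra.
  have [n1 n2] := amp_neq0 b0 p0.
  have zb : p ^+ 2 <= b.
    rewrite -(@ler_pXn2r R 2%N isT) ?nnegrE ?sqr_ge0 ?(ltW b0) // -exprM.
    have := r0; have -> : r = 3 * p * (b ^+ 2 - p ^+ 4) by rewrite /r mE; ring.
    by rewrite pmulr_rge0 ?mulr_gt0 // subr_ge0.
  have z0 : 0 < p ^+ 2 by rewrite exprn_gt0.
  rewrite /h -/q -/p.
  have -> : (q ^+ 2 + (p ^+ 2 - b) ^+ 2 * (p ^+ 2 + 2 * b)) / 6 + q ^+ 2 * ((1 - ampN b p) / 2) =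
    (4 * b ^+ 3 * (p ^+ 2 + b) ^+ 2 - (3 * b ^+ 2 - p ^+ 4) * (b - p ^+ 2) * (p ^+ 4 + 3 * b * p ^+ 2 + b ^+ 2)) /
    (12 * (p ^+ 2 + b) ^+ 2).
    by rewrite q2 /ampN; field; rewrite n1 n2.
  apply: divr_gt0; last by rewrite mulr_gt0 // exprn_gt0 // addr_gt0.
  have -> : p ^+ 4 = (p ^+ 2) ^+ 2 by rewrite -exprM.
  move: (p ^+ 2) zb z0 => z zb z0.
  have -> : 4 * b ^+ 3 * (z + b) ^+ 2 - (3 * b ^+ 2 - z ^+ 2) * (b - z) * (z ^+ 2 + 3 * b * z + b ^+ 2) =
    b ^+ 5 + 2 * b ^+ 4 * z + 11 * b ^+ 3 * z ^+ 2 + 2 * b ^+ 2 * z ^+ 3 + 3 * b * z ^+ 3 * (b - z) +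
    b * z ^+ 4 - z ^+ 5 by ring.
  have z5 : z ^+ 5 <= b * z ^+ 4 by rewrite exprS ler_wpM2r // exprn_ge0 // ltW.
  have ? : 0 <= 3 * b * z ^+ 3 * (b - z).
    by rewrite mulr_ge0 ?subr_ge0 // ltW // !mulr_gt0 // exprn_gt0.
  have ? : 0 < b ^+ 5 by rewrite exprn_gt0.
  have ? : 0 < b ^+ 4 * z by rewrite mulr_gt0 ?exprn_gt0.
  have ? : 0 < b ^+ 3 * z ^+ 2 by rewrite mulr_gt0 ?exprn_gt0.
  have ? : 0 < b ^+ 2 * z ^+ 3 by rewrite mulr_gt0 ?exprn_gt0.
  lra.
(* For r < 0, if the claim fails then s(pi) and s'(pi) are positive. As s / u' increases, s is
   positive on (0, pi], where u^4 > m / 3 makes it concave; this contradicts s'(0) = 0. *)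
rewrite ltNge; apply/negP => D0.
have s1q : s1 pi * q < 0 by lra.
have s1p : 0 < s1 pi by rewrite -(nmulr_llt0 _ q0).
have sp : 0 < s pi.
  have : s pi * r < 0 by lra.
  by rewrite nmulr_llt0.
have spos x : 0 < x <= pi -> 0 < s x.
  move=> /andP[x0 xp]; rewrite -(nmulr_llt0 _ (u1_lt0 P SV (_ : 0 < x <= pi))) ?x0 // mulrC.
  pose f y := s y / u1 y.
  have hy y : x <= y <= pi -> - pi <= y <= pi.
    by move=> /andP[y1 y2]; rewrite y2 andbT; lra.
  have un y : x <= y <= pi -> u1 y < 0.
    by move=> /andP[y1 y2]; apply: (u1_lt0 P SV); rewrite y2 (lt_le_trans x0).
  have df y : x <= y <= pi -> dv f y ((u1 y ^+ 2 + (u y ^+ 2 - b) ^+ 2 * (u y ^+ 2 + 2 * b)) / 2 / u1 y ^+ 2).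
    move=> h1; have ny : u1 y != 0 by rewrite lt_eqF ?un.
    apply: dv_eq (dvM (ds y (hy y h1)) (dvV ny (dvu1 P (hy y h1)))) _.
    have -> : u1 y ^+ 2 + (u y ^+ 2 - b) ^+ 2 * (u y ^+ 2 + 2 * b) =
      2 * (s1 y * u1 y - s y * U2 y) by have := sE y (hy y h1); lra.
    by rewrite -/(U2 y); field.
  have fpi : f x <= f pi.
    apply: (dv_ge0_le (f := f) xp df) => y _.
    rewrite mulr_ge0 ?invr_ge0 ?sqr_ge0 // mulr_ge0 ?invr_ge0 //.
    by rewrite addr_ge0 ?sqr_ge0 // mulr_ge0 ?sqr_ge0 // addr_ge0 ?sqr_ge0 // mulr_ge0 // ltW.
  have fp : f pi < 0 by rewrite /f pmulr_rlt0 // invr_lt0.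
  have fx : f x < 0 by exact: le_lt_trans fp.
  have ux : u1 x < 0 by apply: un; rewrite lexx.
  have -> : u1 x * s x = f x * u1 x ^+ 2 by rewrite /f; field; rewrite lt_eqF.
  by rewrite nmulr_rlt0 // exprn_even_gt0 //= lt_eqF.
have : s1 pi < s1 0.
  apply: (dv_lt0_gt (df := fun x => (m - 15 * u x ^+ 4) * s x) (pi_gt0 R)).
    by move=> x /andP[x1 x2]; apply: ds1; rewrite x2 (le_trans npi0).
  move=> x /andP[x0 xp]; rewrite nmulr_rlt0 ?spos ?x0 ?ltW //.
  have up : p < u x.
    apply: (dv_lt0_gt (df := u1) xp (fun z _ => pru P z)) => z /andP[z1 /ltW z2].
    by apply: (u1_lt0 P SV); rewrite z2 (lt_trans x0).
  have := pow4_lt p0 up.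
  have : m - 3 * p ^+ 4 < 0.
    have := r0; have -> : r = p * (m - 3 * p ^+ 4) by rewrite /r; ring.
    by rewrite pmulr_rlt0.
  by have := exprn_gt0 4 p0; lra.
by rewrite s10; lra.
Qed.

End even_solution.

(** * Eigenfunctions as classical solutions *)

Section modes.
Context {R : realType}.
Implicit Types (a b c x y d t l : R) (e : edge) (w dw z dz : edge -> R -> R).
Local Notation mu := (@lebesgue_measure R).
Local Notation dom := (@dom R).
Context (m : R) (u u1 u2 v v1 v2 : R -> R).
Local Notation phi := (phi u v).

(** The potential of L - l. *)
Definition pot l e x := m - l - 15 * phi e x ^+ 4.

(** A real eigenfunction, or 0, at the level [l]. The extension beyond the edges is only
    C^1, as the equation need not hold there. *)
Record mode l w dw : Prop := Mode {
  modeD : forall e x, dv (w e) x (dw e x);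
  modeC : forall e, continuous (dw e);
  modeE : forall e x, dom e x -> dv (dw e) x (pot l e x * w e x);
  modeV : w Circle pi = w Circle (- pi) /\ w Circle pi = w Ray 0;
  modeK : dw Circle pi - dw Circle (- pi) = dw Ray 0;
  modeL : L2 (dom Ray) (w Ray);
  modeL1 : L2 (dom Ray) (dw Ray) }.

Lemma mode_lin l w dw z dz c d : mode l w dw -> mode l z dz ->
  mode l (fun e x => c * w e x + d * z e x) (fun e x => c * dw e x + d * dz e x).
Proof.
move=> [a1 a2 a3 [a4 a5] a6 a7 a8] [b1 b2 b3 [b4 b5] b6 b7 b8].
have mD e := measurable_dom (R := R) e.
split=> [e x|e x|e x ex||||].
- by apply: dv_eq (dvD (dvM (dv_cst c x) (a1 e x)) (dvM (dv_cst d x) (b1 e x))) _; ring.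
- exact: (ctD (ctM (ctC c x) (a2 e x)) (ctM (ctC d x) (b2 e x))).
- apply: dv_eq (dvD (dvM (dv_cst c x) (a3 e x ex)) (dvM (dv_cst d x) (b3 e x ex))) _.
  by ring.
- by rewrite a4 b4 -a5 -b5 a4 b4.
- by rewrite -a6 -b6; ring.
- by apply: L2D => //; exact: L2Z.
- by apply: L2D => //; exact: L2Z.
Qed.

Context (P : profile m u u1 u2 v v1 v2).

Lemma pot_continuous l e : continuous (pot l e).
Proof.
have cuu : continuous u := cu P.
have cvv : continuous v := cv P.
by case: e => x; [exact: (ctB (ctC (m - l) x) (ctM (ctC 15 x) (ctX (cuu x))))|
  exact: (ctB (ctC (m - l) x) (ctM (ctC 15 x) (ctX (cvv x))))].
Qed.

Lemma phi_bounded e : exists2 M : R, 0 <= M & forall x, dom e x -> `|phi e x| <= M.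
Proof.
have [_ b _ _ _] := phi_energy P; have [_ [M hM]] := b e.
exists M => //; exact: le_trans (normr_ge0 _) (hM _ (elo_dom e)).
Qed.

Lemma pot_bound l e : exists2 C : R, 0 <= C & forall x, dom e x -> `|pot l e x| <= C.
Proof.
have [M M0 hM] := phi_bounded e.
exists (`|m - l| + 15 * M ^+ 4) => [|x ex].
  by rewrite addr_ge0 // mulr_ge0 // exprn_ge0.
apply: le_trans (ler_normB _ _) _; rewrite lerD2l normrM normrX.
by rewrite (ger0_norm (_ : 0 <= 15)) // ler_wpM2l // lerXn2r ?nnegrE ?hM.
Qed.

Lemma ht_sqr_ae0 w : ht (fun e x => w e x * w e x) 0 ->
  forall e, {ae mu, forall x, dom e x -> w e x = 0}.
Proof.
move=> [z1 [z2 [h1 h2 e0]]].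
have p1 : 0 <= z1 by apply: hasint_ge0 h1 _ => x _; rewrite -expr2 sqr_ge0.
have p2 : 0 <= z2 by apply: hasint_ge0 h2 _ => x _; rewrite -expr2 sqr_ge0.
have [e1 e2] : z1 = 0 /\ z2 = 0 by split; lra.
rewrite e1 in h1; rewrite e2 in h2.
suff h e : hasint (dom e) (fun x => w e x * w e x) 0 ->
    {ae mu, forall x, dom e x -> w e x = 0} by case; exact: h.
move=> [ih i0]; have mD := measurable_dom (R := R) e.
have mf : measurable_fun (dom e) (EFin \o (fun x => w e x * w e x)).
  by apply/measurable_EFinP; exact: (integ_measurable ih).
have [+ _] := ae_eq_integral_abs (R := R) mu mD mf.
have -> : (\int[mu]_(x in dom e) `|(w e x * w e x)%:E| = 0)%E.
  transitivity (\int[mu]_(x in dom e) (w e x * w e x)%:E)%E.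
    by apply: eq_integral => x _ /=; rewrite ger0_norm // -expr2 sqr_ge0.
  rewrite -[LHS]fineK; last exact: integrable_fin_num.
  by move: i0; rewrite /Rintegral => ->.
move=> /(_ erefl) h; apply: (ae_imp h) => x /= hx ex.
by have /eqP := hx ex; rewrite eqe mulf_eq0 orbb => /eqP.
Qed.

Section one_mode.
Context (l : R) (w dw : edge -> R -> R) (M : mode l w dw).

Lemma mode_cont e : continuous (w e).
Proof. by move=> x; exact: dv_cont (modeD M e x). Qed.

Lemma mode_L2 e : L2 (dom e) (w e).
Proof.
case: e; last exact: (modeL M).
have cw : continuous (w Circle) by exact: mode_cont.
by apply: L2_cc => x _; exact: cw.
Qed.

Lemma mode_dL2 e : L2 (dom e) (dw e).
Proof.
case: e; last exact: (modeL1 M).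
have cw : continuous (dw Circle) by exact: (modeC M).
by apply: L2_cc => x _; exact: cw.
Qed.

Lemma mode_ddL2 e : L2 (dom e) (fun x => pot l e x * w e x).
Proof.
have [C _ hC] := pot_bound l e.
apply: L2_bounded_mul hC _; [exact: measurable_dom| |exact: mode_L2].
by apply: within_measurable; apply: continuous_subspaceT; exact: pot_continuous.
Qed.

Lemma mode_ddcont e : continuous (fun x => pot l e x * w e x).
Proof.
have c1 : continuous (pot l e) by exact: pot_continuous.
have c2 : continuous (w e) by exact: mode_cont.
by move=> x; exact: (ctM (c1 x) (c2 x)).
Qed.

Lemma rayE x : dom Ray x <-> 0 <= x.
Proof. exact: (domE Ray x). Qed.

Lemma mode_vanish : vanish (w Ray).
Proof.
exact: (H1_vanish (fun x _ => modeD M Ray x) (@modeC l w dw M Ray) (@mode_cont Ray) (modeL M) (modeL1 M)).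
Qed.

Lemma mode_dvanish : vanish (dw Ray).
Proof.
apply: (@H1_vanish _ _ (fun x => pot l Ray x * w Ray x)).
- by move=> x x0; apply: (modeE M); apply/rayE.
- exact: mode_ddcont.
- exact: (modeC M).
- exact: (modeL1 M).
- exact: (@mode_ddL2 Ray).
Qed.

Lemma mode_BL2 : BL2 `[0, +oo[ (w Ray).
Proof.
have cw : continuous (w Ray) by exact: mode_cont.
have [|C C0 hC] := vanish_bounded mode_vanish; first by move=> x _; exact: cw.
split; first exact: (modeL M).
by exists C => x /rayE; exact: hC.
Qed.

Lemma mode_energy : energy w dw.
Proof.
have [h1 h2] := modeV M.
apply: energy_pw => //.
  apply: (pw_C1 (F := w Circle) (F1 := dw Circle)) => //; first exact: ltW pi2.
    exact: (modeD M Circle).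
  exact: (modeC M).
apply: (pw_ray (F := w Ray) (F1 := dw Ray)) => //.
- exact: (modeD M Ray).
- exact: (modeC M).
- exact: mode_BL2.
- exact: (modeL1 M).
Qed.

Lemma mode_phi5 : exists c, ht (fun e x => phi e x ^+ 5 * w e x) c.
Proof.
apply: ht_integ => e; have mD := measurable_dom (R := R) e.
have [_ b _ _ _] := phi_energy P; have [l5 _] := BL2_exp 4 mD (b e).
exact: L2_mul l5 (mode_L2 e).
Qed.

End one_mode.

(** Green's formula; the boundary terms cancel by Kirchhoff's condition. *)
Lemma mode_form l l' w dw z dz : mode l w dw -> mode l' z dz -> exists N,
  ht (fun e x => w e x * z e x) N /\
  ht (fun e x => dw e x * dz e x + (m - 15 * phi e x ^+ 4) * (w e x * z e x)) (l * N).
Proof.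
move=> M M'; have mD e := measurable_dom (R := R) e.
have [N hN] : exists N, ht (fun e x => w e x * z e x) N.
  by apply: ht_integ => e; exact: (L2_mul (mD e) (mode_L2 M e) (mode_L2 M' e)).
exists N; split=> //.
pose k e x := dw e x * dz e x + pot l e x * w e x * z e x.
suff h0 : ht k 0.
  rewrite -[l * N]add0r; apply: ht_ext (htD h0 (htZ l hN)) => e x _.
  by rewrite /k /pot; ring.
pose H e x := dw e x * z e x.
have dH e x : dom e x -> dv (H e) x (k e x).
  move=> ex; apply: dv_eq (dvM (modeE M ex) (modeD M' e x)) _.
  by rewrite /k; ring.
have ck e : continuous (k e).
  have c1 : continuous (dw e) by exact: (modeC M).
  have c2 : continuous (dz e) by exact: (modeC M').
  have c3 : continuous (fun x => pot l e x * w e x) by exact: (mode_ddcont M).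
  have c4 : continuous (z e) by exact: (mode_cont M').
  by move=> x; exact: (ctD (ctM (c1 x) (c2 x)) (ctM (c3 x) (c4 x))).
have hc : hasint (dom Circle) (k Circle) (H Circle pi - H Circle (- pi)).
  apply: (@hasint_ftc _ (k Circle)) => //; first exact: ltW pi2.
    by move=> x hx; apply: dH; apply/domE.
  by move=> x _; exact: ck.
have hr : hasint (dom Ray) (k Ray) (0 - H Ray 0).
  apply: (@hasint_ray R _ (H Ray)).
  - apply: integD; first exact: (mD Ray).
      by apply: L2_mul; [exact: (mD Ray)|exact: (modeL1 M)|exact: (modeL1 M')].
    by apply: L2_mul; [exact: (mD Ray)|exact: (mode_ddL2 M Ray)|exact: (modeL M')].
  - move=> b b0; apply: (@hasint_ftc _ (k Ray)) => //.
      by move=> x /andP[x0 _]; apply: dH; apply/rayE.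
    by move=> x _; exact: ck.
  - rewrite -[0 : R](mul0r (0 : R)).
    by apply: cvgM; apply: vanish_cvg; [exact: mode_dvanish M|exact: mode_vanish M'].
exists (H Circle pi - H Circle (- pi)), (0 - H Ray 0); split=> //.
have [e1 e2] := modeV M'; rewrite /H -(modeK M) -e2 -e1; ring.
Qed.

(** ** Negative eigenvalues *)

Context (SV : stable m u v).

(** On a mode the quadratic form is l times the squared norm. *)
Lemma negative_mode l w dw : l < 0 -> mode l w dw ->
  ht (fun e x => phi e x ^+ 5 * w e x) 0 ->
  forall e, {ae mu, forall x, dom e x -> w e x = 0}.
Proof.
move=> l0 M h5; have [N [hN hQ]] := mode_form M M.
have N0 : 0 <= N by apply: ht_ge0 hN _ => e x _; rewrite -expr2 sqr_ge0.
have : 0 <= l * N.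
  by apply: (SV (mode_energy M) h5); apply: ht_ext hQ => e x _; rewrite !expr2.
rewrite nmulr_rge0 // => N0'.
have N00 : N = 0 by lra.
by rewrite N00 in hN; exact: ht_sqr_ae0 hN.
Qed.

(** Modes at different levels are orthogonal, in L^2 and for the quadratic form. So the form
    is negative on the combination of both which is orthogonal to phi^5. *)
Lemma negative_modes l l' w dw w' dw' c c' : l < 0 -> l' < 0 -> l != l' ->
  mode l w dw -> mode l' w' dw' ->
  ht (fun e x => phi e x ^+ 5 * w e x) c ->
  ht (fun e x => phi e x ^+ 5 * w' e x) c' -> c' != 0 ->
  forall e, {ae mu, forall x, dom e x -> w e x = 0}.
Proof.
move=> l0 l0' ll M M' hc hc' c0'.
have [N [hN hQ]] := mode_form M M; have [N' [hN' hQ']] := mode_form M' M'.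
have [K [hK hQK]] := mode_form M M'; have [K' [hK' hQK']] := mode_form M' M.
have KK : K' = K by apply: (ht_uniq hK'); apply: ht_ext hK => e x _; ring.
have QK : l * K = l' * K.
  by rewrite -[in RHS]KK; apply: (ht_uniq hQK); apply: ht_ext hQK' => e x _; ring.
have K0 : K = 0.
  apply/eqP; have : (l - l') * K == 0 by rewrite mulrBl QK subrr.
  by rewrite mulf_eq0 subr_eq0 (negbTE ll).
have N0 : 0 <= N by apply: ht_ge0 hN _ => e x _; rewrite -expr2 sqr_ge0.
have N0' : 0 <= N' by apply: ht_ge0 hN' _ => e x _; rewrite -expr2 sqr_ge0.
have E := energyD (energyZ c' (mode_energy M)) (energyZ (- c) (mode_energy M')).
have : 0 <= c' ^+ 2 * (l * N) + c ^+ 2 * (l' * N') + (- 2 * c * c') * (l * K).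
  apply: (SV E).
    have -> : (0 : R) = c' * c + - c * c' by ring.
    by apply: ht_ext (htD (htZ c' hc) (htZ (- c) hc')) => e x _; ring.
  have := htD (htD (htZ (c' ^+ 2) hQ) (htZ (c ^+ 2) hQ')) (htZ (- 2 * c * c') hQK).
  by apply: ht_ext => e x _; ring.
rewrite K0 !mulr0 addr0 => Q0.
have Q2 : c ^+ 2 * (l' * N') <= 0 by rewrite mulr_ge0_le0 ?sqr_ge0 // mulr_le0_ge0 // ltW.
have Q1 : 0 <= c' ^+ 2 * (l * N) by lra.
have c2 : 0 < c' ^+ 2 by rewrite exprn_even_gt0.
move: Q1; rewrite pmulr_rge0 // nmulr_rge0 // => N1.
have N00 : N = 0 by lra.
by rewrite N00 in hN; exact: ht_sqr_ae0 hN.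
Qed.

(** ** The kernel *)

(** Wronskians with u', the even solution and v' give two linear equations, with
    nonzero determinant, for the values f and f' at the vertex. *)
Lemma kernel_trivial w dw : mode 0 w dw -> forall e x, dom e x -> w e x = 0.
Proof.
move=> M.
have [s [s1 [ds ds1 sev [_ _] D0]]] := even_solution P SV.
have [npi0 pi0] : - pi <= (0 : R) /\ (0 : R) <= pi by rewrite oppr_le0 pi_ge0.
have ew x : - pi <= x <= pi -> dv (dw Circle) x ((m - 15 * u x ^+ 4) * w Circle x).
  move=> hx; have := modeE M ((domE Circle x).2 hx); rewrite /pot subr0.
  exact.
pose U2 x := m * u x - 3 * u x ^+ 5.
pose V2 x := m * v x - 3 * v x ^+ 5.
have [e1 e2] := modeV M; have e3 := modeK M.
have W1 : w Circle pi * U2 pi - dw Circle pi * u1 pi =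
          w Circle (- pi) * U2 (- pi) - dw Circle (- pi) * u1 (- pi).
  apply: (@dv0_cst _ (fun x => w Circle x * U2 x - dw Circle x * u1 x) (- pi) pi).
  - move=> x hx; apply: dv_eq (dvB (dvM (modeD M Circle x) (dvU2 P x)) (dvM (ew x hx) (dvu1 P hx))) _.
    by rewrite /=; ring.
  - exact: pi_circle.
  - exact: npi_circle.
have U2n : U2 (- pi) = U2 pi by rewrite /U2 (unpi P).
rewrite -e1 U2n (u1npi P) in W1.
have q0 := q_lt0 P SV.
have dwn : dw Circle (- pi) = - dw Circle pi.
  have : u1 pi * (dw Circle pi + dw Circle (- pi)) = 0 by lra.
  by move/eqP; rewrite mulf_eq0 lt_eqF //= => /eqP; lra.
have W2 : w Circle pi * s1 pi - dw Circle pi * s pi =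
          w Circle (- pi) * s1 (- pi) - dw Circle (- pi) * s (- pi).
  apply: (@dv0_cst _ (fun x => w Circle x * s1 x - dw Circle x * s x) (- pi) pi).
  - move=> x hx; apply: dv_eq (dvB (dvM (modeD M Circle x) (ds1 x hx)) (dvM (ew x hx) (ds x hx))) _.
    by ring.
  - exact: pi_circle.
  - exact: npi_circle.
have [s2 s3] := sev pi pi_circle.
rewrite -e1 dwn s2 s3 in W2.
pose WR x := w Ray x * V2 x - dw Ray x * v1 x.
have dWR x : 0 <= x -> dv WR x 0.
  move=> hx; have h := modeE M ((rayE x).2 hx); rewrite /pot subr0 in h.
  apply: dv_eq (dvB (dvM (modeD M Ray x) (dvV2 P x)) (dvM h (dvv1 P hx))) _.
  by rewrite /=; ring.
have W3 : WR 0 = 0.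
  have lim : WR x @[x --> +oo] --> (0 * (m * 0 - 3 * 0 ^+ 5) - 0 * 0 : R).
    have c1 := vanish_cvg (v_vanish P); have c2 := vanish_cvg (v1_vanish P).
    have c3 := vanish_cvg (mode_vanish M); have c4 := vanish_cvg (mode_dvanish M).
    apply: cvgB; last exact: cvgM.
    apply: cvgM => //; apply: cvgB; apply: cvgM; try exact: cvg_cst; first exact: c1.
    exact: (cvg_comp _ _ c1 (@exprn_continuous _ 5 0)).
  have lim' : WR x @[x --> +oo] --> WR 0.
    apply: cvg_near_cst; exists 0; split; first exact: num_real.
    move=> y /ltW y0; apply: (@dv0_cst _ WR 0 y); rewrite ?lexx ?y0 //.
    by move=> x /andP[x0 _]; exact: dWR.
  by rewrite (cvg_unique _ lim' lim) //; ring.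
have dw0 : dw Ray 0 = 2 * dw Circle pi by rewrite -e3 dwn; ring.
have V20 : V2 0 = m * u pi - 3 * u pi ^+ 5 by rewrite /V2 (v0E P).
rewrite /WR -e2 dw0 V20 (v10E P) in W3.
set r := m * u pi - 3 * u pi ^+ 5 in D0 W3.
have k1 : w Circle pi * s1 pi = dw Circle pi * s pi by lra.
have k2 : w Circle pi * r = 4 * (dw Circle pi * u1 pi) by lra.
set D := _ - _ in D0.
have f0 : w Circle pi = 0.
  have : w Circle pi * D = 0.
    have -> : w Circle pi * D = s pi * (w Circle pi * r) - 4 * u1 pi * (w Circle pi * s1 pi).
      by rewrite /D; ring.
    by rewrite k1 k2; ring.
  by move/eqP; rewrite mulf_eq0 (lt_eqF D0) orbF => /eqP.
have f1 : dw Circle pi = 0.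
  have : dw Circle pi * D = 0.
    have -> : dw Circle pi * D = r * (dw Circle pi * s pi) - s1 pi * (4 * (dw Circle pi * u1 pi)).
      by rewrite /D; ring.
    by rewrite -k1 -k2; ring.
  by move/eqP; rewrite mulf_eq0 (lt_eqF D0) orbF => /eqP.
have [C C0 hC] := pot_bounded P.
move=> e x; rewrite domE; case: e => [hx|x0].
  exact: (lin_ode_uniq C0 (fun y _ => modeD M Circle y) ew hC pi_circle f0 f1 hx).1.
have [C' C0' hC'] := pot_bound 0 Ray.
have h0x : 0 <= (0 : R) <= x by rewrite lexx.
have hxx : 0 <= x <= x by rewrite x0 lexx.
apply: (@lin_ode_uniq R (w Ray) (dw Ray) (pot 0 Ray) C' 0 x 0 C0' _ _ _ h0x _ _ x hxx).1.
- by move=> y _; exact: (modeD M Ray).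
- by move=> y /andP[y0 _]; apply: (modeE M); apply/rayE.
- by move=> y /andP[y0 _]; apply: hC'; apply/rayE.
- by rewrite -e2.
- by rewrite dw0 f1 mulr0.
Qed.

End modes.

(** ** Eigenfunctions and their real and imaginary parts *)

Section eigen_modes.
Context {R : realType}.
Implicit Types (a b c x y d t l : R) (e : edge) (f g h w dw : edge -> R -> R).
Local Notation mu := (@lebesgue_measure R).
Local Notation dom := (@dom R).
Local Notation eigenspace := Defs.eigenspace.

(** The real or the imaginary part of an element of the operator domain, with its gradient
    and its laplacian. *)
Record H2_real f g h : Prop := H2Real {
  h2c : forall e, {within dom e, continuous (f e)};
  h2c1 : forall e, {within dom e, continuous (g e)};
  h2l : forall e, L2 (dom e) (f e);
  h2l1 : forall e, L2 (dom e) (g e);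
  h2m : forall e, measurable_fun (dom e) (h e);
  h2w : forall e, rweak (dom e) (f e) (g e);
  h2w1 : forall e, rweak (dom e) (g e) (h e);
  h2v : f Circle pi = f Circle (- pi) /\ f Circle pi = f Ray 0;
  h2k : g Circle pi - g Circle (- pi) = g Ray 0 }.

Lemma rweak_aeL e (f f' g : R -> R) : measurable_fun (dom e) f -> measurable_fun (dom e) f' ->
  {ae mu, forall x, dom e x -> f x = f' x} -> rweak (dom e) f g -> rweak (dom e) f' g.
Proof.
move=> mf mf' ff h phi hphi; rewrite -h //; congr fine.
have [_ [mp _]] := test_L2 hphi; have mD := measurable_dom (R := R) e.
apply: ae_eq_integral => //.
- by apply/measurable_EFinP; exact: measurable_funM.
- by apply/measurable_EFinP; exact: measurable_funM.
have fp : {ae mu, forall x, dom e x -> (f x * derive1 phi x)%:E = (f' x * derive1 phi x)%:E}.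
  by apply: (ae_imp ff) => x /= hx /hx ->.
by apply: (ae_imp fp) => x /= hx /hx.
Qed.

Lemma weak_aeL e (f f' g : R -> R[i]) : sqintegrable (dom e) f -> sqintegrable (dom e) f' ->
  {ae mu, forall x, dom e x -> f x = f' x} ->
  weak_derivative (dom e) f g -> weak_derivative (dom e) f' g.
Proof.
move=> [m1 m2 _] [m1' m2' _] ff /weak_rweak[w1 w2]; apply/weak_rweak; split.
  by apply: rweak_aeL w1 => //; apply: (ae_imp ff) => x /= hx ex; rewrite hx.
by apply: rweak_aeL w2 => //; apply: (ae_imp ff) => x /= hx ex; rewrite hx.
Qed.

(** The laplacian is the chosen gradient of the chosen gradient; the inner one may be
    replaced by its continuous representative. *)
Lemma H2NK_real (U : tadfun R) : H2NK U -> exists dU d2U : tadfun R,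
  [/\ H2_real (fun e x => complex.Re (U e x)) (fun e x => complex.Re (dU e x)) (fun e x => complex.Re (d2U e x)),
      H2_real (fun e x => complex.Im (U e x)) (fun e x => complex.Im (dU e x)) (fun e x => complex.Im (d2U e x)) &
      forall e, {ae mu, forall x, dom e x -> laplacian U e x = d2U e x}].
Proof.
move=> [[hU [vU1 vU2]] [dU [wU hdU kU]]].
have mD e := measurable_dom (R := R) e.
have [d2U hd2U] : exists d2U : tadfun R, forall e, sqintegrable (dom e) (d2U e) /\
    weak_derivative (dom e) (dU e) (d2U e).
  have [_ _ _ [kC hC]] := hdU Circle; have [_ _ _ [kR hR]] := hdU Ray.
  by exists (fun e => match e with Circle => kC | Ray => kR end); case.
have sU e : sqintegrable (dom e) (U e) by case: (hU e).
have sdU e : sqintegrable (dom e) (dU e) by case: (hdU e).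
have s2 e : sqintegrable (dom e) (d2U e) by case: (hd2U e).
have w2 e : weak_derivative (dom e) (dU e) (d2U e) by case: (hd2U e).
exists dU, d2U; split.
- split=> [e|e|e|e|e|e|e||].
  + by case: (hU e).
  + by case: (hdU e).
  + by have [] := (sqint_L2 _ (mD e)).1 (sU e).
  + by have [] := (sqint_L2 _ (mD e)).1 (sdU e).
  + by case: (s2 e).
  + by have [] := (weak_rweak _ _ _).1 (wU e).
  + by have [] := (weak_rweak _ _ _).1 (w2 e).
  + by rewrite -vU1 vU2.
  + by rewrite -kU; case: (dU Circle pi) (dU Circle (- pi)) => a b [c d].
- split=> [e|e|e|e|e|e|e||].
  + by case: (hU e).
  + by case: (hdU e).
  + by have [] := (sqint_L2 _ (mD e)).1 (sU e).
  + by have [] := (sqint_L2 _ (mD e)).1 (sdU e).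
  + by case: (s2 e).
  + by have [] := (weak_rweak _ _ _).1 (wU e).
  + by have [] := (weak_rweak _ _ _).1 (w2 e).
  + by rewrite -vU1 vU2.
  + by rewrite -kU; case: (dU Circle pi) (dU Circle (- pi)) => a b [c d].
move=> e; have [sn wn an] := wderivP (sdU e) (wU e).
have wn2 : weak_derivative (dom e) (nabla U e) (d2U e).
  apply: weak_aeL (w2 e) => //; apply: (ae_imp an) => x /= hx ex.
  by rewrite /nabla hx.
by have [] := wderivP (s2 e) wn2.
Qed.

Lemma H2_real_C2 f g h (W : edge -> R -> R) : H2_real f g h ->
  (forall e, {within dom e, continuous (W e)}) ->
  (forall e, {ae mu, forall x, dom e x -> h e x = W e x}) ->
  exists w dw, [/\ forall e x, dv (w e) x (dw e x),
    forall e x, dv (dw e) x (W e (clamp e x)),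
    forall e x, dom e x -> f e x = w e x & forall e x, dom e x -> g e x = dw e x].
Proof.
move=> [k1 k2 k3 k4 k5 k6 k7 _ _] cW hW.
have C2 e := weak_C2 (k1 e) (k2 e) (cW e) (k3 e) (k4 e) (k5 e) (k6 e) (k7 e) (hW e).
have [F [F1 [a1 a2 a3 a4]]] := C2 Circle; have [G [G1 [b1 b2 b3 b4]]] := C2 Ray.
exists (fun e => match e with Circle => F | Ray => G end),
  (fun e => match e with Circle => F1 | Ray => G1 end).
by split; case.
Qed.

Lemma vertex_dom : [/\ dom Circle pi, dom Circle (- pi) & dom Ray 0].
Proof. by split; apply/domE; [exact: pi_circle|exact: npi_circle|]. Qed.

Context (m : R) (u u1 u2 v v1 v2 : R -> R) (P : profile m u u1 u2 v v1 v2).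
Context (Phi : tadfun R) (PhiE : forall e x, dom e x -> Phi e x = (phi u v e x)%:C).

Lemma H2_real_mode l f g h : H2_real f g h ->
  (forall e, {ae mu, forall x, dom e x -> h e x = pot m u v l e x * f e x}) ->
  exists w dw, mode m u v l w dw /\ forall e x, dom e x -> f e x = w e x.
Proof.
move=> H hW.
have cW e : {within dom e, continuous (fun x => pot m u v l e x * f e x)}.
  have cp : continuous (pot m u v l e) by exact: (pot_continuous P).
  have ck : {within dom e, continuous (f e)} by exact: (h2c H).
  move/subspace_continuousP : ck => ck.
  apply/subspace_continuousP => x ex; apply: cvgM; last exact: ck.
  exact: cvg_within_filter (cp x).
have [w [dw [h1 h2 h3 h4]]] := H2_real_C2 H cW hW.
have [p1 p2 p3] := vertex_dom.
have [v1' v2'] := h2v H; have kk := h2k H.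
exists w, dw; split=> //; split=> //.
- by move=> e x; exact: dv_cont (h2 e x).
- by move=> e x ex; have := h2 e x; rewrite clamp_id // h3.
- by rewrite -!h3.
- by rewrite -!h4.
- by apply: L2_ext (h2l H Ray); [exact: measurable_dom|exact: h3].
- by apply: L2_ext (h2l1 H Ray); [exact: measurable_dom|exact: h4].
Qed.

Lemma eigen_mode l (U : tadfun R) : eigenspace (- m) Phi l U -> exists w dw z dz,
  [/\ mode m u v l w dw, mode m u v l z dz &
      forall e x, dom e x -> U e x = (w e x +i* z e x)%C].
Proof.
move=> [hU eqU]; have [dU [d2U [H1 H2 lap]]] := H2NK_real hU.
have E e : {ae mu, forall x, dom e x -> d2U e x = (pot m u v l e x)%:C * U e x}.
  apply: (ae_imp2 (lap e) (eqU e)) => x /= h1 h2 ex.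
  rewrite -h1 //; have := h2 ex; rewrite /Lop PhiE // => {}h2.
  have -> : laplacian U e x = - (l%:C * U e x) - (- m)%:C * U e x - 15 * (phi u v e x)%:C ^+ 4 * U e x.
    by rewrite -h2; ring.
  by rewrite /pot !rmorphB rmorphM rmorphXn /= rmorph_nat rmorphN; ring.
have reE (a : R) (z : R[i]) : complex.Re (a%:C * z) = a * complex.Re z /\
    complex.Im (a%:C * z) = a * complex.Im z.
  by case: z => z1 z2 /=; split; ring.
have [w [dw [Mw hw]]] : exists w dw, mode m u v l w dw /\ forall e x, dom e x -> complex.Re (U e x) = w e x.
  apply: (H2_real_mode H1) => e; apply: (ae_imp (E e)) => x /= hx ex.
  by rewrite hx // (reE _ _).1.
have [z [dz [Mz hz]]] : exists w dw, mode m u v l w dw /\ forall e x, dom e x -> complex.Im (U e x) = w e x.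
  apply: (H2_real_mode H2) => e; apply: (ae_imp (E e)) => x /= hx ex.
  by rewrite hx // (reE _ _).2.
exists w, dw, z, dz; split=> // e x ex.
by rewrite -hw // -hz //; case: (U e x).
Qed.

Lemma sqint_real e (f : R -> R) : L2 (dom e) f -> sqintegrable (dom e) (fun x => (f x)%:C).
Proof.
move=> lf; have mD := measurable_dom (R := R) e.
apply/(sqint_L2 _ mD); split=> //=.
by have := L2Z 0 mD lf; apply: L2_ext => // x _; exact: mul0r.
Qed.

Lemma weak_real e (f g : R -> R) : rweak (dom e) f g ->
  weak_derivative (dom e) (fun x => (f x)%:C) (fun x => (g x)%:C).
Proof.
move=> fg; apply/weak_rweak; split=> //=.
by apply: (@rweak_C1 R e (fun=> 0) (fun=> 0)) => x; exact: cst_continuous.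
Qed.

Lemma mode_eigen l w dw : mode m u v l w dw -> eigenspace (- m) Phi l (cplx w).
Proof.
move=> M.
have [h1 h2 h3] := energy_H1C (mode_energy M).
pose ddw e x := pot m u v l e x * w e x.
have w1 e : rweak (dom e) (w e) (dw e).
  by apply: rweak_C1; [exact: (modeD M e)|exact: (modeC M)].
have w2 e : rweak (dom e) (dw e) (ddw e).
  apply: rweak_ibp => d ed phi dphi cphi.
  have cdd : continuous (ddw e) by exact: (mode_ddcont P M).
  have [H _ dH] := primitive cdd.
  have le := elo_le ed.
  have dD x : elo e <= x <= d -> dv (fun x => dw e x - H x) x 0.
    move=> hx; apply: dv_eq (dvB (modeE M (dom_convex (elo_dom e) ed hx)) (dH x)) _.
    by rewrite subrr.
  have I : ibp (elo e) d (dw e) (ddw e).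
    apply: (ibp_C1 (F := fun x => H x + (dw e (elo e) - H (elo e))) (F1 := ddw e)) => //.
      by move=> x; apply: dv_eq (dvD (dH x) (dv_cst _ x)) _; rewrite addr0.
    move=> x hx; have := dv0_cst dD hx (_ : elo e <= elo e <= d).
    by rewrite lexx le => /(_ isT) <-; ring.
  exact: I.
have s1 e : sqintegrable (dom e) (fun x => (dw e x)%:C) by exact: sqint_real (mode_dL2 M e).
have s2 e : sqintegrable (dom e) (fun x => (ddw e x)%:C) by exact: sqint_real (mode_ddL2 P M e).
split.
  split=> //; exists (cplx dw); split.
  - by move=> e; exact: weak_real.
  - move=> e; split=> //=.
    + by apply: continuous_subspaceT; exact: (modeC M).
    + by apply: continuous_subspaceT => x; exact: cst_continuous.
    + by exists (fun x => (ddw e x)%:C); split=> //; exact: weak_real.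
  - by rewrite /cplx -(modeK M) rmorphB.
move=> e.
have wn : weak_derivative (dom e) (nabla (cplx w) e) (fun x => (ddw e x)%:C).
  apply: weak_aeL (weak_real (w2 e)) => //; apply: (ae_imp (h3 e)) => x /= hx ex.
  by rewrite hx.
have [_ _ lap] := wderivP (s2 e) wn.
apply: (ae_imp lap) => x /= hx ex; rewrite /Lop PhiE // /laplacian /nabla.
rewrite [wderiv _ _ x](hx ex) /ddw /pot /cplx.
by rewrite !(rmorphM, rmorphB, rmorphXn) /= rmorph_nat rmorphN; ring.
Qed.

End eigen_modes.

(** ** Dimension counts *)

Section counting.
Context {R : realType}.
Implicit Types (a b c x y d t l : R) (e : edge) (w dw z dz : edge -> R -> R).
Local Notation mu := (@lebesgue_measure R).
Local Notation dom := (@dom R).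
Local Notation eigenspace := Defs.eigenspace.

Definition null (U : tadfun R) := tad_ae_eq U (fun _ _ => 0).

Lemma null_ext (U V : tadfun R) : (forall e x, dom e x -> U e x = V e x) -> null U -> null V.
Proof. by move=> h n e; apply: (ae_imp (n e)) => x /= hx ex; rewrite -h // hx. Qed.

Lemma free_null n (F : 'I_n -> tadfun R) (i : 'I_n) : tad_free F -> ~ null (F i).
Proof.
move=> fF nF; have h : null (fun e x => \sum_(j < n) (j == i)%:R * F j e x).
  apply: null_ext nF => e x _; rewrite (bigD1 i) //= eqxx mul1r big1 ?addr0 //.
  by move=> j /negbTE ->; rewrite mul0r.
by have /eqP := fF _ h i; rewrite eqxx oner_eq0.
Qed.

Lemma tad_dim_ub (E : set (tadfun R)) (N : nat) :
  (forall n (F : 'I_n -> tadfun R), (forall i, E (F i)) -> tad_free F -> (n <= N)%N) ->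
  (tad_dim E <= (N%:R)%:E)%E.
Proof.
move=> h; apply: ge_ereal_sup => _ [n [F [EF fF]] <-].
by rewrite lee_fin ler_nat; exact: h EF fF.
Qed.

Lemma tad_dim_ge0 (E : set (tadfun R)) : (0 <= tad_dim E)%E.
Proof.
apply: ereal_sup_ubound; exists 0%N => //.
by exists (fun _ _ _ => 0); split; [case|move=> c _; case].
Qed.

Lemma tad_dim0 (E : set (tadfun R)) : (forall U, E U -> null U) -> tad_dim E = 0%E.
Proof.
move=> h; apply/eqP; rewrite eq_le tad_dim_ge0 andbT.
apply: (@tad_dim_ub E 0) => n F EF fF; rewrite leqNgt; apply/negP => n0.
exact: (free_null (i := Ordinal n0) fF) (h _ (EF _)).
Qed.

Lemma tad_dim1 (E : set (tadfun R)) U0 : E U0 -> ~ null U0 ->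
  (forall U V, E U -> E V -> exists c d : R[i], (c != 0) || (d != 0) /\
     null (fun e x => c * U e x + d * V e x)) -> tad_dim E = 1%E.
Proof.
move=> EU nU h; apply/eqP; rewrite eq_le; apply/andP; split.
  apply: (@tad_dim_ub E 1) => n F EF fF; rewrite leqNgt; apply/negP => n1.
  have n0 : (0 < n)%N by exact: ltn_trans n1.
  pose i0 := Ordinal n0; pose i1 := Ordinal n1.
  have [c [d [cd nl]]] := h _ _ (EF i0) (EF i1).
  pose k (i : 'I_n) : R[i] := if i == i0 then c else if i == i1 then d else 0.
  have kk : null (fun e x => \sum_(j < n) k j * F j e x).
    apply: null_ext nl => e x _; rewrite (bigD1 i0) //= (bigD1 i1) //= big1 ?addr0 //.
    by move=> j /andP[/negbTE h0 /negbTE h1]; rewrite /k h0 h1 mul0r.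
  have := fF k kk i0; have := fF k kk i1; rewrite /k eqxx /= => e1 e0.
  by move: cd; rewrite e0 e1 eqxx.
apply: ereal_sup_ubound; exists 1%N => //; exists (fun=> U0); split=> // c hc i.
rewrite ord1; apply/eqP; apply/negPn/negP => c0; apply: nU => e.
apply: (ae_imp (hc e)) => x /= hx ex; have := hx ex; rewrite big_ord1 => /eqP.
by rewrite mulf_eq0 (negbTE c0) => /eqP.
Qed.

Context (m : R) (u u1 u2 v v1 v2 : R -> R) (P : profile m u u1 u2 v v1 v2).
Context (SV : stable m u v).
Context (Phi : tadfun R) (PhiE : forall e x, dom e x -> Phi e x = (phi u v e x)%:C).
Local Notation mode := (mode m u v).

Lemma nullityE : nullity (- m) Phi = 0%E.
Proof.
apply: tad_dim0 => U /(eigen_mode P PhiE) [w [dw [z [dz [M M' hU]]]]] e.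
apply/aeW => x ex.
by rewrite hU // (kernel_trivial P SV M) // (kernel_trivial P SV M').
Qed.

Lemma null_parts (U : tadfun R) w z : (forall e x, dom e x -> U e x = (w e x +i* z e x)%C) ->
  (forall e, {ae mu, forall x, dom e x -> w e x = 0}) ->
  (forall e, {ae mu, forall x, dom e x -> z e x = 0}) -> null U.
Proof.
move=> hU h1 h2 e; apply: (ae_imp2 (h1 e) (h2 e)) => x /= h3 h4 ex.
by rewrite hU // h3 // h4.
Qed.

Lemma negative_comb l w1 dw1 w2 dw2 w3 dw3 w4 dw4 a1 a2 a3 a4 c1 c2 c3 c4 : l < 0 ->
  mode l w1 dw1 -> mode l w2 dw2 -> mode l w3 dw3 -> mode l w4 dw4 ->
  ht (fun e x => phi u v e x ^+ 5 * w1 e x) a1 ->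
  ht (fun e x => phi u v e x ^+ 5 * w2 e x) a2 ->
  ht (fun e x => phi u v e x ^+ 5 * w3 e x) a3 ->
  ht (fun e x => phi u v e x ^+ 5 * w4 e x) a4 ->
  c1 * a1 + c2 * a2 + (c3 * a3 + c4 * a4) = 0 ->
  forall e, {ae mu, forall x, dom e x ->
    c1 * w1 e x + c2 * w2 e x + (c3 * w3 e x + c4 * w4 e x) = 0}.
Proof.
move=> l0 M1 M2 M3 M4 h1 h2 h3 h4 h0.
have M := mode_lin 1 1 (mode_lin c1 c2 M1 M2) (mode_lin c3 c4 M3 M4).
pose k e x := 1 * (c1 * w1 e x + c2 * w2 e x) + 1 * (c3 * w3 e x + c4 * w4 e x).
have H5 : ht (fun e x => phi u v e x ^+ 5 * k e x) 0.
  rewrite -h0; apply: ht_ext (htD (htD (htZ c1 h1) (htZ c2 h2)) (htD (htZ c3 h3) (htZ c4 h4))).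
  by move=> e x _; rewrite /k; ring.
move=> e; apply: (ae_imp (negative_mode P SV l0 M H5 e)) => x /= hx ex.
by have := hx ex; rewrite !mul1r.
Qed.

(** The scalar products with phi^5 of both functions are the coefficients of a combination
    orthogonal to phi^5, unless they vanish. *)
Lemma negative_dependent l (U V : tadfun R) : l < 0 ->
  eigenspace (- m) Phi l U -> eigenspace (- m) Phi l V ->
  exists c d : R[i], (c != 0) || (d != 0) /\ null (fun e x => c * U e x + d * V e x).
Proof.
move=> l0 /(eigen_mode P PhiE) [w [dw [z [dz [Mw Mz hU]]]]].
move=> /(eigen_mode P PhiE) [w' [dw' [z' [dz' [Mw' Mz' hV]]]]].
have [a ha] := mode_phi5 P Mw; have [b hb] := mode_phi5 P Mz.
have [a' ha'] := mode_phi5 P Mw'; have [b' hb'] := mode_phi5 P Mz'.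
have [e0|n0] := eqVneq ((a' +i* b')%C : R[i]) 0; last first.
  exists (a' +i* b')%C, (- (a +i* b)%C); split; first by rewrite n0.
  have k1 := negative_comb (c1 := a') (c2 := - b') (c3 := - a) (c4 := b) l0 Mw Mz Mw' Mz' ha hb ha' hb'.
  have k2 := negative_comb (c1 := b') (c2 := a') (c3 := - b) (c4 := - a) l0 Mw Mz Mw' Mz' ha hb ha' hb'.
  apply: (null_parts _ (k1 _) (k2 _)); [|by ring|by ring].
  move=> e x ex; rewrite hU // hV //; apply: complex_eq => /=; ring.
have [a'0 b'0] : a' = 0 /\ b' = 0 by case: e0.
have [f0|m0] := eqVneq ((a +i* b)%C : R[i]) 0; last first.
  exists 0, 1; split; first by rewrite oner_eq0 orbT.
  have k1 := negative_comb (c1 := 0) (c2 := 0) (c3 := 1) (c4 := 0) l0 Mw Mz Mw' Mz' ha hb ha' hb'.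
  have k2 := negative_comb (c1 := 0) (c2 := 0) (c3 := 0) (c4 := 1) l0 Mw Mz Mw' Mz' ha hb ha' hb'.
  apply: (null_parts _ (k1 _) (k2 _)); [|by rewrite a'0 b'0; ring|by rewrite a'0 b'0; ring].
  move=> e x ex; rewrite hU // hV //; apply: complex_eq => /=; ring.
have [a0 b0] : a = 0 /\ b = 0 by case: f0.
exists 1, 0; split; first by rewrite oner_eq0.
have k1 := negative_comb (c1 := 1) (c2 := 0) (c3 := 0) (c4 := 0) l0 Mw Mz Mw' Mz' ha hb ha' hb'.
have k2 := negative_comb (c1 := 0) (c2 := 1) (c3 := 0) (c4 := 0) l0 Mw Mz Mw' Mz' ha hb ha' hb'.
apply: (null_parts _ (k1 _) (k2 _)); [|by rewrite a0 b0; ring|by rewrite a0 b0; ring].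
move=> e x ex; rewrite hU // hV //; apply: complex_eq => /=; ring.
Qed.

(** The second variation leaves no room for another level, nor for a second dimension. *)
Lemma morse_indexE l0 w0 dw0 : l0 < 0 -> mode l0 w0 dw0 ->
  ~ (forall e, {ae mu, forall x, dom e x -> w0 e x = 0}) ->
  morse_index (- m) Phi = 1%E.
Proof.
move=> l00 M0 n0; rewrite /morse_index.
have mult0 : multiplicity (- m) Phi l0 = 1%E.
  apply: (@tad_dim1 _ (cplx w0)); first exact: (mode_eigen P PhiE M0).
    move=> nl; apply: n0 => e; apply: (ae_imp (nl e)) => x /= hx ex.
    by have /(congr1 (@complex.Re R)) := hx ex.
  by move=> U V; exact: negative_dependent.
have [c hc] := mode_phi5 P M0.
have c0 : c != 0.
  apply/eqP => c0; apply: n0; rewrite c0 in hc; exact: (negative_mode P SV l00 M0 hc).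
have other l : l < 0 -> l != l0 -> multiplicity (- m) Phi l = 0%E.
  move=> ln ll; apply: tad_dim0 => U /(eigen_mode P PhiE) [w [dw [z [dz [M M' hU]]]]].
  have [a ha] := mode_phi5 P M; have [b hb] := mode_phi5 P M'.
  apply: (null_parts hU).
    exact: (negative_modes P SV ln l00 ll M M0 ha hc c0).
  exact: (negative_modes P SV ln l00 ll M' M0 hb hc c0).
pose N := [set l : R | l < 0]; pose mult := multiplicity (- m) Phi.
rewrite -/N -/mult (_ : \esum_(l in N) mult l =
    \esum_(l in N) if l \in [set l0] then mult l else 0)%E.
  rewrite -esum_mkcondr (_ : _ `&` _ = [set l0]).
    by rewrite esum_set1 /mult mult0 // lee01.
  by apply/seteqP; split => [x [_]|x ->].
apply: eq_esum => l ln; case: ifPn => //; rewrite notin_setE /= => ll.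
by apply: other => //; apply/eqP.
Qed.

End counting.

(** * Existence of a negative eigenvalue *)

Section shooting.
Context {R : realType}.
Implicit Types (a b c x y d t l X : R) (e : edge) (w dw z dz : edge -> R -> R).
Local Notation dom := (@dom R).
Context (m : R) (u u1 u2 v v1 v2 : R -> R) (P : profile m u u1 u2 v v1 v2).
Local Notation mode := (mode m u v).
Local Notation pot := (pot m u v).

(** The initial condition makes the solution even on the circle, hence continuous at the
    vertex, and the slope on the ray is the one of Kirchhoff's condition: only
    square integrability is missing for an eigenfunction. *)
Record shot (A l : R) (w dw : edge -> R -> R) : Prop := Shot {
  shD : forall e x, dv (w e) x (dw e x);
  shE : forall e x, dv (dw e) x (pot l e x * w e x);
  sh0 : w Circle 0 = A;
  shd0 : dw Circle 0 = 0;
  shv : w Ray 0 = w Circle pi;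
  shdv : dw Ray 0 = 2 * dw Circle pi }.

Lemma shot_exists A l : exists w dw, shot A l w dw.
Proof.
have c1 : continuous (pot l Circle) by exact: (pot_continuous P).
have c2 : continuous (pot l Ray) by exact: (pot_continuous P).
have [f [f1 [h1 h2 h3 h4]]] := lin_ode_exists A 0 c1.
have [g [g1 [k1 k2 k3 k4]]] := lin_ode_exists (f pi) (2 * f1 pi) c2.
exists (fun e => match e with Circle => f | Ray => g end),
  (fun e => match e with Circle => f1 | Ray => g1 end).
by split=> //; case.
Qed.

Lemma zero_circle : - pi <= (0 : R) <= pi.
Proof. by rewrite oppr_le0 pi_ge0. Qed.

Lemma circle_uniq l (f f1 g g1 : R -> R) :
  (forall x, - pi <= x <= pi -> dv f x (f1 x)) ->
  (forall x, - pi <= x <= pi -> dv f1 x (pot l Circle x * f x)) ->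
  (forall x, - pi <= x <= pi -> dv g x (g1 x)) ->
  (forall x, - pi <= x <= pi -> dv g1 x (pot l Circle x * g x)) ->
  f 0 = g 0 -> f1 0 = g1 0 ->
  forall x, - pi <= x <= pi -> f x = g x /\ f1 x = g1 x.
Proof.
move=> df df1 dg dg1 e0 e1 x hx.
have [C C0 hC] := pot_bound P l Circle.
have [|||||h1 h2] := @lin_ode_uniq R (fun x => f x - g x) (fun x => f1 x - g1 x)
  (pot l Circle) C (- pi) pi 0 C0 _ _ _ zero_circle _ _ x hx.
- by move=> y hy; exact: dvB (df y hy) (dg y hy).
- by move=> y hy; apply: dv_eq (dvB (df1 y hy) (dg1 y hy)) _; rewrite mulrBr.
- by move=> y hy; apply: hC; apply/domE.
- by rewrite e0 subrr.
- by rewrite e1 subrr.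
by split; lra.
Qed.

Section one_shot.
Context (A l : R) (w dw : edge -> R -> R) (S : shot A l w dw).

Lemma shot_even x : - pi <= x <= pi -> w Circle (- x) = w Circle x /\ dw Circle (- x) = - dw Circle x.
Proof.
move=> hx.
have [||||||h1 h2] := @circle_uniq l (fun x => w Circle (- x)) (fun x => - dw Circle (- x))
  (w Circle) (dw Circle) _ _ _ _ _ _ x hx.
- by move=> y _; exact: dv_neg (shD S Circle _).
- move=> y hy; apply: dv_eq (dvN (dv_neg (shE S Circle _))) _.
  by rewrite opprK /pot /= (u_even P hy).1.
- by move=> y _; exact: (shD S).
- by move=> y _; exact: (shE S).
- by rewrite oppr0.
- by rewrite oppr0 (shd0 S) oppr0.
by split=> //; lra.
Qed.

Lemma shot_mode : L2 (dom Ray) (w Ray) -> L2 (dom Ray) (dw Ray) -> mode l w dw.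
Proof.
move=> l1 l2; have [e1 e2] := shot_even pi_circle.
split=> //.
- exact: (shD S).
- by move=> e x; exact: dv_cont (shE S e x).
- by move=> e x _; exact: (shE S).
- by rewrite e1 (shv S).
- by rewrite e2 (shdv S); ring.
Qed.

Definition growth x := w Ray x * dw Ray x.

Lemma dgrowth x : dv growth x (dw Ray x ^+ 2 + pot l Ray x * w Ray x ^+ 2).
Proof. by apply: dv_eq (dvM (shD S Ray x) (shE S Ray x)) _; ring. Qed.

(** Where the potential is nonnegative, w w' is nondecreasing, so that a solution which
    starts to grow keeps its sign forever. *)
Lemma growth_persists X : (forall x, X <= x -> 0 <= pot l Ray x) -> 0 < growth X ->
  forall x, X <= x -> 0 < growth x /\ 0 < w Ray X * w Ray x.
Proof.
move=> hp hX x Xx.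
have gx y : X <= y -> 0 < growth y.
  move=> Xy; apply: lt_le_trans hX _.
  apply: (@dv_ge0_le R growth (fun x => dw Ray x ^+ 2 + pot l Ray x * w Ray x ^+ 2) X y Xy).
    by move=> z _; exact: dgrowth.
  move=> z /andP[/ltW zX _].
  by rewrite addr_ge0 ?sqr_ge0 // mulr_ge0 ?sqr_ge0 // hp.
split; first exact: gx.
have nz y : X <= y -> w Ray y != 0.
  by move=> /gx; rewrite /growth; apply: contraTneq => ->; rewrite mul0r ltxx.
rewrite ltNge; apply/negP => neg.
have [||c /andP[c1 _] wc] := @ivt R (w Ray) X x 0 Xx.
- by move=> z _; exact: dv_cont (shD S Ray z).
- move: neg; have [p|n|e] := ltgtP 0 (w Ray X).
  + by rewrite pmulr_rle0 // => neg; right; rewrite neg ?ltW.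
  + by rewrite nmulr_rle0 // => neg; left; rewrite neg ?ltW.
  + by have := nz X (lexx X); rewrite -e eqxx.
by have := nz c c1; rewrite wc eqxx.
Qed.

(** If the nondecreasing function w w' stays nonpositive it converges, so that its derivative
    w'^2 + pot w^2 is integrable. *)
Lemma decaying_mode X k : 0 <= X -> 0 < k -> (forall x, X <= x -> k <= pot l Ray x) ->
  (forall x, X <= x -> growth x <= 0) -> mode l w dw.
Proof.
move=> X0 k0 hp hg.
have cw : continuous (w Ray) by move=> x; exact: dv_cont (shD S Ray x).
have cdw : continuous (dw Ray) by move=> x; exact: dv_cont (shE S Ray x).
have cp : continuous (pot l Ray) by exact: (pot_continuous P).
pose h x := dw Ray x ^+ 2 + pot l Ray x * w Ray x ^+ 2.
have ch : continuous h.
  by move=> x; exact: (ctD (ctX (cdw x)) (ctM (cp x) (ctX (cw x)))).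
have ih : integ `[X, +oo[ h.
  apply: (@ge0_integ_ray R h growth X 0) => //.
  - by move=> x _; exact: dgrowth.
  - by move=> x _; exact: ch.
  move=> x Xx; rewrite addr_ge0 ?sqr_ge0 // mulr_ge0 ?sqr_ge0 //.
  exact: le_trans (ltW k0) (hp x Xx).
have mX : measurable (`[X, +oo[ : set R) by exact: measurable_itv.
have lift (f : R -> R) : continuous f -> (forall x, X <= x -> f x ^+ 2 <= (1 + k^-1) * h x) ->
    L2 (dom Ray) f.
  move=> cf hf; split.
    by apply: within_measurable; exact: continuous_subspaceT.
  have cf2 : continuous (fun x => f x ^+ 2) by move=> x; exact: (ctX (cf x)).
  have i1 : integ `[0, X] (fun x => f x ^+ 2) by apply: integ_cc => x _; exact: cf2.
  have i2 : integ `[X, +oo[ (fun x => f x ^+ 2).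
    apply: (integ_dom (g := fun x => (1 + k^-1) * h x)) => //.
    - by apply: measurable_funS (continuous_measurable_fun cf2).
    - move=> x /=; rewrite in_itv /= andbT => Xx.
      by rewrite ger0_norm ?sqr_ge0 // hf.
    - exact: integZ.
  by have [] := hasint_cat_cy X0 (integ_hasint i1) (integ_hasint i2).
have k1 : 0 < k^-1 by rewrite invr_gt0.
apply: shot_mode; apply: lift => // x Xx.
  have a1 : k * w Ray x ^+ 2 <= pot l Ray x * w Ray x ^+ 2 by rewrite ler_wpM2r ?sqr_ge0 // hp.
  have a2 : k * w Ray x ^+ 2 <= h x by rewrite /h; have := sqr_ge0 (dw Ray x); lra.
  have a3 : w Ray x ^+ 2 <= k^-1 * h x by rewrite mulrC ler_pdivlMr // mulrC.
  have h0 : 0 <= h x by apply: le_trans a2; rewrite mulr_ge0 ?sqr_ge0 // ltW.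
  by rewrite mulrDl mul1r; lra.
have a1 : 0 <= pot l Ray x * w Ray x ^+ 2.
  by rewrite mulr_ge0 ?sqr_ge0 // (le_trans (ltW k0)) // hp.
have a2 : dw Ray x ^+ 2 <= h x by rewrite /h; lra.
have h0 : 0 <= k^-1 * h x by rewrite mulr_ge0 ?(ltW k1) // (le_trans (sqr_ge0 _) a2).
by rewrite mulrDl mul1r; lra.
Qed.

End one_shot.

Lemma shot_near A l w dw X : shot A l w dw -> 0 <= X -> exists2 K : R, 0 <= K &
  forall l' w' dw', shot A l' w' dw' -> `|l' - l| <= 1 ->
    (w' Ray X - w Ray X) ^+ 2 + (dw' Ray X - dw Ray X) ^+ 2 <= K * (l' - l) ^+ 2.
Proof.
move=> S X0.
have [C C0 hC] := pot_bound P l Circle; have [C' C0' hC'] := pot_bound P l Ray.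
have cw e : continuous (w e) by move=> x; exact: dv_cont (shD S e x).
have [M M0 hM] := cc_bounded (pi_ge0 R) (continuous_subspaceT (cw Circle)).
have [M' M0' hM'] := cc_bounded X0 (continuous_subspaceT (cw Ray)).
pose E := expR ((C + 1 + 2) * (pi - 0)); pose E' := expR ((C' + 1 + 2) * (X - 0)).
have E0 : 0 <= E by exact: expR_ge0.
have E0' : 0 <= E' by exact: expR_ge0.
exists ((4 * (M ^+ 2 * E) + M' ^+ 2) * E').
  by rewrite mulr_ge0 // addr_ge0 ?sqr_ge0 // mulr_ge0 // mulr_ge0 // sqr_ge0.
move=> l' w' dw' S' ll.
have step e (c d B N : R) : c <= d -> 0 <= B ->
    (forall x, c <= x <= d -> `|pot l e x| <= B) ->
    (forall x, c <= x <= d -> `|w e x| <= N) ->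
    (w' e d - w e d) ^+ 2 + (dw' e d - dw e d) ^+ 2 <=
    ((w' e c - w e c) ^+ 2 + (dw' e c - dw e c) ^+ 2 + (`|l' - l| * N) ^+ 2) *
      expR ((B + 1 + 2) * (d - c)).
  move=> cd B0 hB hN.
  apply: (@lin_ode_bound R (fun x => w' e x - w e x) (fun x => dw' e x - dw e x)
    (pot l' e) (fun x => - (l' - l) * w e x)) => //.
  - by rewrite addr_ge0.
  - by move=> x _; exact: dvB (shD S' e x) (shD S e x).
  - move=> x _; apply: dv_eq (dvB (shE S' e x) (shE S e x)) _.
    by rewrite /pot; ring.
  - move=> x /hB h; have -> : pot l' e x = pot l e x - (l' - l) by rewrite /pot; ring.
    by apply: le_trans (ler_normB _ _) _; exact: lerD.
  - by move=> x /hN h; rewrite normrM normrN ler_wpM2l.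
have b1 := step Circle 0 pi C M (pi_ge0 R) C0 _ hM.
rewrite (sh0 S) (sh0 S') (shd0 S) (shd0 S') !subrr expr0n /= !add0r in b1.
have {}b1 := b1 _.
have b2 := step Ray 0 X C' M' X0 C0' _ hM'.
rewrite (shv S) (shv S') (shdv S) (shdv S') in b2.
have nn : `|l' - l| ^+ 2 = (l' - l) ^+ 2 by rewrite real_normK // num_real.
rewrite !exprMn nn -/E -/E' in b1 b2.
have {}b1 : (w' Circle pi - w Circle pi) ^+ 2 + (dw' Circle pi - dw Circle pi) ^+ 2 <=
    (l' - l) ^+ 2 * M ^+ 2 * E.
  apply: b1 => x /andP[x1 x2]; apply: hC; apply/domE; rewrite x2 andbT.
  by apply: le_trans x1; rewrite oppr_le0 pi_ge0.
have {}b2 : (w' Ray X - w Ray X) ^+ 2 + (dw' Ray X - dw Ray X) ^+ 2 <=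
    ((w' Circle pi - w Circle pi) ^+ 2 + (2 * dw' Circle pi - 2 * dw Circle pi) ^+ 2 +
     (l' - l) ^+ 2 * M' ^+ 2) * E'.
  by apply: b2 => x /andP[x1 x2]; apply: hC'; apply/domE.
apply: le_trans b2 _.
rewrite [X in _ <= X](_ : _ = (4 * ((l' - l) ^+ 2 * M ^+ 2 * E) + (l' - l) ^+ 2 * M' ^+ 2) * E'); last by ring.
rewrite ler_wpM2r // lerD2r.
have := sqr_ge0 (w' Circle pi - w Circle pi).
have -> : (2 * dw' Circle pi - 2 * dw Circle pi) ^+ 2 = 4 * (dw' Circle pi - dw Circle pi) ^+ 2 by ring.
lra.
Qed.

Lemma shot_near_eps A l w dw X eps : shot A l w dw -> 0 <= X -> 0 < eps -> exists2 D : R, 0 < D &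
  forall l' w' dw', shot A l' w' dw' -> `|l - l'| < D ->
    `|w' Ray X - w Ray X| < eps /\ `|dw' Ray X - dw Ray X| < eps.
Proof.
move=> S X0 e0; have [K K0 hK] := shot_near S X0.
have K1 : 0 < K + 1 by rewrite ltr_wpDl.
exists (Num.min 1 (eps / (K + 1))).
  by rewrite lt_min ltr01 divr_gt0.
move=> l' w' dw' S'; rewrite lt_min distrC => /andP[/ltW d1 d2].
have := hK l' w' dw' S' d1.
have h : K * (l' - l) ^+ 2 < eps ^+ 2.
  rewrite -(real_normK (num_real (l' - l))).
  move: d2; rewrite ltr_pdivlMr // => d2.
  have n0 := normr_ge0 (l' - l).
  have : (`|l' - l| * (K + 1)) ^+ 2 < eps ^+ 2.
    by rewrite ltr_pXn2r // nnegrE ?mulr_ge0 // ltW.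
  apply: le_lt_trans; rewrite exprMn mulrC ler_wpM2l ?sqr_ge0 //.
  by have := sqr_ge0 K; rewrite sqrrD1; lra.
have sq (a : R) : a ^+ 2 < eps ^+ 2 -> `|a| < eps.
  by rewrite -(real_normK (num_real a)) ltr_pXn2r // nnegrE ?normr_ge0 // ltW.
have p1 := sqr_ge0 (w' Ray X - w Ray X); have p2 := sqr_ge0 (dw' Ray X - dw Ray X).
by move=> h'; split; apply: sq; lra.
Qed.

End shooting.

(** ** The sign at infinity *)

Section negative_level.
Context {R : realType}.
Implicit Types (a b c x y d t l X : R) (e : edge) (w dw z dz : edge -> R -> R).
Local Notation mu := (@lebesgue_measure R).
Local Notation dom := (@dom R).
Context (m : R) (u u1 u2 v v1 v2 : R -> R) (P : profile m u u1 u2 v v1 v2).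
Local Notation mode := (mode m u v).
Local Notation pot := (pot m u v).
Local Notation shot := (shot m u v).

Lemma shot_uniq A l w dw w' dw' X : shot A l w dw -> shot A l w' dw' -> 0 <= X ->
  w' Ray X = w Ray X.
Proof.
move=> S S' X0; have [K K0 hK] := shot_near P S X0.
have := hK l w' dw' S'; rewrite subrr normr0 ler01 expr0n /= mulr0 => /(_ isT) h.
have p1 := sqr_ge0 (w' Ray X - w Ray X); have p2 := sqr_ge0 (dw' Ray X - dw Ray X).
by apply/eqP; rewrite -subr_eq0 -sqrf_eq0; apply/eqP; lra.
Qed.

Lemma shot_not_null A l w dw : 0 < A -> shot A l w dw ->
  ~ (forall e, {ae mu, forall x, dom e x -> w e x = 0}).
Proof.
move=> A0 S /(_ Circle) h.
have cw : continuous (w Circle) by move=> x; exact: dv_cont (shD S Circle x).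
have cw2 : continuous (fun x => w Circle x ^+ 2) by move=> x; exact: (ctX (cw x)).
have [H _ dH] := primitive cw2.
have mD := measurable_dom (R := R) Circle.
have i1 : hasint (dom Circle) (fun x => w Circle x ^+ 2) (H pi - H (- pi)).
  apply: (@hasint_ftc _ (fun x => w Circle x ^+ 2)) => //; first exact: ltW pi2.
  by move=> x _; exact: cw2.
have i2 : hasint (dom Circle) (fun x => w Circle x ^+ 2) 0.
  apply: (hasint_ae (k := fun=> 0)) => //.
  - by apply: within_measurable; exact: continuous_subspaceT.
  - by apply: (ae_imp h) => x /= hx ex; rewrite hx // expr0n.
  - exact: hasint0.
have HH := hasint_uniq i1 i2.
have np : - pi < (0 : R) by rewrite oppr_lt0 pi_gt0.
have [|y /andP[y1 y2] hy] := pos_left np (cw 0); first by rewrite (sh0 S).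
have a1 : H (- pi) <= H y.
  by apply: (dv_ge0_le (ltW y1) (fun x _ => dH x)) => x _; exact: sqr_ge0.
have a2 : H 0 <= H pi.
  by apply: (dv_ge0_le (pi_ge0 R) (fun x _ => dH x)) => x _; exact: sqr_ge0.
have a3 : H y < H 0.
  apply: (dv_gt0_lt y2 (fun x _ => dH x)) => x /andP[/ltW x1 /ltW x2].
  by rewrite exprn_gt0 // hy // x1.
lra.
Qed.

Context (A X0 : R) (A0 : 0 < A) (X00 : 0 <= X0)
  (hX0 : forall x, X0 <= x -> m / 2 <= m - 15 * v x ^+ 4).

Let m0 : 0 < m := prm P.

Lemma far_pot l x : l <= m / 4 -> X0 <= x -> m / 4 <= pot l Ray x.
Proof. by move=> lm /hX0; rewrite /pot /=; lra. Qed.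

(** The two ways to miss an eigenvalue, growth with sign [sg] = 1 or -1; each is an open
    condition on the level. *)
Definition grows (sg l : R) := exists w dw X,
  [/\ shot A l w dw, X0 <= X, 0 < sg * w Ray X & 0 < sg * dw Ray X].

Lemma grows_open sg l : sg ^+ 2 = 1 -> grows sg l ->
  exists2 D : R, 0 < D & forall l', `|l - l'| < D -> grows sg l'.
Proof.
move=> sg2 [w [dw [X [S XX p1 p2]]]].
pose eps := Num.min (sg * w Ray X) (sg * dw Ray X).
have e0 : 0 < eps by rewrite lt_min p1.
have [D D0 hD] := shot_near_eps P S (le_trans X00 XX) e0.
exists D => // l' ll; have [w' [dw' S']] := shot_exists P A l'.
have [h1 h2] := hD l' w' dw' S' ll.
have ns : `|sg| = 1.
  apply/eqP; rewrite -(@pexpr_eq1 R _ 2) // real_normK ?sg2 //; exact: num_real.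
exists w', dw', X; split=> //.
  have : `|sg * (w' Ray X - w Ray X)| < sg * w Ray X.
    by rewrite normrM ns mul1r (lt_le_trans h1) // ge_min lexx.
  by rewrite ltr_norml => /andP[+ _]; lra.
have : `|sg * (dw' Ray X - dw Ray X)| < sg * dw Ray X.
  by rewrite normrM ns mul1r (lt_le_trans h2) // ge_min lexx orbT.
by rewrite ltr_norml => /andP[+ _]; lra.
Qed.

Lemma grows_persists l w dw X x : l <= m / 4 -> shot A l w dw -> X0 <= X ->
  0 < growth w dw X -> X <= x -> 0 < w Ray X * w Ray x.
Proof.
move=> lm S XX gX Xx; apply: (growth_persists S _ gX Xx).2 => y Xy.
by apply: le_trans (far_pot lm (le_trans XX Xy)); rewrite divr_ge0 // ltW.
Qed.

Lemma grows_excl l : l <= m / 4 -> grows 1 l -> grows (-1) l -> False.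
Proof.
move=> lm [w [dw [X [S XX p1 p2]]]] [w' [dw' [Y [S' YY n1 n2]]]].
rewrite !mul1r in p1 p2; rewrite !mulN1r !oppr_gt0 in n1 n2.
have gX : 0 < growth w dw X by rewrite mulr_gt0.
have gY : 0 < growth w' dw' Y by rewrite nmulr_rgt0.
have [XY|/ltW YX] := leP X Y.
  have := grows_persists lm S XX gX XY.
  rewrite (shot_uniq S' S (le_trans X00 YY)) pmulr_rgt0 //; lra.
have := grows_persists lm S' YY gY YX.
rewrite (shot_uniq S S' (le_trans X00 XX)) nmulr_rgt0 //; lra.
Qed.

Lemma not_grows_mode l w dw : l <= m / 4 -> shot A l w dw -> ~ grows 1 l -> ~ grows (-1) l ->
  mode l w dw.
Proof.
move=> lm S n1 n2.
apply: (decaying_mode P S (X := X0) (k := m / 4)) => //; first by rewrite divr_gt0.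
  by move=> x; exact: far_pot.
move=> x Xx; rewrite leNgt; apply/negP => g0.
have [p|n|e] := ltgtP 0 (w Ray x).
- apply: n1; exists w, dw, x; rewrite !mul1r; split=> //.
  by move: g0; rewrite /growth pmulr_rgt0.
- apply: n2; exists w, dw, x; rewrite !mulN1r !oppr_gt0; split=> //.
  by move: g0; rewrite /growth nmulr_rgt0.
by move: g0; rewrite /growth -e mul0r ltxx.
Qed.

(** Far below, the potential is at least 1 and positive data grow from the start. *)
Lemma grows_low : exists2 L : R, 0 <= L & grows 1 (- L).
Proof.
have [C C0 hC] := pot_bound P 0 Circle; have [C' C0' hC'] := pot_bound P 0 Ray.
pose L := C + C' + 1.
have L0 : 0 <= L by rewrite !addr_ge0.
exists L => //; have [w [dw S]] := shot_exists P A (- L).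
have potL e x : dom e x -> 1 <= pot (- L) e x.
  move=> ex; have -> : pot (- L) e x = pot 0 e x + L by rewrite /pot; ring.
  have : - (C + C') <= pot 0 e x.
    case: e ex => ex; [have := hC x ex|have := hC' x ex]; rewrite ler_norml => /andP[]; lra.
  by rewrite /L; lra.
have potC x : 0 <= x <= pi -> 1 <= pot (- L) Circle x.
  move=> /andP[x0 xp]; apply: potL; apply/domE; rewrite xp andbT.
  by apply: le_trans x0; rewrite oppr_le0 pi_ge0.
pose k x := w Circle x * dw Circle x.
pose k1 x := dw Circle x ^+ 2 + pot (- L) Circle x * w Circle x ^+ 2.
have dk x : dv k x (k1 x).
  by apply: dv_eq (dvM (shD S Circle x) (shE S Circle x)) _; rewrite /k1; ring.
have k0 : k 0 = 0 by rewrite /k (shd0 S) mulr0.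
have kx x : 0 <= x <= pi -> 0 <= k x.
  move=> /andP[x0 xp]; suff : k 0 <= k x by rewrite k0.
  apply: (@dv_ge0_le R k k1 0 x x0 (fun t _ => dk t)) => z /andP[/ltW z0 /ltW zx].
  rewrite /k1 addr_ge0 ?sqr_ge0 // mulr_ge0 ?sqr_ge0 //.
  by apply: le_trans ler01 (potC z _); rewrite z0 (le_trans zx).
have w2 x : 0 <= x <= pi -> A ^+ 2 <= w Circle x ^+ 2.
  move=> /andP[x0 xp]; suff : w Circle 0 ^+ 2 <= w Circle x ^+ 2 by rewrite (sh0 S).
  apply: (@dv_ge0_le R (fun t => w Circle t ^+ 2) (fun t => 2 * w Circle t * dw Circle t) 0 x x0).
    by move=> z _; apply: dv_eq (dvX 2 (shD S Circle z)) _; rewrite expr1.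
  move=> z /andP[/ltW z0 /ltW zx]; rewrite -mulrA mulr_ge0 // kx // z0; exact: le_trans xp.
have A2 : 0 < A ^+ 2 by rewrite exprn_gt0.
have wpos : 0 < w Circle pi.
  rewrite ltNge; apply/negP => neg.
  have [||c hc wc] := @ivt R (w Circle) 0 pi 0 (pi_ge0 R).
  - by move=> z _; exact: dv_cont (shD S Circle z).
  - by right; rewrite (sh0 S) neg ltW.
  by have := w2 c hc; rewrite wc expr0n /=; lra.
have kpi : 0 < k pi.
  suff : k 0 < k pi by rewrite k0.
  apply: (@dv_gt0_lt R k k1 0 pi (pi_gt0 R) (fun t _ => dk t)) => z /andP[/ltW z0 /ltW zp].
  have hz : 0 <= z <= pi by rewrite z0.
  rewrite /k1 ltr_wpDl ?sqr_ge0 // mulr_gt0 //; first exact: lt_le_trans ltr01 (potC z hz).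
  exact: lt_le_trans (w2 z hz).
have dwpos : 0 < dw Circle pi by move: kpi; rewrite /k pmulr_rgt0.
have g0 : 0 < growth w dw 0.
  by rewrite /growth (shv S) (shdv S) !mulr_gt0.
have pR x : 0 <= x -> 0 <= pot (- L) Ray x.
  by move=> x0; apply: le_trans ler01 (potL _ _ _); apply/domE.
have [gX wX] := growth_persists S pR g0 X00.
rewrite (shv S) pmulr_rgt0 // in wX.
exists w, dw, X0; rewrite !mul1r; split=> //.
by move: gX; rewrite /growth pmulr_rgt0.
Qed.

End negative_level.

Section negative_eigenvalue.
Context {R : realType}.
Implicit Types (a b c x y d t l X : R) (e : edge) (w dw z dz : edge -> R -> R).
Local Notation mu := (@lebesgue_measure R).
Local Notation dom := (@dom R).
Context (m : R) (u u1 u2 v v1 v2 : R -> R) (P : profile m u u1 u2 v v1 v2).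
Context (SV : stable m u v).
Local Notation mode := (mode m u v).
Local Notation pot := (pot m u v).

Let m0 : 0 < m := prm P.

Lemma far_exists : exists2 X0, 0 <= X0 & forall x, X0 <= x -> m / 2 <= m - 15 * v x ^+ 4.
Proof.
pose eps := Num.min 1 (m / 30).
have e0 : 0 < eps by rewrite lt_min ltr01 divr_gt0.
have e1 : eps <= 1 by rewrite ge_min lexx.
have e2 : eps <= m / 30 by rewrite ge_min lexx orbT.
have [X X0 hX] := v_vanish P e0; exists X => // x /hX vx.
have : v x ^+ 4 <= eps.
  have -> : v x ^+ 4 = `|v x| ^+ 4 by rewrite -normrX ger0_norm // (@exprn_even_ge0 _ 4).
  apply: le_trans (_ : eps ^+ 4 <= _); first by rewrite lerXn2r ?nnegrE ?(ltW e0) ?(ltW vx).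
  by rewrite exprS ler_piMr ?exprn_ile1 // ltW.
lra.
Qed.

(** At the level 0 the solution outgrows v', which has the other sign, because their
    Wronskian is the determinant of the even solution lemma. *)
Lemma grows_zero A X0 s s1 :
  (forall x, - pi <= x <= pi -> dv s x (s1 x)) ->
  (forall x, - pi <= x <= pi -> dv s1 x ((m - 15 * u x ^+ 4) * s x)) ->
  s 0 = A -> s1 0 = 0 -> 0 < A -> 0 <= X0 ->
  (forall x, X0 <= x -> m / 2 <= m - 15 * v x ^+ 4) ->
  s pi * (m * u pi - 3 * u pi ^+ 5) - 4 * s1 pi * u1 pi < 0 ->
  ~ grows m u v A X0 1 0.
Proof.
move=> ds ds1 s0 s10 A0 X00 hX0 D0 [w [dw [X [S XX p1 p2]]]].
rewrite !mul1r in p1 p2.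
have X0' : 0 <= X by exact: le_trans XX.
have [e1 e2] : w Circle pi = s pi /\ dw Circle pi = s1 pi.
  apply: (circle_uniq P (l := 0) _ _ ds _ _ _ pi_circle).
  - by move=> x _; exact: (shD S Circle).
  - by move=> x _; exact: (shE S Circle).
  - by move=> x hx; rewrite /pot subr0; exact: ds1.
  - by rewrite (sh0 S).
  - by rewrite (shd0 S).
pose V2 x := m * v x - 3 * v x ^+ 5.
pose W x := w Ray x * V2 x - dw Ray x * v1 x.
pose D := s pi * (m * u pi - 3 * u pi ^+ 5) - 4 * s1 pi * u1 pi.
have W0 : W 0 = D.
  by rewrite /W /V2 (shv S) (shdv S) e1 e2 (v0E P) (v10E P) /D; ring.
have WD x : 0 <= x -> W x = D.
  move=> x0; rewrite -W0; apply: (@dv0_cst _ W 0 x); rewrite ?lexx ?x0 //.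
  move=> y /andP[y0 _]; apply: dv_eq (dvB (dvM (shD S Ray y) (dvV2 P y))
    (dvM (shE S Ray y) (dvv1 P y0))) _.
  by rewrite /= /pot /=; ring.
have gX : 0 < growth w dw X by rewrite mulr_gt0.
have wpos x : X <= x -> 0 < w Ray x.
  move=> Xx; have m4 : 0 <= m / 4 by rewrite divr_ge0 // ltW.
  by have := grows_persists P hX0 m4 S XX gX Xx; rewrite pmulr_rgt0.
have vneg x : X <= x -> v1 x < 0.
  by move=> Xx; apply: (v1_lt0 P SV); exact: le_trans Xx.
pose rho x := w Ray x / v1 x.
have rneg x : X <= x -> rho x < 0.
  by move=> Xx; rewrite /rho pmulr_rlt0 ?invr_lt0 ?vneg ?wpos.
have drho x : X <= x -> dv rho x (- D / v1 x ^+ 2).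
  move=> Xx; have n0 : v1 x != 0 by rewrite lt_eqF ?vneg.
  have x0 : 0 <= x by exact: le_trans Xx.
  apply: dv_eq (dvM (shD S Ray x) (dvV n0 (dvv1 P x0))) _.
  by rewrite -(WD x x0) /W /V2; field.
pose eps := Num.min 1 (- D).
have e0 : 0 < eps by rewrite lt_min ltr01 oppr_gt0.
have [Y Y0 hY] := v1_vanish P e0.
pose Z := Num.max X Y.
have [ZX ZY] : X <= Z /\ Y <= Z by rewrite !le_max !lexx orbT.
pose T := - rho Z.
have T0 : 0 < T by rewrite oppr_gt0 rneg.
have ZT : Z <= Z + T by rewrite lerDl ltW.
have : rho Z - Z <= rho (Z + T) - (Z + T).
  apply: (dv_ge0_le (f := fun x => rho x - x) (df := fun x => - D / v1 x ^+ 2 - 1) ZT).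
    by move=> x /andP[x1 _]; exact: dvB (drho x (le_trans ZX x1)) (dv_id x).
  move=> x /andP[/ltW x1 _]; rewrite subr_ge0.
  have n0 : v1 x < 0 := vneg x (le_trans ZX x1).
  rewrite ler_pdivlMr ?mul1r; last by rewrite exprn_even_gt0 //= lt_eqF.
  have vx := ltW (hY x (le_trans ZY x1)).
  have e1' : eps <= 1 by rewrite ge_min lexx.
  have e2' : eps <= - D by rewrite ge_min lexx orbT.
  apply: le_trans e2'; rewrite -(real_normK (num_real (v1 x))).
  apply: le_trans (_ : eps ^+ 2 <= _); first by rewrite lerXn2r ?nnegrE ?(ltW e0).
  by rewrite expr2 ler_piMr // ltW.
have := rneg (Z + T) (le_trans ZX ZT); rewrite /T; lra.
Qed.

(** Growth is positive far below and negative at the level 0. Both being open conditions, an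
    interval of levels is not exhausted by them, and in between there is an eigenvalue. *)
Lemma negative_exists : exists l w dw, [/\ l < 0, mode l w dw &
  ~ (forall e, {ae mu, forall x, dom e x -> w e x = 0})].
Proof.
have [s [s1 [ds ds1 _ [s10 s00] D0]]] := even_solution P SV.
have [X0 X00 hX0] := far_exists.
pose A := s 0.
have m4 : 0 < m / 4 by rewrite divr_gt0.
have g0 := grows_zero ds ds1 (erefl A) s10 s00 X00 hX0 D0.
have n0 : grows m u v A X0 (-1) 0.
  apply: contrapT => ng; have [w [dw S]] := shot_exists P A 0.
  have M := not_grows_mode P X00 hX0 (ltW m4) S g0 ng.
  have := kernel_trivial P SV M (e := Circle) (x := 0).
  by rewrite domE (sh0 S) => /(_ zero_circle) e; move: s00; rewrite -/A e ltxx.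
have [L L0 gL] := grows_low P s00 X00.
have [l hl [h1 h2]] : exists2 l, - L <= l <= 0 & ~ grows m u v A X0 1 l /\ ~ grows m u v A X0 (-1) l.
  apply: contrapT => no.
  have all l : - L <= l <= 0 -> grows m u v A X0 1 l \/ grows m u v A X0 (-1) l.
    move=> hl; apply: contrapT => nn; apply: no; exists l => //.
    by split=> g; apply: nn; [left|right].
  pose h l : R := if `[< grows m u v A X0 1 l >] then 1 else - 1.
  have h1 l : grows m u v A X0 1 l -> h l = 1 by rewrite /h => /asboolT ->.
  have h2 l : ~ grows m u v A X0 1 l -> h l = - 1 by rewrite /h => /asboolF ->.
  have nL : - L <= 0 by rewrite oppr_le0.
  have [||c hc hc0] := @ivt R h (- L) 0 0 nL.
  - move=> l hl; apply: cvg_near_cst.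
    have [g|g] := all l hl.
      have [|D D0' hD] := grows_open P X00 _ g; first by rewrite expr1n.
      by exists D => //= y yD; rewrite (h1 l g) h1 //; exact: hD.
    have [|D D0' hD] := grows_open P X00 _ g; first by rewrite sqrrN expr1n.
    have ng l' : l' <= m / 4 -> grows m u v A X0 (-1) l' -> ~ grows m u v A X0 1 l'.
      by move=> lm gn gp; exact: (grows_excl P X00 hX0 lm gp gn).
    exists (Num.min D (m / 4)) => /= [|y]; first by rewrite lt_min D0'.
    rewrite /ball_ /= lt_min => /andP[yD ym]; rewrite (h2 l) ?h2 //.
      apply: ng (hD y yD); move: ym; rewrite ltr_norml => /andP[ym _].
      by case/andP: hl => _ l0; lra.
    by apply: ng g; case/andP: hl => _ l0; lra.
  - by right; rewrite h2 // h1 // lerN10 ler01.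
  by move: hc0; rewrite /h; case: ifP => _ /eqP; rewrite ?oppr_eq0 oner_eq0.
case/andP: hl => _ l0.
have ln : l < 0.
  by rewrite lt_neqAle l0 andbT; apply/eqP => e; apply: h2; rewrite e.
have [w [dw S]] := shot_exists P A l.
exists l, w, dw; split=> //; last exact: shot_not_null s00 S.
by apply: (not_grows_mode P X00 hX0) S h1 h2; lra.
Qed.

End negative_eigenvalue.

(** * The minimizer *)

Section minimizer.
Context {R : realType}.
Implicit Types (a b c x y d t l : R) (e : edge) (w dw : edge -> R -> R) (U V : tadfun R).
Local Notation mu := (@lebesgue_measure R).
Local Notation dom := (@dom R).

(** Values off the edge are invisible to the weak derivative, even to the chosen one. *)
Lemma wderiv_ext e (f g : R -> R[i]) : (forall x, dom e x -> f x = g x) ->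
  wderiv (dom e) f = wderiv (dom e) g.
Proof.
move=> fg; rewrite /wderiv; congr (xget _ _); apply/seteqP.
have h (f' g' k : R -> R[i]) : (forall x, dom e x -> f' x = g' x) ->
    weak_derivative (dom e) f' k -> weak_derivative (dom e) g' k.
  move=> fg' /weak_rweak[h1 h2]; apply/weak_rweak; split.
    by apply: rweak_ext h1 => // x ex; rewrite fg'.
  by apply: rweak_ext h2 => // x ex; rewrite fg'.
split=> k [sk wk]; split=> //; first exact: h fg wk.
by apply: (h g f) wk => x ex; rewrite fg.
Qed.

Lemma Lnorm_tad_ext q U V : (forall e x, dom e x -> normc (U e x) = normc (V e x)) ->
  Lnorm_tad q U = Lnorm_tad q V.
Proof.
move=> UV; rewrite /Lnorm_tad; congr (_ `^ _)%E; congr (_ + _)%E;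
  by apply: eq_integral => x; rewrite inE => ex; rewrite UV.
Qed.

Lemma B_form_ext omega U V : (forall e x, dom e x -> U e x = V e x) ->
  B_form omega U = B_form omega V.
Proof.
move=> UV; rewrite /B_form (Lnorm_tad_ext _ (U := U) (V := V)); last by move=> e x /UV ->.
rewrite (Lnorm_tad_ext _ (U := nabla U) (V := nabla V)) // => e x _.
by rewrite /nabla (wderiv_ext (UV e)).
Qed.

Lemma hasint_pos a b (f : R -> R) (v : R) : a < b -> {within `[a, b], continuous f} ->
  (forall x, a <= x <= b -> 0 < f x) -> hasint `[a, b] (fun x => f x ^+ 2) v -> 0 < v.
Proof.
move=> ab cf f0 hv; have [c] := EVT_min (ltW ab) cf.
rewrite in_itv /= => hc cmin.
have fc := f0 c hc.
have h : hasint `[a, b] (fun=> f c ^+ 2) (f c ^+ 2 * b - f c ^+ 2 * a).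
  apply: (@hasint_ftc _ (fun=> f c ^+ 2) _ (fun x => f c ^+ 2 * x)) => //; first exact: ltW.
    move=> x _; apply: dv_eq (dvM (dv_cst (f c ^+ 2) x) (dv_id x)) _.
    by rewrite mulr1 mulr0 addr0.
  by move=> x _; exact: ctC.
have mI : measurable (`[a, b] : set R) by exact: measurable_itv.
apply: (lt_le_trans _ (hasint_le mI h hv _)).
  by rewrite -mulrBr mulr_gt0 ?exprn_gt0 // subr_gt0.
move=> x /=; rewrite in_itv /= => hx.
by rewrite lerXn2r ?nnegrE ?(ltW fc) ?(ltW (f0 x hx)) // cmin // in_itv.
Qed.

Lemma pos_real (z : R[i]) : 0 < z -> z = (complex.Re z)%:C /\ 0 < complex.Re z.
Proof.
by case: z => a b; rewrite ltcE /= => /andP[/eqP -> ?].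
Qed.

Lemma calB_gt0 omega (Psi : tadfun R) : omega < 0 -> global_minimizer omega Psi ->
  tad_positive Psi -> 0 < calB omega.
Proof.
move=> w0 [[[hP _] _] <-] pos.
have mD e := measurable_dom (R := R) e.
have l2 e : L2 (dom e) (fun x => complex.Re (Psi e x)).
  have [_ _ s _] := hP e; exact: ((sqint_L2 _ (mD e)).1 s).1.
have [v hv] : exists v, ht (fun e x => complex.Re (Psi e x) ^+ 2) v.
  by apply: ht_integ => e; case: (l2 e).
have v0 : 0 < v.
  case: hv => z1 [z2 [h1 h2 ->]].
  rewrite ltr_wpDr //; first by apply: hasint_ge0 h2 _ => x _; exact: sqr_ge0.
  apply: (hasint_pos (f := fun x => complex.Re (Psi Circle x)) (pi2 (R := R)) _ _ h1).
    by have [+ _ _ _] := hP Circle.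
  by move=> x hx; apply: (pos_real _).2; apply: pos; apply/domE.
have e2 : fine (Lnorm_tad 2 Psi) ^+ 2 = v.
  apply: fine_Lnorm2; apply: ht_ext hv => e x ex.
  rewrite {2}(pos_real (pos e x ex)).1 normc_real real_normK //; exact: num_real.
rewrite /B_form e2 ltr_wpDl ?sqr_ge0 // oppr_gt0 nmulr_rlt0 //.
Qed.

Lemma profile_exists omega (Phi : tadfun R) : omega < 0 -> tad_positive Phi ->
  H2NK Phi -> stationary_NLS omega Phi -> exists u u1 u2 v v1 v2,
    profile (- omega) u u1 u2 v v1 v2 /\
    forall e x, dom e x -> Phi e x = (phi u v e x)%:C.
Proof.
move=> w0 pos hPhi eqPhi.
have re e x : dom e x -> Phi e x = (complex.Re (Phi e x))%:C.
  by move=> ex; exact: (pos_real (pos e x ex)).1.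
have [dU [d2U [H _ lap]]] := H2NK_real hPhi.
set f := (fun e x => complex.Re (Phi e x)) in H.
pose W e x := (- omega) * f e x - 3 * f e x ^+ 5.
have cf e : {within dom e, continuous (f e)} by exact: (h2c H).
have cW e : {within dom e, continuous (W e)}.
  move/subspace_continuousP : (cf e) => ck.
  apply/subspace_continuousP => x ex; apply: cvgB; apply: cvgM; try exact: cvg_cst.
    exact: ck.
  exact: (cvg_comp _ _ (ck x ex) (@exprn_continuous _ 5 _)).
have hW e : {ae mu, forall x, dom e x -> complex.Re (d2U e x) = W e x}.
  apply: (ae_imp2 (lap e) (eqPhi e)) => x /= h1 h2 ex.
  rewrite -h1 // /W /f; have := h2 ex; rewrite re //; set a := complex.Re (Phi e x) => {}h2.
  have -> : laplacian Phi e x = ((- omega) * a - 3 * a ^+ 5)%:C.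
    have -> : laplacian Phi e x = - (omega%:C * a%:C) - 3 * a%:C ^+ 5 by rewrite -h2; ring.
    by rewrite !(rmorphM, rmorphB, rmorphXn, rmorphN) /= rmorph_nat; ring.
  by [].
have [w [dw [h1 h2 h3 h4]]] := H2_real_C2 H cW hW.
have cW' e : continuous (fun x => W e (clamp e x)) by exact: clamp_continuous.
have [p1 p2 p3] := vertex_dom (R := R).
have [v1' v2'] := h2v H; have kk := h2k H.
have wpos e x : dom e x -> 0 < w e x.
  by move=> ex; rewrite -h3 //; exact: (pos_real (pos e x ex)).2.
have E e x : dom e x -> W e (clamp e x) = (- omega) * w e x - 3 * w e x ^+ 5.
  by move=> ex; rewrite clamp_id // /W h3.
exists (w Circle), (dw Circle), (fun x => W Circle (clamp Circle x)),
  (w Ray), (dw Ray), (fun x => W Ray (clamp Ray x)); split; last first.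
  by case=> x ex /=; rewrite re // -h3.
split=> //.
- by rewrite oppr_gt0.
- by move=> x hx; apply: E; apply/domE.
- by move=> x hx; apply: E; apply/domE.
- by move=> x hx; apply: wpos; apply/domE.
- by move=> x hx; apply: wpos; apply/domE.
- by apply: L2_ext (h2l H Ray); [exact: measurable_dom|exact: h3].
- by apply: L2_ext (h2l1 H Ray); [exact: measurable_dom|exact: h4].
- by rewrite -!h3.
- by rewrite -!h4.
Qed.

(** The factor c = (calB / 3)^(1/4) turns the normalization of Psi into N(Phi) = c^6 and
    B(Phi) = 3 N(Phi). *)
Lemma minimizer_second_variation omega (Psi Phi : tadfun R) u u1 u2 v v1 v2 :
  omega < 0 -> global_minimizer omega Psi -> tad_positive Psi ->
  Phi = (fun e x => ((calB omega / 3) `^ (4^-1))%:C * Psi e x) ->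
  profile (- omega) u u1 u2 v v1 v2 ->
  (forall e x, dom e x -> Phi e x = (phi u v e x)%:C) ->
  stable (- omega) u v.
Proof.
move=> w0 gm pos PE P PhiE.
have B0 := calB_gt0 w0 gm pos.
case: gm => [[hP N6] BP].
set c := (calB omega / 3) `^ (4^-1) in PE.
have c0 : 0 < c by rewrite powR_gt0 // divr_gt0.
have c4 : calB omega = 3 * c ^+ 4.
  rewrite -powR_mulrn ?(ltW c0) // -powRrM mulVf // powRr1; first by field.
  by rewrite divr_ge0 // ltW.
have PsiE e x : dom e x -> Psi e x = cplx (fun e x => c^-1 * phi u v e x) e x.
  move=> ex; have := PhiE e x ex; rewrite PE /cplx rmorphM /= => <-.
  by rewrite mulrA -rmorphM mulVf ?rmorph1 ?mul1r // gt_eqF.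
have eP := phi_energy P.
have [n hn] := energy_exp 4 eP; have [a ha] := energy_grad2 eP; have [b hb] := energy_exp 0 eP.
have nc : n = c ^+ 6.
  have h : ht (fun e x => normc (Psi e x) ^+ 6) (c^-1 ^+ 6 * n).
    apply: ht_ext (htZ (c^-1 ^+ 6) hn) => e x ex.
    rewrite PsiE // /cplx normc_real -exprMn -[6%N]/(2 * 3)%N exprM [in RHS]exprM.
    by rewrite real_normK // num_real.
  have n0 : 0 <= c^-1 ^+ 6 * n.
    by apply: ht_ge0 h _ => e x _; rewrite -[6%N]/(2 * 3)%N exprM exprn_ge0 ?sqr_ge0.
  move: N6; rewrite (Lnorm_tad_ht h) => -[] h1.
  have : (c^-1 ^+ 6 * n) `^ (6%:R^-1) `^ 6%:R = 1 by rewrite h1 powR1.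
  rewrite -powRrM mulVf // powRr1 // exprVn => e.
  by rewrite -[LHS](mulVKf (_ : c ^+ 6 != 0)) ?e ?mulr1 // gt_eqF // exprn_gt0.
have ab : a - omega * b = 3 * n.
  have e2 : ht (fun e x => (c^-1 * dphi u1 v1 e x) ^+ 2) (c^-1 ^+ 2 * a).
    by apply: ht_ext (htZ (c^-1 ^+ 2) ha) => e x _; rewrite exprMn.
  have e3 : ht (fun e x => (c^-1 * phi u v e x) ^+ 2) (c^-1 ^+ 2 * b).
    by apply: ht_ext (htZ (c^-1 ^+ 2) hb) => e x _; rewrite exprMn.
  have := B_form_energy omega (energyZ c^-1 eP) e2 e3.
  rewrite -(B_form_ext omega PsiE) BP c4 nc => e.
  have -> : 3 * c ^+ 6 = c ^+ 2 * (3 * c ^+ 4) by ring.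
  by rewrite e; field; rewrite gt_eqF.
move=> w dw q ew h5 hq.
apply: (second_variation w0 eP ew hn _ ha hb ab _ h5 hq).
  by rewrite nc exprn_gt0.
by rewrite c4 nc; ring.
Qed.

End minimizer.

Theorem theorem1p2 (R : realType) (omega : R) (Psi Phi : tadfun R) :
  omega < 0 ->
  global_minimizer omega Psi ->
  tad_positive Psi ->
  Phi = (fun e x => ((calB omega / 3) `^ (4^-1))%:C * Psi e x) ->
  H2NK Phi ->
  stationary_NLS omega Phi ->
  morse_index omega Phi = 1%E /\ nullity omega Phi = 0%E.
Proof.
move=> w0 gm pos PE hPhi eqPhi.
have posPhi : tad_positive Phi.
  move=> e x ex; rewrite PE mulr_gt0 ?pos // ltcR powR_gt0 // divr_gt0 //.
  exact: calB_gt0 gm pos.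
have [u [u1 [u2 [v [v1 [v2 [P PhiE]]]]]]] := profile_exists w0 posPhi hPhi eqPhi.
have SV := minimizer_second_variation w0 gm pos PE P PhiE.
rewrite -[omega]opprK; split; last exact: (nullityE P SV PhiE).
have [l [w [dw [l0 M nn]]]] := negative_exists P SV.
exact: (morse_indexE P SV PhiE l0 M nn).
Qed.
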